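(* Let $K$ be a primitive quartic CM field different from $\mathbb{Q}(\zeta_5)$ whose real quadratic subfield $K_0$ has class number one. Let $\mathfrak{l}$ be an ideal of $\mathcal{O}_{K_0}$ of prime norm $\ell$ which is generated by a totally positive element of $\mathcal{O}_{K_0}$. Let $A$ be a principally polarizable abelian surface defined over $\mathbb{C}$ whose endomorphism ring is an order $\mathcal{O}$ of $K$, and assume that $\mathcal{O}$ has locally maximal real multiplication at $\mathfrak{l}$. Let $\mathfrak{f}$ be the conductor of $\mathcal{O}$. 1. Assume that $\mathfrak{l}\mathcal{O}_K$ is coprime to $\mathfrak{f}$. Then: (a) If $\mathfrak{l}$ splits into two ideals in $\mathcal{O}_K$, then there are, up to isomorphism, exactly two horizontal $\mathfrak{l}$-isogenies starting from $A$, and all the other $\mathfrak{l}$-isogenies starting from $A$ are descending. (b) If $\mathfrak{l}$ ramifies in $\mathcal{O}_K$, then there is, up to isomorphism, exactly one horizontal $\mathfrak{l}$-isogeny starting from $A$, and all the others are descending. (c) If $\mathfrak{l}$ is inert in $K$, then all $\ell+1$ $\mathfrak{l}$-isogenies starting from $A$ are descending. 2. If $\mathfrak{l}$ is not coprime to $\mathfrak{f}$, then, up to isomorphism, there are exactly one ascending $\mathfrak{l}$-isogeny and $\ell$ descending $\mathfrak{l}$-isogenies starting from $A$.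
   Context: A quartic CM field is primitive if it contains no imaginary quadratic subfield. The conductor of an order $\mathcal{O}\subset K$ is $\mathfrak{f}_{\mathcal{O}}=\{x\in\mathcal{O}_K : x\mathcal{O}_K\subset\mathcal{O}\}$. An order $\mathcal{O}$ of $K$ has locally maximal real multiplication at $\mathfrak{l}$ if, with $\mathcal{O}_0=\mathcal{O}\cap K_0$, the index $[\mathcal{O}_{K_0}:\mathcal{O}_0]$ is prime to $\ell$ (so that $\mathcal{O}_{K_0}$ is contained in $\mathcal{O}$ locally at $\mathfrak{l}$). In that case write $\mathcal{O}_{K_0,\mathfrak{l}}$ for the completion of $\mathcal{O}_{K_0}$ at $\mathfrak{l}$ and $\mathcal{O}_{\mathfrak{l}}=\mathcal{O}\otimes_{\mathcal{O}_0}\mathcal{O}_{K_0,\mathfrak{l}}$, which contains $\mathcal{O}_{K_0,\mathfrak{l}}$. For an abelian surface $A$ with $\mathrm{End}(A)\cong\mathcal{O}$, set $A[\mathfrak{l}]=\{x\in A : \beta x=0 \text{ for all } \beta\in\mathfrak{l}\cap\mathcal{O}_0\}$, a group isomorphic to $(\mathbb{Z}/\ell\mathbb{Z})^2$. An $\mathfrak{l}$-isogeny starting from $A$ is an isogeny $A\to B$ whose kernel is a cyclic subgroup of order $\ell$ of $A[\mathfrak{l}]$; isogenies are considered up to isomorphism. The endomorphism rings $\mathcal{O}_A=\mathrm{End}(A)$ and $\mathcal{O}_B=\mathrm{End}(B)$ are viewed as orders in $K$ by means of the embeddings of $K$ in $\mathrm{End}(A)\otimes\mathbb{Q}$ and $\mathrm{End}(B)\otimes\mathbb{Q}$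 compatible with the isogeny. An $\mathfrak{l}$-isogeny $A\to B$ is horizontal if $\mathcal{O}_A\simeq\mathcal{O}_B$; it is descending if $(\mathcal{O}_B)_{\mathfrak{l}}\subsetneq(\mathcal{O}_A)_{\mathfrak{l}}$, and ascending if $(\mathcal{O}_A)_{\mathfrak{l}}\subsetneq(\mathcal{O}_B)_{\mathfrak{l}}$. *)

(* Defs.v *)
From HB Require Import structures.
From mathcomp Require Import all_boot all_order all_algebra all_field.
From mathcomp Require Import complex.
From mathcomp Require Import boolp classical_sets functions reals.

Set Implicit Arguments.
Unset Strict Implicit.
Unset Printing Implicit Defensive.

Import Order.TTheory GRing.Theory Num.Theory.

Local Open Scope classical_set_scope.
Local Open Scope ring_scope.

(* [M : N] = n, for additive subgroups N <= M of an abelian group: t lists a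
   system of representatives of M / N. *)
Definition has_index (V : zmodType) (M N : set V) (n : nat) : Prop :=
  exists t : 'I_n -> V,
    (forall i, M (t i)) /\ (forall x, M x -> exists! i, N (x - t i)).

Section NumberFields.
Variables (R : realType) (L : fieldExtType rat).

Definition totally_real : Prop :=
  forall (phi : {rmorphism L -> R[i]}) (x : L), complex.Im (phi x) = 0.

Definition totally_imaginary : Prop :=
  forall phi : {rmorphism L -> R[i]}, exists x : L, complex.Im (phi x) <> 0.

Definition totally_positive (x : L) : Prop :=
  forall phi : {rmorphism L -> R}, 0 < phi x.

End NumberFields.

Definition real_quadratic (R : realType) (K : fieldExtType rat)
    (F : {subfield K}) : Prop :=
  \dim F = 2 /\ totally_real R (subvs_of F).

Definition imaginary_quadratic (R : realType) (K : fieldExtType rat)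
    (F : {subfield K}) : Prop :=
  \dim F = 2 /\ totally_imaginary R (subvs_of F).

Definition CM_field (R : realType) (K : fieldExtType rat) : Prop :=
  totally_imaginary R K /\
  exists F : {subfield K},
    \dim {:K} = (2 * \dim F)%N /\ totally_real R (subvs_of F).

Definition primitive_quartic_CM (R : realType) (K : fieldExtType rat) : Prop :=
  [/\ CM_field R K, \dim {:K} = 4
    & ~ exists F : {subfield K}, imaginary_quadratic R F].

(* Subrings, ideals and orders of K and of its subfields are all taken as
   subsets of K. *)
Section Arithmetic.
Variable K : fieldExtType rat.
Implicit Types (F : {vspace K}) (O I J P : set K).

Definition integers F : set K :=
  [set x | x \in F /\ integralOver (intr : int -> K) x].

Definition is_order O : Prop :=
  [/\ O 1, (forall x y, O x -> O y -> O (x * y))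
    & exists b : (\dim {:K}).-tuple K, basis_of {:K} b /\ O = inIntSpan b].

Definition is_ideal O I : Prop :=
  [/\ I `<=` O, I 0, (forall x y, I x -> I y -> I (x + y))
    & (forall a x, O a -> I x -> I (a * x))].

Definition is_prime_ideal O P : Prop :=
  [/\ is_ideal O P, ~ P 1
    & forall x y, O x -> O y -> P (x * y) -> P x \/ P y].

Definition principal O (a : K) : set K := [set a * x | x in O].

Definition ideal_mul I J : set K :=
  [set x | exists n (a b : 'I_n -> K),
     [/\ forall i, I (a i), forall i, J (b i) & x = \sum_i a i * b i]].

Definition ideal_add I J : set K :=
  [set x | exists a b, [/\ I a, J b & x = a + b]].

Definition coprime_ideals O I J : Prop := ideal_add I J = O.

(* The ideal I^n M; in particular I^n for M = O, and the extension of I^n to a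
   larger ring M. *)
Definition ideal_pow I (n : nat) M : set K := iter n (ideal_mul I) M.

(* Same class in the ideal class group: a I = b J for some nonzero a, b. *)
Definition ideal_equiv O I J : Prop :=
  exists a b, [/\ O a, O b, a != 0, b != 0 & [set a * x | x in I] = [set b * x | x in J]].

Definition class_number_one F : Prop :=
  forall I J, is_ideal (integers F) I -> is_ideal (integers F) J ->
    (exists2 x, I x & x != 0) -> (exists2 x, J x & x != 0) ->
    ideal_equiv (integers F) I J.

Definition conductor O : set K :=
  [set x | integers {:K} x /\ forall y, integers {:K} y -> O (x * y)].

Definition extended_ideal I : set K := ideal_mul I (integers {:K}).

Definition splits I : Prop :=
  exists P1 P2, [/\ is_prime_ideal (integers {:K}) P1,
    is_prime_ideal (integers {:K}) P2, P1 <> P2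
    & extended_ideal I = ideal_mul P1 P2].

Definition ramifies I : Prop :=
  exists P, is_prime_ideal (integers {:K}) P /\
    extended_ideal I = ideal_mul P P.

Definition inert I : Prop :=
  is_prime_ideal (integers {:K}) (extended_ideal I).

Definition locally_maximal_RM F O (ell : nat) : Prop :=
  exists m, has_index (integers F) (O `&` [set` F]) m /\ coprime m ell.

Definition adic_null I M (u : nat -> K) : Prop :=
  forall n, exists N : nat, forall k, (N <= k)%N -> ideal_pow I n M (u k).

Definition adic_cauchy I M (u : nat -> K) : Prop :=
  forall n, exists N : nat, forall j k, (N <= j)%N -> (N <= k)%N ->
    ideal_pow I n M (u j - u k).

(* Let F_I be the completion of F at I.  Elements of K (x)_F F_I are given by
   I-adic Cauchy sequences in K, two sequences being identified when
   their difference is null, and those of the completion of integers F at I by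
   Cauchy sequences in integers F.  This is the set of all sequences that
   represent an element sum_i x_i (x) a_i of K (x)_F F_I with x_i in O and
   a_i in the completion of integers F, that is, an element of the image of
   O (x)_(O :&: F) (integers F)_I in K (x)_F F_I; the tensor product embeds in
   K (x)_F F_I when O has locally maximal real multiplication at I.
   Representing sets are saturated, so inclusions between them are the
   inclusions inside K (x)_F F_I. *)
Definition completed_order F I O : set (nat -> K) :=
  [set u | exists n (x : 'I_n -> K) (a : 'I_n -> nat -> K),
     [/\ forall i, O (x i),
         forall i k, integers F (a i k),
         forall i, adic_cauchy I (integers F) (a i)
       & adic_null I (integers {:K}) (fun k => u k - \sum_i x i * a i k)]].

(* Isomorphism of subrings of K. *)
Definition subring_iso (O O' : set K) : Prop :=
  exists f : K -> K,
    [/\ set_bij O O' f, f 1 = 1,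
        forall x y, O x -> O y -> f (x + y) = f x + f y
      & forall x y, O x -> O y -> f (x * y) = f x * f y].

End Arithmetic.

(* Abelian surfaces over the complex numbers R[i], as polarizable complex tori
   R[i]^2 / Lambda; homomorphisms are the linear maps M with M Lambda contained
   in Lambda'.  Subgroups of R[i]^2 / Lambda are given by their preimages in
   R[i]^2. *)
Section AbelianSurfaces.
Variable R : realType.
Local Notation C := R[i].
Local Notation V := 'cV[R[i]]_2.

Definition is_lattice (Lam : set V) : Prop :=
  exists b : 4.-tuple V,
    (forall c : 'I_4 -> R,
       \sum_i (c i)%:C%C *: tnth b i = 0 -> forall i, c i = 0) /\
    Lam = inIntSpan b.

Definition is_polarization (Lam : set V) (H : V -> V -> C) : Prop :=
  [/\ forall (a : C) u v w, H (a *: u + v) w = a * H u w + H v w,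
      forall u v, H v u = (H u v)^*%C,
      forall v, v != 0 -> 0 < H v v
    & forall u v, Lam u -> Lam v -> complex.Im (H u v) \is a Num.int].

(* The kernel of the isogeny from the torus to its dual defined by H is
   {v | Im H (v, Lam) in Z} / Lam; it must be trivial. *)
Definition is_principal (Lam : set V) (H : V -> V -> C) : Prop :=
  forall v, (forall w, Lam w -> complex.Im (H v w) \is a Num.int) -> Lam v.

Record abelian_surface := AbelianSurface {
  lattice : set V;
  latticeP : is_lattice lattice;
  polarizableP : exists H, is_polarization lattice H }.

Implicit Types A B : abelian_surface.

Definition principally_polarizable A : Prop :=
  exists H, is_polarization (lattice A) H /\ is_principal (lattice A) H.

Definition is_hom A B (M : 'M[C]_2) : Prop :=
  forall v, lattice A v -> lattice B (M *m v).

Definition endo_ring A : set 'M[C]_2 := [set M | is_hom A A M].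

Record isogeny A := Isogeny {
  target : abelian_surface;
  isog_mx : 'M[C]_2;
  isog_unit : isog_mx \in unitmx;
  isog_hom : is_hom A target isog_mx }.

Definition isog_ker A (phi : isogeny A) : set V :=
  [set v | lattice (target phi) (isog_mx phi *m v)].

Definition isog_iso A (phi psi : isogeny A) : Prop :=
  exists U : 'M[C]_2, [/\ U \in unitmx, is_hom (target phi) (target psi) U,
    is_hom (target psi) (target phi) (invmx U)
    & isog_mx psi = U *m isog_mx phi].

Definition exactly_up_to_iso A (n : nat) (P : isogeny A -> Prop) : Prop :=
  exists t : 'I_n -> isogeny A,
    [/\ forall i, P (t i), forall i j, isog_iso (t i) (t j) -> i = j
      & forall phi, P phi -> exists i, isog_iso phi (t i)].

Section CM.
Variables (K : fieldExtType rat) (K0 : {subfield K}) (l : set K) (ell : nat).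
Variables (A : abelian_surface) (iota : {rmorphism K -> 'M[C]_2}).

Definition order_of_source : set K := [set x | endo_ring A (iota x)].

(* The embedding of K in End(B) (x) Q compatible with phi : A -> B is
   x |-> phi iota(x) phi^-1. *)
Definition order_of_target (phi : isogeny A) : set K :=
  [set x | endo_ring (target phi)
             (isog_mx phi *m iota x *m invmx (isog_mx phi))].

Definition ltorsion : set V :=
  [set v | forall beta, l beta -> order_of_source beta ->
             lattice A (iota beta *m v)].

Definition l_isogeny (phi : isogeny A) : Prop :=
  [/\ isog_ker phi `<=` ltorsion,
      has_index (isog_ker phi) (lattice A) ell
    & exists2 v, isog_ker phi v &
        forall w, isog_ker phi w -> exists m : int, lattice A (w - v *~ m)].

Definition horizontal (phi : isogeny A) : Prop :=
  subring_iso order_of_source (order_of_target phi).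

Definition descending (phi : isogeny A) : Prop :=
  completed_order K0 l (order_of_target phi) `<`
  completed_order K0 l order_of_source.

Definition ascending (phi : isogeny A) : Prop :=
  completed_order K0 l order_of_source `<`
  completed_order K0 l (order_of_target phi).

End CM.
End AbelianSurfaces.

(* Main.v *)
Require Import Defs.
From HB Require Import structures.
From mathcomp Require Import all_boot all_order all_algebra all_field.
From mathcomp Require Import complex.
From mathcomp Require Import boolp classical_sets functions reals.
From mathcomp Require Import ring zify.

Set Implicit Arguments.
Unset Strict Implicit.
Unset Printing Implicit Defensive.

Import Order.TTheory GRing.Theory Num.Theory.

Local Open Scope classical_set_scope.
Local Open Scope ring_scope.

(* Fix a nonzero vector [v0] of the lattice. Since [K] has degree 4, the lattice is
   [iota A v0] for a subgroup [A] of [K] whose ring of multipliers is [O], and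
   l-isogenies correspond to the lines of [T / A], where [T] is the set of [x] with
   [b x \in A] for all [b] in [l :&: O].  Localizing at [l] replaces [O :&: K0] by a
   discrete valuation ring [R] with uniformizer [alpha]; modules over it have bases,
   so [O] becomes [R + R th] with [th = alpha^k w], where [R + R w] is the
   localized maximal order, and [k = 0] iff [l] is coprime to the conductor.  As [O]
   is the full multiplier ring, [th] is not scalar on the plane [T / A] over [F_ell],
   so [T / A] has a basis [y, th y], where [th^2 = tau th - nu].  The line of [y] is
   not stable under [th], and that of [(th - c) y] is stable iff
   [c^2 - tau c + nu = 0] in [F_ell].  Unstable lines are descending.  If [k = 0],
   stable lines keep the order, and the number of roots is read off from the
   decomposition of [l] since [F_ell[th]] is then [O_K / l O_K].  If [k > 0], then
   [tau = nu = 0] and the order of the unique stable line contains an element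
   [s th / alpha] with [s] prime to [l], which does not belong to [O] locally. *)

(** * Integral elements *)

(** Descending and ascending compare completed orders. For a ring that contains [O :&: K0] and some
    positive integer multiple of the maximal order, a constant sequence [x] lies in the completed
    order only if [x] lies in the localization. So each strict inclusion is decided there by a
    single element, [th] for descent and [s th / alpha] for ascent. Horizontal asks only for an
    abstract ring isomorphism, so unstable lines must also be shown not to be horizontal: an order
    is never isomorphic to a proper subring of itself contained in it. Conversely, the equality of
    orders on stable lines is global, although the computation is local; the way back is that a
    torsion element lying in the localization of [A] lies in [A], so the lattice of a line differs
    from [A] only at [l]. Denominators are elements of [O :&: K0] prime to [l], and local maximality
    of the real multiplication supplies enough of them. That [alpha] divides a nonzero element only
    finitely often comes from a pigeonhole in [O], and bounded denominators come from traces in the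
    two quadratic steps from the rationals to [K0] and to [K]. *)

Section Integrality.
Variable K : fieldExtType rat.
Implicit Types (x y : K) (F E : {subfield K}).
Local Notation intK := (intr : int -> K).
Local Notation ZK := (integers {:K}).

Lemma intrK_eq0 (n : int) : (n%:~R == 0 :> K) = (n == 0).
Proof. by rewrite -(rmorph_int (in_alg K)) fmorph_eq0 intr_eq0. Qed.

Lemma natrK_eq0 (n : nat) : (n%:R == 0 :> K) = (n == 0)%N.
Proof. by rewrite -[n%:R]/((Posz n)%:~R) intrK_eq0. Qed.

Lemma memv_int F (n : int) : n%:~R \in F.
Proof. by rewrite rpred_int. Qed.

Lemma integers_int F (n : int) : integers F (n%:~R : K).
Proof. by split; [apply: memv_int | apply: integral_id]. Qed.

Lemma integers_nat F (n : nat) : integers F (n%:R : K).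
Proof. exact: (integers_int F (Posz n)). Qed.

Lemma integersD F x y : integers F x -> integers F y -> integers F (x + y).
Proof. by case=> Fx ix [Fy iy]; split; [rewrite memvD | apply: integral_add]. Qed.

Lemma integersN F x : integers F x -> integers F (- x).
Proof. by case=> Fx ix; split; [rewrite memvN | apply: integral_opp]. Qed.

Lemma integersB F x y : integers F x -> integers F y -> integers F (x - y).
Proof. by move=> Fx Fy; apply: integersD => //; apply: integersN. Qed.

Lemma integersM F x y : integers F x -> integers F y -> integers F (x * y).
Proof. by case=> Fx ix [Fy iy]; split; [rewrite memvM | apply: integral_mul]. Qed.

Lemma integersX F x n : integers F x -> integers F (x ^+ n).
Proof.
move=> Fx; elim: n => [|n IHn]; first exact: (integers_nat F 1).
by rewrite exprS; apply: integersM.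
Qed.

Lemma integers_sub F x : integers F x -> ZK x.
Proof. by case=> _ ix; split; rewrite ?memvf. Qed.

Lemma integersW F x : x \in F -> ZK x -> integers F x.
Proof. by move=> Fx [_ ix]. Qed.

(** The determinant trick: the vector [X] is an eigenvector for [x] of an integer matrix, so [x] is
    a root of its monic characteristic polynomial. The matrix is transposed because eigenvectors are
    rows. *)
Lemma integral_span m (X : 'I_m -> K) (N : 'I_m -> 'I_m -> int) x :
    (forall i, x * X i = \sum_j (N i j)%:~R * X j) ->
  (exists i, X i != 0) -> integralOver intK x.
Proof.
move=> defx [i0 Xi0]; pose A : 'M[int]_m := \matrix_(i, j) N j i.
exists (char_poly A); first exact: char_poly_monic.
rewrite map_char_poly -eigenvalue_root_char; apply/eigenvalueP.
exists (\row_i X i); last by apply: contraNneq Xi0 => /rowP/(_ i0); rewrite !mxE => ->.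
by apply/rowP=> i; rewrite !mxE defx; apply: eq_bigr => j _; rewrite !mxE mulrC.
Qed.

(** The equation is moved to [algC], where a rational algebraic integer is an integer. *)
Lemma integers_rat x : integers 1%VS x -> exists n : int, x = n%:~R.
Proof.
case=> /vlineP[q ->] [p mon_p]; have inK : in_alg K \o intr =1 intK by move=> n /=;
  rewrite scaler_int.
rewrite -(eq_map_poly inK) map_poly_comp -[q%:A]/(in_alg K q) fmorph_root => rq.
suff /Cint_rat_Aint : (ratr q : algC) \in Aint.
  move=> /(_ (rpred_rat _ _)); rewrite -[ratr q]/(ratr q) => /intrP[n Dn].
  exists n; rewrite -(rmorph_int (in_alg K)) /=; congr (_ *: _).
  by apply: (fmorph_inj (ratr : {rmorphism rat -> algC})); rewrite [LHS]Dn [RHS]ratr_int.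
pose P : {poly algC} := map_poly (ratr : rat -> algC) (map_poly intr p).
have P_ : P = map_poly intr p by rewrite /P -map_poly_comp; apply: eq_map_poly => n /=;
  rewrite ratr_int.
apply: (@root_monic_Aint P); rewrite ?P_ ?monic_map //.
  by rewrite -P_ /P fmorph_root.
by apply/polyOverP=> i; rewrite coef_map /= intr_int.
Qed.

(** For any [y] in [E] outside [F], the spaces [F] and [F y] meet in 0, so dimensions give
    [E = F + F y]. Completing the square in [y^2 = a + b y] yields [w = y - b / 2]. *)
Lemma quadratic_generator F E : (F <= E)%VS -> \dim E = (2 * \dim F)%N ->
  exists w, [/\ w \in E, w \notin F, w ^+ 2 \in F &
    forall x, x \in E -> exists a b, [/\ a \in F, b \in F & x = a + b * w]].
Proof.
move=> sFE dimE.
have /subvPn[y Ey nFy] : ~~ (E <= F)%VS.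
  apply/negP=> /dimvS; rewrite dimE mul2n -addnn -[X in (_ <= X)%N]addn0.
  by rewrite leq_add2l leqNgt adim_gt0.
have ny0 : y != 0 by apply: contraNneq nFy => ->; rewrite mem0v.
have disj : (F :&: F * <[y]> = 0)%VS.
  apply/eqP; rewrite -subv0; apply/subvP=> z; rewrite memv_cap => /andP[Fz /memv_cosetP[a Fa zE]].
  rewrite memv0; apply: contraNT nFy => nz0.
  have na0: a != 0 by apply: contraNneq nz0 => a0; rewrite zE a0 mul0r.
  by rewrite -[y](mulKf na0) -zE memvM ?memvV.
have EE : (F + F * <[y]>)%VS = E.
  apply/eqP; rewrite eqEdim dimv_disjoint_sum // dim_cosetv // addnn -mul2n -dimE leqnn andbT.
  rewrite subv_add sFE; apply/subvP=> _ /memv_cosetP[a Fa ->].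
  by rewrite memvM // (subvP sFE).
have gen x : x \in E -> exists a b, [/\ a \in F, b \in F & x = a + b * y].
  by rewrite -EE => /memv_addP[a Fa [_ /memv_cosetP[b Fb ->] ->]]; exists a, b.
have n2 : (2%:R : K) != 0 by rewrite natrK_eq0.
have F2 : (2%:R^-1 : K) \in F by rewrite memvV (rpred_nat _ 2).
have [a [b [Fa Fb y2E]]] := gen (y ^+ 2) (rpredX 2 Ey).
exists (y - b / 2%:R); split.
- by rewrite memvB // (subvP sFE) // memvM.
- by apply: contra nFy => Fw; rewrite -[y](subrK (b / 2%:R)) memvD // memvM.
- have -> : (y - b / 2%:R) ^+ 2 = a + (b / 2%:R) ^+ 2.
    have -> : (y - b / 2%:R) ^+ 2 = y ^+ 2 - b * y + (b / 2%:R) ^+ 2 by field.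
    by rewrite y2E; ring.
  by rewrite memvD // rpredX // memvM.
move=> x /gen[c [d [Fc Fd ->]]]; exists (c + d * (b / 2%:R)), d; split=> //.
  by rewrite memvD // !memvM.
by ring.
Qed.

(** Any polynomial over [F] that vanishes at [a + b w] vanishes at the conjugate: its remainder
    modulo the quadratic [q], which has both as roots, is linear over [F] and has a root outside
    [F], hence is 0. *)
Lemma integral_conj F w a b : w \notin F -> w ^+ 2 \in F -> a \in F -> b \in F ->
  integralOver intK (a + b * w) -> integralOver intK (a - b * w).
Proof.
move=> nFw Fw2 Fa Fb; have [->|nb0] := eqVneq b 0; first by rewrite mul0r subr0 addr0.
have nFx : a + b * w \notin F.
  apply: contra nFw => Fx; rewrite -[w](mulKf nb0) memvM ?memvV //.
  by rewrite -[b * w](addKr a) addrC memvB.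
case=> p mon_p rp; exists p => //.
set P := map_poly intr p in rp *.
pose q : {poly K} := 'X ^+ 2 - (2%:R * a) *: 'X + (a ^+ 2 - b ^+ 2 * w ^+ 2)%:P.
have FP : P \is a polyOver F by apply/polyOverP=> i; rewrite coef_map memv_int.
have size_q : size q = 3%N.
  rewrite /q -addrA size_polyDl size_polyXn // -mul_polyC.
  apply: leq_ltn_trans (size_polyD _ _) _; rewrite gtn_max size_polyN.
  by rewrite (leq_ltn_trans (size_polyMleq _ _)) ?size_polyX ?addn2 ?ltnS //= ?size_polyC;
    case: eqP.
have Fq : q \is a polyOver F.
  rewrite /q rpredD ?rpredB ?rpredX ?polyOverX ?polyOverC ?polyOverZ ?polyOverX //.
    by rewrite memvM // (rpred_nat _ 2).
  by apply: memvB; [exact: rpredX | apply: memvM => //; exact: rpredX].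
have root_q c : c ^+ 2 = (b * w) ^+ 2 -> q.[a + c] = 0.
  move=> c2; rewrite /q !(hornerD, hornerN, hornerZ, hornerX, hornerXn, hornerC).
  transitivity (c ^+ 2 - (b * w) ^+ 2); first by ring.
  by rewrite c2 subrr.
have := divp_eq P q; have : P %% q \is a polyOver F by rewrite modp_polyOver.
have : (size (P %% q)%R < 3)%N by rewrite -size_q ltn_modp -size_poly_eq0 size_q.
set r := P %% q => size_r Fr PE.
have r0 : r.[a + b * w] = 0.
  by have := rp; rewrite rootE PE hornerD hornerM root_q // mulr0 add0r => /eqP.
have rE c : r.[c] = r`_0 + r`_1 * c.
  by rewrite (@horner_coef_wide _ 2 r) // big_ord_recl big_ord1 expr0 mulr1 /= expr1.
have Fr_ i : r`_i \in F by apply: (polyOverP Fr).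
have r1 : r`_1 = 0.
  apply: contraNeq nFx => nr1; have := r0; rewrite rE => /eqP.
  rewrite addr_eq0 => /eqP r01.
  by rewrite -[_ + _](mulKf nr1) memvM ?memvV // -[_ * _]opprK -r01 memvN.
have r00 : r`_0 = 0 by have := r0; rewrite rE r1 mul0r addr0.
rewrite rootE PE hornerD hornerM root_q ?sqrrN // mulr0 add0r rE r1 r00 mul0r addr0 //.
Qed.

(** * Finitely generated subgroups of K *)

Definition zspan m (X : 'I_m -> K) : set K :=
  [set x | exists c : 'I_m -> int, x = \sum_i (c i)%:~R * X i].

Lemma inIntSpan_zspan m (s : m.-tuple K) : inIntSpan s = zspan (fun i : 'I_m => s`_i).
Proof.
apply/seteqP; split=> x [c ->].
  by exists c; apply: eq_bigr => i _; rewrite mulrzl.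
by exists [ffun i => c i]; apply: eq_bigr => i _; rewrite ffunE mulrzl.
Qed.

Lemma zspan_gen m (X : 'I_m -> K) i : zspan X (X i).
Proof.
exists (fun j => (j == i)%:R); rewrite (bigD1 i) //= eqxx mul1r.
by rewrite big1 ?addr0 // => j /negPf->; rewrite mul0r.
Qed.

Lemma zspanP m (X : 'I_m -> K) (M : set K) :
    M 0 -> (forall x y, M x -> M y -> M (x - y)) -> (forall i, M (X i)) ->
  zspan X `<=` M.
Proof.
move=> M0 MB MX _ [c ->].
have MN x : M x -> M (- x) by rewrite -[- x]sub0r; apply: MB.
have MD x y : M x -> M y -> M (x + y) by move=> Mx /MN My; rewrite -[y]opprK; apply: MB.
have Mn x n : M x -> M (n%:R * x).
  by move=> Mx; elim: n => [|n IHn]; rewrite ?mul0r // -natr1 mulrDl mul1r; apply: MD.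
apply: big_ind => // i _; case: (c i) => n; first exact: Mn.
by rewrite NegzE mulrNz mulNr; apply/MN/Mn.
Qed.

Lemma zspanB m (X : 'I_m -> K) x y : zspan X x -> zspan X y -> zspan X (x - y).
Proof.
move=> [c ->] [d ->]; exists (fun i => c i - d i).
by rewrite -sumrB; apply: eq_bigr => i _; rewrite mulrzBr mulrBl.
Qed.

Lemma zspan0 m (X : 'I_m -> K) : zspan X 0.
Proof. by exists (fun=> 0); rewrite big1 // => i _; rewrite mul0r. Qed.

Lemma zspan_integral m (X : 'I_m -> K) x :
    (forall i, zspan X (x * X i)) -> (exists i, X i != 0) -> ZK x.
Proof.
move=> /choice[N NE] X0; split; first by rewrite memvf.
exact: (@integral_span m X N).
Qed.

Lemma common_denominator m (q : 'I_m -> rat) :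
  exists2 D : nat, (0 < D)%N & exists c : 'I_m -> int, forall i, D%:R * q i = (c i)%:~R.
Proof.
exists (\prod_i `|denq (q i)|)%N; first by rewrite prodn_gt0 // => i; rewrite absz_gt0.
exists (fun i => numq (q i) * (Posz (\prod_(j | j != i) `|denq (q j)|)%N)) => i.
have dq : (`|denq (q i)|%N)%:R = (denq (q i))%:~R :> rat.
  by rewrite -[in RHS](gez0_abs (denq_ge0 (q i))).
rewrite (bigD1 i) //= natrM dq -{2}[q i]divq_num_den rmorphM /=.
by rewrite mulrAC mulrCA divff ?mulr1 ?intr_eq0.
Qed.

(** Coordinates modulo [M] take at most [M ^ d] values, so two of the first [M ^ d + 1] terms agree
    modulo [M]. *)
Lemma zspan_pigeonhole d (b : 'I_d -> K) (x : nat -> K) M :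
    (0 < M)%N -> (forall n, zspan b (x n)) ->
  exists i j z, [/\ (i < j)%N, zspan b z & x i - x j = M%:R * z].
Proof.
case: M => // M _ /choice[c cE].
pose f (n : 'I_(M.+1 ^ d).+1) : {ffun 'I_d -> 'I_M.+1} :=
  [ffun k => inord `|(c n k %% M.+1)%Z|].
have /injectivePn[i0 [j0 nij fij]] : ~~ injectiveb f.
  apply/negP; by move=> /injectiveP/leq_card; rewrite card_ffun !card_ord ltnn.
wlog lt_ij : i0 j0 {nij} fij / (i0 < j0)%N.
  move=> IH; have [] := ltngtP i0 j0; [exact: IH | exact: IH | ].
  by move/val_inj => e; rewrite e eqxx in nij.
have ck k : exists q : int, c i0 k - c j0 k = q * M.+1.
  have lt_mod (a : int) : (`|(a %% M.+1)%Z| < M.+1)%N by have :=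
    modz_ge0 a (isT : M.+1 != 0 :> int); have := ltz_pmod a (isT : 0 < M.+1%:Z); lia.
  have /(congr1 val) := congr1 (fun g : {ffun _} => g k) fij; rewrite /= !ffunE !inordK //.
  move=> e; have /eqP : (c i0 k %% M.+1)%Z = (c j0 k %% M.+1)%Z.
    have := modz_ge0 (c i0 k) (isT : M.+1 != 0 :> int);
      have := modz_ge0 (c j0 k) (isT : M.+1 != 0 :> int); lia.
  by rewrite eqz_mod_dvd => /dvdzP.
have [q qE] := choice ck.
exists i0, j0, (\sum_k (q k)%:~R * b k); split=> //; first by exists q.
rewrite !cE -sumrB mulr_sumr; apply: eq_bigr => k _.
by rewrite -mulrBl -rmorphB /= qE rmorphM /= -pmulrn; ring.
Qed.

(** * Orders, and bounded denominators of integral elements *)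

Section Order.
Variables (O : set K) (hO : is_order O).

Lemma order_zspan : exists b : 'I_(\dim {:K}) -> K, O = zspan b.
Proof. by case: hO => _ _ [b [_ ->]]; rewrite inIntSpan_zspan; eexists. Qed.

Lemma order1 : O 1. Proof. by case: hO. Qed.

Lemma orderM x y : O x -> O y -> O (x * y). Proof. by case: hO => _ h _; apply: h. Qed.

Lemma order0 : O 0.
Proof. by case: order_zspan => b ->; apply: zspan0. Qed.

Lemma orderB x y : O x -> O y -> O (x - y).
Proof. by case: order_zspan => b ->; apply: zspanB. Qed.

Lemma orderN x : O x -> O (- x).
Proof. by rewrite -[- x]sub0r; apply: orderB order0. Qed.

Lemma orderD x y : O x -> O y -> O (x + y).
Proof. by move=> Ox /orderN; rewrite -{2}[y]opprK; apply: orderB. Qed.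

Lemma order_int (n : int) : O n%:~R.
Proof.
have On (k : nat) : O k%:R.
  by elim: k => [|k IHk]; [exact: order0 | rewrite -natr1; apply: orderD order1].
by case: n => n; [apply: On | rewrite NegzE mulrNz; apply/orderN/On].
Qed.

Lemma order_integral : O `<=` ZK.
Proof.
move=> x Ox; have [b Ob] := order_zspan; apply: (@zspan_integral _ b).
  by move=> i; rewrite -Ob; apply: orderM => //; rewrite Ob; apply: zspan_gen.
apply: contrapT => b0; have := order1; rewrite Ob => -[c] /eqP; apply/negP.
rewrite big1 ?oner_eq0 // => i _; have [->|nbi] := eqVneq (b i) 0; first by rewrite mulr0.
by case: b0; exists i.
Qed.

Lemma order_scale x : exists2 D : nat, (0 < D)%N & O (D%:R * x).
Proof.
case: hO => _ _ [b [bB ->]]; have [D D0 [c cE]] := common_denominator (fun i => coord b i x).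
exists D => //; rewrite inIntSpan_zspan; exists c.
rewrite {1}(coord_basis bB (memvf x)) mulr_sumr; apply: eq_bigr => i _.
rewrite -mulr_algl mulrA; congr (_ * _).
by rewrite -[_%:A]/(in_alg K _) -(rmorph_nat (in_alg K)) -rmorphM /= cE scaler_int.
Qed.
(** The sum and the difference of [x = a + b w] and its conjugate are integral: they are [2 a], and
    [2 b w], which the integral element [k w] multiplies into [F]. The generators [1 / 2] and
    [w / (2 k w^2)] undo these two scalings. *)
Lemma integers_quadratic F E : (F <= E)%VS -> \dim E = (2 * \dim F)%N ->
  exists z1 z2 : K, forall x, integers E x ->
    exists a c, [/\ integers F a, integers F c & x = a * z1 + c * z2].
Proof.
move=> sFE dimE; have [w [Ew nFw Fw2 gen]] := quadratic_generator sFE dimE.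
have [k k0 /order_integral ikw] := order_scale w.
have nw0 : w != 0 by apply: contraNneq nFw => ->; rewrite mem0v.
have n2 : (2%:R : K) != 0 by rewrite natrK_eq0.
have nk : (k%:R : K) != 0 by rewrite natrK_eq0 -lt0n.
exists 2%:R^-1, (w / (2%:R * (k%:R * w ^+ 2))) => x [/gen[a [b [Fa Fb ->]]] ix].
have ix' := integral_conj nFw Fw2 Fa Fb ix.
exists (2%:R * a), (2%:R * b * w * (k%:R * w)); split; last by field; rewrite nw0 nk.
- split; first by rewrite memvM // (rpred_nat _ 2).
  have -> : 2%:R * a = (a + b * w) + (a - b * w) by ring.
  exact: integral_add.
split.
  have -> : 2%:R * b * w * (k%:R * w) = 2%:R * b * k%:R * w ^+ 2 by ring.
  by apply: memvM => //; apply: memvM; [apply: memvM => // |]; apply: rpred_nat.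
apply: integral_mul; last by case: ikw.
have -> : 2%:R * b * w = (a + b * w) - (a - b * w) by ring.
exact: integral_sub.
Qed.

(** Both quadratic steps together put all integers of [K] in the span over the ordinary integers of
    four fixed products, whose denominators with respect to [O] are cleared at once. *)
Lemma integers_bound (F : {subfield K}) : \dim F = 2 -> \dim {:K} = 4 ->
  exists2 D : nat, (0 < D)%N & forall x, ZK x -> O (D%:R * x).
Proof.
move=> dF dK.
have dK' : \dim {:K} = (2 * \dim F)%N by rewrite dF dK.
have dF' : \dim F = (2 * \dim (1%AS : {subfield K}))%N by rewrite dF [\dim _]dimv1.
have [z1 [z2 zE]] := integers_quadratic (subvf F) dK'.
have [y1 [y2 yE]] := @integers_quadratic 1%AS F (sub1v F) dF'.
have [D1 D10 O1] := order_scale (y1 * z1). have [D2 D20 O2] := order_scale (y2 * z1).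
have [D3 D30 O3] := order_scale (y1 * z2). have [D4 D40 O4] := order_scale (y2 * z2).
exists (D1 * D2 * D3 * D4)%N; first by rewrite !muln_gt0 D10 D20 D30.
move=> x /zE[_ [_ [/yE[_ [_ [/integers_rat[a ->] /integers_rat[b ->] ->]]]
  /yE[_ [_ [/integers_rat[c ->] /integers_rat[d ->] ->]]] ->]]].
have -> : (D1 * D2 * D3 * D4)%:R * ((a%:~R * y1 + b%:~R * y2) * z1 + (c%:~R * y1 + d%:~R * y2) * z2) =
  (a * (D2 * D3 * D4)%N)%:~R * (D1%:R * (y1 * z1)) + (b * (D1 * D3 * D4)%N)%:~R * (D2%:R * (y2 * z1)) +
  ((c * (D1 * D2 * D4)%N)%:~R * (D3%:R * (y1 * z2)) + (d * (D1 * D2 * D3)%N)%:~R * (D4%:R * (y2 * z2))).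
  by rewrite !natrM !rmorphM /= -!pmulrn ?natrM; ring.
by apply: orderD; apply: orderD; apply: orderM => //; apply: order_int.
Qed.
End Order.
End Integrality.

(* The orbit of [x] under the isomorphism consists of roots of one polynomial, hence
   is finite, so [x] is itself a value of the isomorphism. *)
Lemma order_not_iso (K : fieldExtType rat) (O O' : set K) :
  is_order O -> O' `<` O -> ~ subring_iso O O'.
Proof.
move=> hO [O'O nOO'] [f [[fO' finj _] f1 fD fM]].
have {finj} finj x y : O x -> O y -> f x = f y -> x = y.
  by move=> Ox Oy; apply: finj; rewrite inE.
have {}fO' x : O x -> O' (f x) by move=> Ox; apply: fO'; rewrite ?inE.
have O0 := order0 hO; have O1 := order1 hO.
have f0 : f 0 = 0 by apply: (addrI (f 0)); rewrite -fD // !addr0.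
have fN x : O x -> f (- x) = - f x.
  by move=> Ox; apply: (addrI (f x)); rewrite -fD ?subrr //; apply: orderN.
have fint (n : int) : f n%:~R = n%:~R.
  have fnat (m : nat) : f m%:R = m%:R.
    by elim: m => // m IHm; rewrite -natr1 fD ?IHm ?f1 //; apply: (order_int hO (Posz m)).
  by case: n => n; [apply: fnat | rewrite NegzE mulrNz fN ?fnat //; apply: (order_int hO (Posz _))].
have fP (p : {poly int}) x : O x ->
    O (map_poly intr p).[x] /\ f (map_poly intr p).[x] = (map_poly intr p).[f x].
  move=> Ox; elim/poly_ind: p => [|p c [Op fp]]; first by rewrite rmorph0 !horner0.
  have Oc := order_int hO c; have Opx : O ((map_poly intr p).[x] * x) by apply: orderM.
  rewrite rmorphD rmorphM /= map_polyX map_polyC /= !hornerMXaddC.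
  by rewrite fD // fM // fint fp; split=> //; apply: orderD.
apply: nOO' => x Ox; have [_ [p mon_p px]] := order_integral hO Ox.
have Oiter n : O (iter n f x) by elim: n => //= n /fO'/O'O.
have root_iter n : root (map_poly intr p) (iter n f x).
  elim: n => //= n /rootP pn; apply/rootP.
  by have [_ <-] := fP p _ (Oiter n); rewrite pn.
set P := map_poly intr p in px root_iter.
have P0 : P != 0 by rewrite monic_neq0 ?monic_map.
have : ~~ uniq [seq iter n f x | n <- iota 0 (size P)].
  apply/negP=> u; have al : all (root P) [seq iter n f x | n <- iota 0 (size P)].
    by apply/allP=> _ /mapP[n _ ->].
  by have := max_poly_roots P0 al u; rewrite size_map size_iota ltnn.
case/(uniqPn 0) => i [j [ij]]; rewrite size_map size_iota => js.
rewrite !(nth_map 0%N) ?size_iota ?nth_iota ?(ltn_trans ij) // !add0n -(subnKC (ltnW ij)) iterD => e.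
have iter_inj n : iter n f x = iter n f (iter (j - i) f x) -> x = iter (j - i) f x.
  elim: n => // n IHn; rewrite !iterS => /finj E; apply/IHn/E => //.
  by rewrite -iterD.
have -> : x = iter (j - i) f x by apply: iter_inj e.
by case: (j - i)%N (subn_gt0 i j) => [|n _]; [rewrite ij | rewrite iterS; apply: fO'].
Qed.

(** * Localization at l *)

(** Translation by [x] permutes the [n] cosets; summing [t i + x] over all representatives therefore
    gives [n x] modulo [N]. *)
Lemma has_index_mul (K : comNzRingType) (M N : set K) n x :
    N 0 -> (forall u v, N u -> N v -> N (u - v)) ->
    (forall u v, M u -> M v -> M (u + v)) ->
  has_index M N n -> M x -> N (n%:R * x).
Proof.
move=> N0 NB MD [t [Mt tP]] Mx.
have ND u v : N u -> N v -> N (u + v).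
  by move=> Nu Nv; rewrite -[v]opprK; apply: (NB) => //; rewrite -[- v]sub0r; apply: NB.
have /choice[s sP] i : exists j, N (t i + x - t j).
  by have [j [Nj _]] := tP _ (MD _ _ (Mt i) Mx); exists j.
have s_inj : injective s.
  move=> i j sij; have [k [_ uk]] := tP _ (Mt i).
  have := NB _ _ (sP i) (sP j); rewrite sij.
  have -> : t i + x - t (s j) - (t j + x - t (s j)) = t i - t j by ring.
  by move=> /uk <-; apply/esym/uk; rewrite subrr.
have -> : n%:R * x = \sum_i (t i + x - t (s i)).
  rewrite sumrB big_split /= sumr_const card_ord.
  by rewrite [\sum_i t i](reindex_inj s_inj) /= addrAC subrr add0r mulr_natl.
by apply: big_ind => // i _; apply: sP.
Qed.

Section Localization.
Variables (K : fieldExtType rat) (K0 : {subfield K}).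
Hypotheses (dK0 : \dim K0 = 2) (dK : \dim {:K} = 4).
Variables (O : set K) (hO : is_order O).
Variables (ell : nat) (hell : prime ell) (alpha : K).
Hypothesis Zalpha : integers K0 alpha.
Let l : set K := principal (integers K0) alpha.
Hypotheses (hnorm : has_index (integers K0) l ell) (hRM : locally_maximal_RM K0 O ell).
Local Notation Z0 := (integers K0).
Local Notation ZK := (integers {:K}).
Implicit Types (x y z s u v w : K).

Lemma idealP x : l x <-> exists2 y, Z0 y & x = alpha * y.
Proof. by split=> [[y Zy <-]|[y Zy ->]]; exists y. Qed.

Lemma ideal0 : l 0.
Proof. by apply/idealP; exists 0; rewrite ?mulr0 //; apply: (integers_nat K0 0). Qed.

Lemma idealB x y : l x -> l y -> l (x - y).
Proof.
case/idealP=> x' Zx -> /idealP[y' Zy ->]; apply/idealP; exists (x' - y').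
  exact: integersB.
by rewrite mulrBr.
Qed.

Lemma idealM x y : Z0 x -> l y -> l (x * y).
Proof.
move=> Zx /idealP[y' Zy ->]; apply/idealP; exists (x * y'); first exact: integersM.
by ring.
Qed.

Lemma idealN x : l x -> l (- x).
Proof. by rewrite -[- x]sub0r; apply: idealB ideal0. Qed.

Lemma idealD x y : l x -> l y -> l (x + y).
Proof. by move=> lx /idealN; rewrite -{2}[y]opprK; apply: idealB. Qed.

Lemma ideal_ell : l ell%:R.
Proof.
rewrite -[_%:R]mulr1; apply: has_index_mul hnorm _.
- exact: ideal0.
- exact: idealB.
- exact: integersD.
- exact: (integers_nat K0 1).
Qed.

Lemma ideal_not1 : ~ l 1.
Proof.
move=> l1; have [t [Zt tP]] := hnorm.
have [_ n1] : (0 < ell)%N /\ (1 < ell)%N by rewrite prime_gt0 // prime_gt1.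
have n0 := ltnW n1; have [k [_ uk]] := tP _ (Zt (Ordinal n0)).
have all_l x : Z0 x -> l x by move=> Zx; rewrite -[x]mulr1; apply: idealM.
have e0 : k = Ordinal n0 by apply: uk; apply: all_l; apply: integersB.
have e1 : k = Ordinal n1 by apply: uk; apply: all_l; apply: integersB.
by have := congr1 val e1; rewrite e0.
Qed.

Lemma ideal_int (n : int) : l n%:~R <-> (ell %| n)%Z.
Proof.
split=> [ln | /dvdzP[q ->]]; last first.
  by rewrite rmorphM; apply: idealM ideal_ell; apply: integers_int.
apply: contrapT => /negP ndiv; apply: ideal_not1.
have /coprimezP[[u v] /= uv] : coprimez n ell.
  by rewrite /coprimez gcdzC -[_ == _]/(coprime _ _) prime_coprime.
have -> : 1 = u%:~R * n%:~R + v%:~R * ell%:R :> K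
  by rewrite -[ell%:R]/(ell%:~R) -!rmorphM -rmorphD uv.
by apply: idealD; apply: idealM => //;
  [exact: integers_int | exact: integers_int | exact: ideal_ell].
Qed.

(** The residue field is the prime field: 0, ..., [ell - 1] are pairwise incongruent modulo [l], so
    they exhaust its [ell] classes. *)
Lemma ideal_residue x : Z0 x -> exists c : int, l (x - c%:~R).
Proof.
have [t [Zt tP]] := hnorm => Zx.
have /choice[j jP] (c : 'I_ell) : exists j, l ((c : nat)%:R - t j).
  by have [j [? _]] := tP _ (integers_nat K0 c); exists j.
have j_inj : injective j.
  move=> c d jcd; have := idealB (jP c) (jP d); rewrite jcd.
  have -> : (c : nat)%:R - t (j d) - ((d : nat)%:R - t (j d)) = (c%:Z - d%:Z)%:~R.
    by rewrite rmorphB /= -!pmulrn; ring.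
  by move=> /ideal_int H; apply: val_inj => /=; have := ltn_ord c; have := ltn_ord d;
    case/dvdzP: H => -[[|q]|q]; nia.
have [i [li _]] := tP _ Zx; have /injF_bij[g gK jK] := j_inj.
exists (Posz (g i)); have := idealB li (jP (g i)); rewrite jK.
by congr (l _); rewrite -pmulrn; ring.
Qed.

Lemma ideal_inverse s : Z0 s -> ~ l s -> exists u : int, l (u%:~R * s - 1).
Proof.
move=> Zs ls; have [c lc] := ideal_residue Zs.
have ndiv : ~ (ell %| c)%Z by move=> /ideal_int/(idealD lc); rewrite subrK.
have /coprimezP[[u v] /= uv] : coprimez c ell.
  by rewrite /coprimez gcdzC -[_ == _]/(coprime _ _) prime_coprime //; apply/negP.
exists u; have -> : u%:~R * s - 1 = u%:~R * (s - c%:~R) - v%:~R * ell%:R.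
  have e : 1 = u%:~R * c%:~R + v%:~R * ell%:R :> K
    by rewrite -[ell%:R]/(ell%:~R) -!rmorphM -rmorphD uv.
  by rewrite [X in _ - X = _]e; ring.
by apply: idealB; apply: idealM => //;
  [exact: integers_int | exact: integers_int | exact: ideal_ell].
Qed.

Lemma ideal_prime x y : Z0 x -> Z0 y -> l (x * y) -> l x \/ l y.
Proof.
move=> Zx Zy lxy; have [lx|nlx] := pselect (l x); [by left | right].
have [u lu] := ideal_inverse Zx nlx.
have -> : y = u%:~R * (x * y) - y * (u%:~R * x - 1) by ring.
by apply: idealB; apply: idealM => //; apply: integers_int.
Qed.

Lemma alpha_neq0 : alpha != 0.
Proof.
apply/eqP=> a0; have /idealP[y _ /eqP] := ideal_ell.
by rewrite a0 mul0r natrK_eq0 => /eqP e0; have := prime_gt0 hell; rewrite e0.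
Qed.

(** Here [m] is the index of [O :&: K0] in the integers of [K0], prime to [ell] by local maximality.
    It moves any integer of [K0] into [O] at the cost of a factor invertible at [l]. *)
Lemma real_multiplier : exists m : nat, (0 < m)%N /\ ~ l m%:R /\ forall x, Z0 x -> O (m%:R * x).
Proof.
have [m [mP cm]] := hRM; have ndiv : ~ (ell %| m)%N.
  by move=> d; have := prime_coprime m hell; rewrite d coprime_sym cm.
exists m; split; first by rewrite lt0n; apply: contra_not_neq ndiv => ->; rewrite dvdn0.
split; first by move=> lm; apply: ndiv; apply/(ideal_int (Posz m)).
move=> x Zx; suff [] : (O `&` [set` K0]) (m%:R * x) by [].
apply: has_index_mul mP Zx.
- by split; [exact: order0 | rewrite /= mem0v].
- by move=> u v [Ou K0u] [Ov K0v]; split; [exact: orderB | rewrite /= memvB].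
- exact: integersD.
Qed.

(** * The discrete valuation ring of K0 at l *)

Definition locunit : set K := [set s | [/\ O s, s \in K0 & ~ l s]].

(** Denominators come from [O] rather than from all integers of [K0], so that they act on every
    [O]-module. *)
Definition localize (M : set K) : set K := [set x | exists2 s, locunit s & M (s * x)].

Definition valring : set K := [set x | x \in K0 /\ exists2 s, locunit s & Z0 (s * x)].

Lemma locunit_int s : locunit s -> Z0 s.
Proof. by case=> Os K0s _; apply: integersW => //; apply: (order_integral hO). Qed.

Lemma locunit_order s : locunit s -> O s. Proof. by case. Qed.

Lemma locunitM s t : locunit s -> locunit t -> locunit (s * t).
Proof.
move=> us ut; have Zs := locunit_int us; have Zt := locunit_int ut.
case: us ut => Os K0s ls [Ot K0t lt]; split; [exact: orderM | exact: memvM |].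
by case/ideal_prime.
Qed.

Lemma locunit1 : locunit 1.
Proof. by split; [exact: order1 | exact: mem1v | exact: ideal_not1]. Qed.

Lemma locunit_neq0 s : locunit s -> s != 0.
Proof. by case=> _ _ ls; apply: contra_not_neq ls => ->; apply: ideal0. Qed.

Lemma int_to_locunit s : Z0 s -> ~ l s ->
  exists t, [/\ locunit t, locunit (t * s) & forall x, Z0 x -> O (t * x)].
Proof.
move=> Zs ls; have [m [m0 [lm Om]]] := real_multiplier.
exists m%:R; split=> //.
  by split=> //; [exact: (order_int hO (Posz m)) | exact: rpred_nat].
split; first exact: Om.
- by case: Zs => K0s _; rewrite memvM ?rpred_nat.
- by case/ideal_prime => //; apply: integers_nat.
Qed.

Lemma locunit_prod n (s : 'I_n -> K) : (forall i, locunit (s i)) -> locunit (\prod_i s i).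
Proof. by move=> us; apply: big_ind => //; [exact: locunit1 | exact: locunitM]. Qed.

Lemma valring_sub x : valring x -> x \in K0. Proof. by case. Qed.

Lemma valring_int x : Z0 x -> valring x.
Proof. by move=> Zx; split; [case: Zx | exists 1; [exact: locunit1 | rewrite mul1r]]. Qed.

Lemma valring0 : valring 0. Proof. exact/valring_int/(integers_nat K0 0). Qed.
Lemma valring1 : valring 1. Proof. exact/valring_int/(integers_nat K0 1). Qed.
Lemma valring_intr (n : int) : valring n%:~R. Proof. exact/valring_int/integers_int. Qed.
Lemma valring_alpha : valring alpha. Proof. exact: valring_int. Qed.

Lemma valringM x y : valring x -> valring y -> valring (x * y).
Proof.
move=> [K0x [s us Zx]] [K0y [t ut Zy]]; split; first exact: memvM.
exists (s * t); first exact: locunitM.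
have -> : s * t * (x * y) = (s * x) * (t * y) by ring.
exact: integersM.
Qed.

Lemma valringX x n : valring x -> valring (x ^+ n).
Proof.
move=> Rx; elim: n => [|n IHn]; first exact: valring1.
by rewrite exprS; apply: valringM.
Qed.

Lemma valring_inv s : Z0 s -> ~ l s -> valring s^-1.
Proof.
move=> Zs ls; have [t [ut uts Ot]] := int_to_locunit Zs ls.
split; first by case: Zs => K0s _; rewrite memvV.
exists (t * s) => //; rewrite mulfK; first exact: locunit_int.
by apply: contra_not_neq ls => ->; apply: ideal0.
Qed.

Lemma locunit_inv s : locunit s -> valring s^-1.
Proof. by move=> us; apply: valring_inv; [exact: locunit_int | case: us]. Qed.

Lemma valring_integers x : x \in K0 -> localize ZK x -> valring x.
Proof.
move=> K0x [s us Osx]; split=> //; exists s => //; apply: integersW => //.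
by case: us => _ K0s _; rewrite memvM.
Qed.

Lemma valring_localize x : valring x -> localize O x.
Proof.
move=> [K0x [s us Zx]]; have [m [m0 [lm Om]]] := real_multiplier.
exists (m%:R * s); last by rewrite -mulrA; apply: Om.
apply: locunitM => //; split=> //; [exact: (order_int hO (Posz m)) | exact: rpred_nat].
Qed.

Lemma valring_residue x : valring x -> exists c : int, valring ((x - c%:~R) / alpha).
Proof.
move=> [K0x [s us Zsx]]; have Zs := locunit_int us; have [_ _ ls] := us.
have [u /idealP[z' Zz' z'E]] := ideal_inverse Zs ls; have [c /idealP[z Zz zE]] := ideal_residue Zsx.
have a0 := alpha_neq0; have s0 := locunit_neq0 us.
(* [u] inverts the denominator [s] modulo [l] and [c] is the residue of [s * x], so [u * c] is the
   residue of [x]. *)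
exists (u * c).
have -> : (x - (u * c)%:~R) / alpha = s^-1 * (z - c%:~R * z').
  have xE : x = s^-1 * (alpha * z + c%:~R) by rewrite -zE subrK mulKf.
  have uE : u%:~R = s^-1 * (alpha * z' + 1) by rewrite -z'E; field.
  by rewrite rmorphM /= xE uE; field; rewrite ?a0 ?s0.
apply: valringM; first exact: locunit_inv.
by apply/valring_int/integersB => //; apply: integersM => //; apply: integers_int.
Qed.

Lemma valring_dvd (n : int) : valring (n%:~R / alpha) -> (ell %| n)%Z.
Proof.
case=> _ [s us Zs]; have a0 := alpha_neq0; apply/ideal_int.
have : l (s * n%:~R) by apply/idealP; exists (s * (n%:~R / alpha)) => //; field.
by case/ideal_prime => //; [exact: locunit_int | exact: integers_int | case: us].
Qed.

Lemma valring_alphaV : ~ valring alpha^-1.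
Proof.
move=> Ra; have /valring_dvd : valring ((Posz 1)%:~R / alpha) by rewrite mul1r.
by rewrite dvdz1 absz_nat => /eqP e1; have := prime_gt1 hell; rewrite e1.
Qed.

(** If all powers of [alpha] divided [x], every [N / alpha ^+ n] would lie in [O] for one [N]. By
    pigeonhole modulo [N * ell], some [alpha ^- i - alpha ^- j] with [i < j] equals [ell * z] with
    [z] an integer of [K0]; multiplying by [alpha ^+ j] puts 1 in [l]. *)
Lemma integers_pfactor x : Z0 x -> x != 0 ->
  exists n s, [/\ Z0 s, ~ l s & x = alpha ^+ n * s].
Proof.
move=> Zx x0; apply: contrapT => nx; have a0 := alpha_neq0.
have an0 n : alpha ^+ n != 0 by rewrite expf_neq0.
have dvdx n : Z0 (x / alpha ^+ n).
  elim: n => [|n IHn]; first by rewrite divr1.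
  have [lx|nlx] := pselect (l (x / alpha ^+ n)); last first.
    by case: nx; exists n, (x / alpha ^+ n); rewrite mulrCA divff ?mulr1.
  have [y Zy yE] := (idealP _).1 lx.
  suff -> : x / alpha ^+ n.+1 = y by [].
  by rewrite exprSr invfM mulrA yE mulrAC divff // mul1r.
have [D D0 OD] := integers_bound hO dK0 dK.
have [D' D'0 OD'] := order_scale hO x^-1.
have [b Ob] := order_zspan hO.
pose N := (D * D')%N; have N0 : (0 < N)%N by rewrite muln_gt0 D0.
have ON n : zspan b (N%:R / alpha ^+ n).
  rewrite -Ob; have -> : N%:R / alpha ^+ n = D%:R * ((D'%:R * x^-1) * (x / alpha ^+ n)).
    by rewrite natrM; field; rewrite x0 an0.
  apply/OD/integersM; first exact: (order_integral hO).
  exact: integers_sub (dvdx n).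
have Nl0 : (0 < N * ell)%N by rewrite muln_gt0 N0 prime_gt0.
have [i [j [z [ij zz e]]]] := zspan_pigeonhole Nl0 ON.
have Nn0 : N%:R != 0 :> K by rewrite natrK_eq0 -lt0n.
have {}e : (alpha ^+ i)^-1 - (alpha ^+ j)^-1 = ell%:R * z.
  by apply: (mulfI Nn0); rewrite mulrBr e natrM mulrA.
have ezK : z = ((alpha ^+ i)^-1 - (alpha ^+ j)^-1) / ell%:R.
  by rewrite e mulrC mulKf // natrK_eq0 -lt0n prime_gt0.
have Zz : Z0 z.
  apply: integersW; last by apply: (order_integral hO); rewrite Ob.
  have K0a : alpha \in K0 by case: Zalpha.
  by rewrite ezK memvM ?memvV ?rpred_nat // memvB ?memvV // rpredX.
apply: ideal_not1.
have -> : 1 = alpha * alpha ^+ (j - i).-1 - alpha ^+ j * z * ell%:R.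
  have -> : alpha ^+ j * z * ell%:R = alpha ^+ j * (ell%:R * z) by ring.
  have jE : alpha ^+ j = alpha ^+ (j - i) * alpha ^+ i by rewrite -exprD subnK // ltnW.
  by rewrite -e -exprS prednK ?subn_gt0 // mulrBr divff // jE mulfK // opprB addrC subrK.
apply: idealB; first by apply/idealP; exists (alpha ^+ (j - i).-1) => //; apply: integersX.
by apply: idealM ideal_ell; apply: integersM => //; apply: integersX.
Qed.

Lemma valring_factor x : valring x -> x != 0 ->
  exists n u, [/\ valring u, valring u^-1 & x = alpha ^+ n * u].
Proof.
move=> [K0x [s us Zx]] x0; have s0 := locunit_neq0 us.
have [n [t [Zt lt xE]]] := integers_pfactor Zx (mulf_neq0 s0 x0).
exists n, (s^-1 * t); split.
- by apply: valringM; [exact: locunit_inv | exact: valring_int].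
- rewrite invfM invrK; apply: valringM; last exact: valring_inv.
  exact/valring_int/locunit_int.
- by rewrite mulrCA -xE mulKf.
Qed.

(** Nonzero elements are units times powers of [alpha], and [n] is the least exponent with
    [alpha ^+ n] in [I]. *)
Lemma valring_ideal (I : set K) :
    I `<=` valring -> (forall r x, valring r -> I x -> I (r * x)) ->
    (exists2 x, I x & x != 0) ->
  exists n, I (alpha ^+ n) /\ forall x, I x -> exists2 r, valring r & x = alpha ^+ n * r.
Proof.
move=> IR IM [x0 Ix0 nx0].
have factor x : I x -> x != 0 -> exists n u, [/\ valring u, I (alpha ^+ n) & x = alpha ^+ n * u].
  move=> Ix nx; have [n [u [Ru Ru' xE]]] := valring_factor (IR _ Ix) nx.
  exists n, u; split=> //; have -> : alpha ^+ n = u^-1 * x; last exact: IM.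
  by rewrite xE mulrCA mulVf ?mulr1 //; apply: contra_neq nx => u0; rewrite xE u0 mulr0.
have exI : exists n, `[< I (alpha ^+ n) >].
  by have [n [u [_ In _]]] := factor _ Ix0 nx0; exists n; apply/asboolP.
exists (ex_minn exI); case: ex_minnP => n /asboolP In nmin; split=> // x Ix.
have [->|nx] := eqVneq x 0; first by exists 0; rewrite ?mulr0 //; apply: valring0.
have [k [u [Ru Ik ->]]] := factor _ Ix nx.
have /subnKC <- : (n <= k)%N by apply: nmin; apply/asboolP.
exists (alpha ^+ (k - n) * u); last by rewrite exprD mulrA.
by apply: valringM => //; apply: valringX valring_alpha.
Qed.

(** * Coordinates over K0 and bases of localized modules *)

Lemma real_coord w x : w \notin K0 -> exists a b, [/\ a \in K0, b \in K0 & x = a + b * w].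
Proof.
move=> nw; have dK' : \dim {:K} = (2 * \dim K0)%N by rewrite dK dK0.
have [w0 [_ _ _ gen]] := @quadratic_generator _ K0 {:K}%AS (subvf _) dK'.
have [p [q [K0p K0q wE]]] := gen w (memvf w).
have q0 : q != 0 by apply: contraNneq nw => q0; rewrite wE q0 mul0r addr0.
have [a [b [K0a K0b ->]]] := gen x (memvf x).
exists (a - b / q * p), (b / q); split.
- by apply: memvB => //; apply: memvM => //; rewrite memvM ?memvV.
- by rewrite memvM ?memvV.
- by rewrite wE; field.
Qed.

Lemma real_coord_inj w a b c d : w \notin K0 -> a \in K0 -> b \in K0 -> c \in K0 -> d \in K0 ->
  a + b * w = c + d * w -> a = c /\ b = d.
Proof.
move=> nw K0a K0b K0c K0d e; have e' : (b - d) * w = c - a.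
  by apply/eqP; rewrite -subr_eq0 (_ : (b - d) * w - (c - a) = (a + b * w) - (c + d * w));
    [rewrite e subrr | ring].
have bd : b = d.
  apply/eqP; rewrite -subr_eq0; apply: contraNT nw => bd0.
  by rewrite -[w](mulKf bd0) e' memvM ?memvV ?memvB.
by split=> //; apply/eqP; rewrite eq_sym -subr_eq0 -e' bd subrr mul0r.
Qed.

Lemma order_scale_family n (f : 'I_n -> K) :
  exists2 D : nat, (0 < D)%N & forall i, O (D%:R * f i).
Proof.
have /choice[D DP] i : exists D : nat, (0 < D)%N /\ O (D%:R * f i).
  by have [D ? ?] := order_scale hO (f i); exists D.
exists (\prod_i D i)%N; first by rewrite prodn_gt0 // => i; case: (DP i).
move=> i; rewrite (bigD1 i) //= natrM mulrAC mulrC; apply: orderM => //; last by case: (DP i).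
exact: (order_int hO (Posz _)).
Qed.

Lemma order_real x : O x -> x \in K0 -> Z0 x.
Proof. by move=> /(order_integral hO) Zx K0x; apply: integersW. Qed.

Lemma order_coord_bound w : w \notin K0 -> exists2 D : nat, (0 < D)%N &
  forall a b, a \in K0 -> b \in K0 -> O (a + b * w) -> Z0 (D%:R * a) /\ Z0 (D%:R * b).
Proof.
move=> nw; have [e Oe] := order_zspan hO.
have /choice[p pP] i : exists p : K * K, [/\ p.1 \in K0, p.2 \in K0 & e i = p.1 + p.2 * w].
  by have [a [b [? ? ?]]] := real_coord (e i) nw; exists (a, b).
have [D1 D10 OD1] := order_scale_family (fun i => (p i).1).
have [D2 D20 OD2] := order_scale_family (fun i => (p i).2).
exists (D1 * D2)%N; first by rewrite muln_gt0 D10.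
move=> a b K0a K0b; rewrite Oe => -[c cE].
have [] := @real_coord_inj w a b (\sum_i (c i)%:~R * (p i).1) (\sum_i (c i)%:~R * (p i).2) nw K0a K0b.
- by apply: memv_suml => i _; apply: memvM; [exact: memv_int | case: (pP i)].
- by apply: memv_suml => i _; apply: memvM; [exact: memv_int | case: (pP i)].
- rewrite cE mulr_suml -big_split /=; apply: eq_bigr => i _; case: (pP i) => _ _ ->; ring.
move=> -> ->; rewrite !mulr_sumr; split; apply: (@big_ind _ Z0) => [|x y|i _];
  try exact: (integers_nat K0 0); try exact: integersD.
- have -> : (D1 * D2)%:R * ((c i)%:~R * (p i).1) = (D2%:Z * c i)%:~R * (D1%:R * (p i).1).
    by rewrite natrM rmorphM /= -pmulrn; ring.
  by apply: integersM; [exact: integers_int | apply: order_real => //;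
    rewrite memvM ?rpred_nat //; case: (pP i)].
- have -> : (D1 * D2)%:R * ((c i)%:~R * (p i).2) = (D1%:Z * c i)%:~R * (D2%:R * (p i).2).
    by rewrite natrM rmorphM /= -pmulrn; ring.
  by apply: integersM; [exact: integers_int | apply: order_real => //;
    rewrite memvM ?rpred_nat //; case: (pP i)].
Qed.

Lemma nat_pfactor D : (0 < D)%N -> exists d s, [/\ Z0 s, ~ l s & D%:R = alpha ^+ d * s].
Proof.
by move=> D0; apply: integers_pfactor; [exact: integers_nat | rewrite natrK_eq0 -lt0n].
Qed.

(** [O], the maximal order, the lattice [A] and the stable superlattices of [A] are all of this
    kind; the common hypotheses let them share the localization lemmas. *)
Definition order_lattice (N : set K) : Prop :=
  [/\ forall x y, N x -> N y -> N (x - y), forall r x, O r -> N x -> N (r * x), O `<=` N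
    & exists2 D : nat, (0 < D)%N & forall x, N x -> O (D%:R * x)].

Lemma order_lattice_order : order_lattice O.
Proof.
split=> //; [exact: orderB | exact: orderM |].
by exists 1%N => // x; rewrite mul1r.
Qed.

Lemma order_lattice_integers : order_lattice ZK.
Proof.
split; [exact: integersB | | exact: (order_integral hO) | exact: (integers_bound hO dK0 dK)].
by move=> r x /(order_integral hO); apply: integersM.
Qed.

Section Lattice.
Variables (N : set K) (hN : order_lattice N).

Lemma lattice_sub_localize : N `<=` localize N.
Proof. by move=> x Nx; exists 1; [exact: locunit1 | rewrite mul1r]. Qed.

Lemma localizeB x y : localize N x -> localize N y -> localize N (x - y).
Proof.
case: hN => NB NM _ _ [s us Nx] [t ut Ny]; exists (s * t); first exact: locunitM.
have -> : s * t * (x - y) = t * (s * x) - s * (t * y) by ring.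
by apply: NB; apply: NM => //; apply: locunit_order.
Qed.

Lemma localize0 : localize N 0.
Proof.
case: hN => _ _ ON _; exists 1; first exact: locunit1.
by rewrite mulr0; apply: ON; apply: order0.
Qed.

Lemma localizeD x y : localize N x -> localize N y -> localize N (x + y).
Proof.
move=> Nx Ny; rewrite -[y]opprK; apply: localizeB => //.
by rewrite -[- y]sub0r; apply: localizeB => //; apply: localize0.
Qed.

Lemma localizeOM x y : localize O x -> localize N y -> localize N (x * y).
Proof.
case: hN => NB NM _ _ [s us Ox] [t ut Ny]; exists (s * t); first exact: locunitM.
have -> : s * t * (x * y) = (s * x) * (t * y) by ring.
exact: NM.
Qed.

Lemma localizeM r x : valring r -> localize N x -> localize N (r * x).
Proof. by move/valring_localize; apply: localizeOM. Qed.

(** A triangular basis. The factor [alpha ^+ d] clears all denominators at [l]; after scaling by it,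
    the elements of the localized module in [K0] form an ideal of the valuation ring, and so do the
    [w]-coordinates of all its elements. A generator of the first and an element whose
    [w]-coordinate generates the second form the basis. *)
Lemma localize_basis : exists x1 x2, [/\ x1 \in K0, x2 \notin K0, localize N x1, localize N x2
  & forall x, localize N x -> exists r1 r2, [/\ valring r1, valring r2 & x = r1 * x1 + r2 * x2]].
Proof.
case: (hN) => _ _ ON [D D0 OD]; have a0 := alpha_neq0.
have [w Ow nw] : exists2 w, O w & w \notin K0.
  have /subvPn[w0 _ nw0] : ~~ (fullv <= K0)%VS.
    by apply/negP => /dimvS; rewrite dK dK0.
  have [k k0 Okw] := order_scale hO w0; exists (k%:R * w0) => //.
  apply: contra nw0 => Kw; have k0' : k%:R != 0 :> K by rewrite natrK_eq0 -lt0n.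
  by rewrite -[w0](mulKf k0') memvM ?memvV ?rpred_nat.
have [D1 D10 bound] := order_coord_bound nw.
have [d [s [Zs ls DE]]] : exists d s, [/\ Z0 s, ~ l s & (D1 * D)%:R = alpha ^+ d * s].
  by apply: nat_pfactor; rewrite muln_gt0 D10.
have s0 : s != 0 by apply: contra_not_neq ls => ->; apply: ideal0.
have ad0 : alpha ^+ d != 0 by rewrite expf_neq0.
have K0a n : alpha ^+ n \in K0 by case: Zalpha => K0a _; rewrite rpredX.
have den a b : a \in K0 -> b \in K0 -> localize N (a + b * w) ->
    valring (alpha ^+ d * a) /\ valring (alpha ^+ d * b).
  move=> K0a' K0b [t ut /OD Oab]; have K0t : t \in K0 by case: ut.
  have t0 := locunit_neq0 ut.
  have [] := bound (D%:R * t * a) (D%:R * t * b).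
  - by apply: memvM => //; apply: memvM => //; apply: rpred_nat.
  - by apply: memvM => //; apply: memvM => //; apply: rpred_nat.
  - by move: Oab; congr O; ring.
  have E y : alpha ^+ d * y = t^-1 * s^-1 * (D1%:R * (D%:R * t * y)).
    have -> : D1%:R * (D%:R * t * y) = (D1 * D)%:R * t * y by rewrite natrM; ring.
    by rewrite DE; field; rewrite s0 t0.
  have Rts : valring (t^-1 * s^-1) by apply: valringM; [exact: locunit_inv | exact: valring_inv].
  by move=> Za Zb; rewrite !E; split; apply: valringM => //; apply: valring_int.
have [|||n1 [[a1 [K0a1 Na1 a1E]] gen1]] := @valring_ideal
    [set y | exists a, [/\ a \in K0, localize N a & y = alpha ^+ d * a]].
- move=> _ [a [Ka Na ->]].
  by have := den a 0 Ka (mem0v _); rewrite mul0r addr0 => /(_ Na)[].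
- move=> r _ Rr [a [Ka Na ->]]; exists (r * a); split; last by ring.
    by apply: memvM => //; exact: valring_sub.
  exact: localizeM.
- exists (alpha ^+ d) => //; exists 1; split; [exact: mem1v | | by rewrite mulr1].
  by apply/lattice_sub_localize/ON; apply: order1.
have [|||n2 [[b2 [K0b2 [a2 [K0a2 Nx2]] b2E]] gen2]] := @valring_ideal
    [set y | exists b, [/\ b \in K0, (exists a, a \in K0 /\ localize N (a + b * w)) & y =
      alpha ^+ d * b]].
- by move=> _ [b [Kb [a [Ka Na]] ->]]; have [] := den a b Ka Kb Na.
- move=> r _ Rr [b [Kb [a [Ka Na]] ->]]; exists (r * b).
  have K0r := valring_sub Rr; split; [exact: memvM | | by ring].
  exists (r * a); split; first exact: memvM.
  by rewrite -mulrA -mulrDr; apply: localizeM.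
- exists (alpha ^+ d) => //; exists 1; split; [exact: mem1v | | by rewrite mulr1].
  exists 0; split; [exact: mem0v | rewrite add0r mul1r].
  exact/lattice_sub_localize/ON.
have nb2 : b2 != 0.
  by apply: contra_eq_neq b2E => ->; rewrite mulr0 expf_neq0.
exists a1, (a2 + b2 * w); split=> //.
  apply: contra nw => K0x; rewrite -[w](mulKf nb2) memvM ?memvV //.
  by rewrite -[b2 * w](addKr a2) memvD ?memvN.
move=> x Nx; have [a [b [K0a' K0b xE]]] := real_coord x nw.
have [r2 Rr2 e2] : exists2 r, valring r & alpha ^+ d * b = alpha ^+ n2 * r.
  by apply: gen2; exists b; split=> //; exists a; rewrite -xE.
have bE : b = r2 * b2 by apply: (mulfI ad0); rewrite e2 b2E; ring.
have Na : localize N (a - r2 * a2).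
  have -> : a - r2 * a2 = x - r2 * (a2 + b2 * w) by rewrite xE bE; ring.
  by apply: localizeB => //; apply: localizeM.
have K0r : a - r2 * a2 \in K0 by rewrite memvB // memvM // valring_sub.
have [r1 Rr1 e1] : exists2 r, valring r & alpha ^+ d * (a - r2 * a2) = alpha ^+ n1 * r.
  by apply: gen1; exists (a - r2 * a2).
have aE : a - r2 * a2 = r1 * a1 by apply: (mulfI ad0); rewrite e1 a1E; ring.
by exists r1, r2; split=> //; rewrite -aE xE bE; ring.
Qed.
End Lattice.

(** The localized maximal order is [R + R x2], and [k] is the exponent of the ideal of those [b]
    with [b x2] in the localization of [O]. As the latter contains [R], an element [a + b x2]
    belongs to it only if [b] is in this ideal. *)
Lemma order_structure : exists w k,
  [/\ w \notin K0, localize ZK w, O (alpha ^+ k * w),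
    (forall x, localize ZK x -> exists a b, [/\ valring a, valring b & x = a + b * w])
  & (forall x, localize O x -> exists a b,
       [/\ valring a, valring b & x = a + b * (alpha ^+ k * w)])].
Proof.
have [x1 [x2 [K0x1 nx2 ix1 ix2 gen]]] := localize_basis order_lattice_integers.
have Rx1 : valring x1 by apply: valring_integers.
have genZ x : localize ZK x -> exists a b, [/\ valring a, valring b & x = a + b * x2].
  move=> /gen[r1 [r2 [Rr1 Rr2 ->]]]; exists (r1 * x1), r2; split=> //.
  exact: valringM.
have OZ x : localize O x -> localize ZK x.
  by case=> s us /(order_integral hO) Osx; exists s.
have [|||k [Ok genk]] := @valring_ideal [set b | valring b /\ localize O (b * x2)].
- by move=> b [].
- move=> r b Rr [Rb Ob]; split; first exact: valringM.
  by rewrite -mulrA; apply: (localizeM order_lattice_order).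
- have [D D0 ODx] := order_scale hO x2; exists D%:R; last by rewrite natrK_eq0 -lt0n.
  split; first exact/valring_int/integers_nat.
  exact: (lattice_sub_localize ODx).
case: Ok => _ [s us Os]; have s0 := locunit_neq0 us.
(* The denominator [s] is absorbed in [w], so that [alpha ^+ k * w] lies in [O] and not only in its
   localization. *)
exists (s * x2), k; split.
- apply: contra nx2 => Ksx; rewrite -[x2](mulKf s0) memvM ?memvV //.
  by case: us.
- case: ix2 => t ut Zt; exists t => //; rewrite mulrCA; apply: integersM => //.
  exact/(order_integral hO)/locunit_order.
- by rewrite mulrCA.
- move=> x /genZ[a [b [Ra Rb ->]]]; exists a, (b / s); split=> //.
    by apply: valringM => //; apply: locunit_inv.
  by rewrite mulrA divfK.
move=> x Ox; have [a [b [Ra Rb xE]]] := genZ _ (OZ _ Ox).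
have [|r Rr bE] := genk b; first split=> //.
  have -> : b * x2 = x - a by rewrite xE addrC addKr.
  by apply: (localizeB order_lattice_order) => //; apply: valring_localize.
exists a, (r / s); split=> //; first by apply: valringM => //; apply: locunit_inv.
by rewrite xE bE; field.
Qed.

(** * Coprimality to the conductor *)

Lemma extended_idealP x : extended_ideal l x <-> exists2 z, ZK z & x = alpha * z.
Proof.
split=> [[n [a [b [la Zb ->]]]] | [z Zz ->]].
  have /choice[c cP] i : exists c, Z0 c /\ a i = alpha * c.
    by have [y Zy ->] := (idealP _).1 (la i); exists y.
  exists (\sum_i c i * b i).
    apply: (@big_ind _ ZK) => [|u v|i _]; [exact: (integers_nat _ 0) | exact: integersD |].
    by apply: integersM => //; apply: (@integers_sub _ K0); case: (cP i).
  by rewrite mulr_sumr; apply: eq_bigr => i _; rewrite mulrA; case: (cP i) => _ ->.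
exists 1%N, (fun=> alpha), (fun=> z); split=> // [i|]; last by rewrite big_ord1.
by apply/idealP; exists 1; rewrite ?mulr1 //; apply: (integers_nat _ 1).
Qed.

(** From [1 = alpha z + c] with [c] in the conductor, induction gives [1 = alpha ^+ n z' + c'] for
    every [n]. If [D = alpha ^+ n s] multiplies the maximal order into [O], then [s = D z' + s c']
    lies in the conductor and is prime to [l]. *)
Lemma coprime_conductorP : coprime_ideals ZK (extended_ideal l) (conductor O) <->
  exists2 s, locunit s & forall x, ZK x -> O (s * x).
Proof.
have fD x y : conductor O x -> conductor O y -> conductor O (x + y).
  move=> [Zx Ox] [Zy Oy]; split; first exact: integersD.
  by move=> z Zz; rewrite mulrDl; apply: orderD => //; [apply: Ox | apply: Oy].
have fM x y : ZK x -> conductor O y -> conductor O (x * y).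
  move=> Zx [Zy Oy]; split; first exact: integersM.
  by move=> z Zz; rewrite mulrAC mulrC; apply: Oy; apply: integersM.
split=> [cop | [s us sO]]; last first.
  have [_ _ ls] := us; have Zs := locunit_int us.
  have [u /idealP[z Zz uE]] := ideal_inverse Zs ls.
  apply/seteqP; split=> [_ [a [b [/extended_idealP[y Zy ->] [Zb _] ->]]] | x Zx].
    by apply: integersD => //; apply: integersM => //; apply: integers_sub Zalpha.
  exists (alpha * (- z * x)), (u%:~R * s * x); split.
  - apply/extended_idealP; exists (- z * x) => //; apply: integersM => //.
    exact/integersN/integers_sub/Zz.
  - rewrite mulrAC; apply: fM; first by apply: integersM => //; apply: integers_int.
    by split; [exact: integers_sub Zs | exact: sO].
  - by have -> : u%:~R * s = alpha * z + 1 by [rewrite -uE subrK]; ring.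
have [a [c [/extended_idealP[z Zz ->] fc e1]]] : ideal_add (extended_ideal l) (conductor O) 1.
  by rewrite [ideal_add _ _]cop; apply: (integers_nat _ 1).
have power n : exists z c, [/\ ZK z, conductor O c & 1 = alpha ^+ n * z + c].
  elim: n => [|n [z' [c' [Zz' fc' e]]]].
    exists 1, 0; rewrite expr0 mul1r addr0; split=> //; first exact: (integers_nat _ 1).
    split=> [|y _]; first exact: (integers_nat _ 0).
    by rewrite mul0r; apply: order0.
  exists (z' * z), (alpha ^+ n * z' * c + c'); split; first exact: integersM.
    apply: fD => //; apply: fM => //; apply: integersM => //; apply: integersX.
    exact: integers_sub Zalpha.
  by rewrite [LHS]e -[X in X + c' = _]mulr1 [X in _ * X + c' = _]e1 exprS; ring.
have [D D0 OD] := integers_bound hO dK0 dK.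
have [n [s [Zs ls DE]]] := nat_pfactor D0.
have [z' [c' [Zz' fc' e]]] := power n.
have [_ fs] : conductor O s.
  have -> : s = D%:R * z' + s * c' by rewrite DE -[LHS]mulr1 [X in s * X = _]e; ring.
  apply: fD; last by apply: fM => //; apply: integers_sub Zs.
  split; first by apply: integersM => //; apply: (integers_nat _ D).
  by move=> y Zy; rewrite -mulrA; apply: OD; apply: integersM.
exists s => //; split=> //; last by case: Zs.
by rewrite -[s]mulr1; apply: fs; apply: (integers_nat _ 1).
Qed.

(** [t] is prime to [alpha]: since [alpha] divides [t * (alpha ^+ n.+1 * y)], it divides the second
    factor, and the exponent drops by one. *)
Lemma integers_cancel n y t : locunit t -> y \in K0 -> Z0 (t * y) ->
  Z0 (alpha ^+ n * y) -> Z0 y.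
Proof.
move=> ut K0y Zty; elim: n => [|n IHn]; first by rewrite mul1r.
move=> Za; apply: IHn; have a0 := alpha_neq0.
have : l (t * (alpha ^+ n.+1 * y)).
  apply/idealP; exists (alpha ^+ n * (t * y)); last by rewrite exprS; ring.
  by apply: integersM => //; apply: integersX.
case/ideal_prime => //; [exact: locunit_int | by case: ut |].
case/idealP=> z Zz; rewrite exprS -mulrA => /(mulfI a0) ->.
exact: Zz.
Qed.

(** Coprimality puts [w] in the localization of [O], so [alpha ^+ k] divides 1. Conversely one [s]
    must serve for the whole maximal order: if [alpha ^+ d * s] clears the denominators of all
    coordinates, then [s] alone clears them, because the coordinates are already integral at [l]. *)
Lemma order_structure_coprime w k : w \notin K0 -> localize ZK w -> O (alpha ^+ k * w) ->
    (forall x, localize ZK x -> exists a b, [/\ valring a, valring b & x = a + b * w]) ->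
    (forall x, localize O x -> exists a b,
       [/\ valring a, valring b & x = a + b * (alpha ^+ k * w)]) ->
  coprime_ideals ZK (extended_ideal l) (conductor O) <-> k = 0.
Proof.
move=> nw [t ut Ztw] Ow genZ genO; have a0 := alpha_neq0.
split=> [/coprime_conductorP[s us sO] | k0].
  have [|a [b [Ra Rb wE]]] := genO w.
    by exists (s * t); [exact: locunitM | rewrite -mulrA; apply: sO].
  case: k Ow wE genO => // k Ow wE _; case: valring_alphaV.
  have [||||| _ b1] := @real_coord_inj w 0 1 a (b * alpha ^+ k.+1) nw.
  - exact: mem0v.
  - exact: mem1v.
  - exact: valring_sub.
  - by apply: memvM; [exact: valring_sub | case: Zalpha => K0a _; rewrite rpredX].
  - by rewrite {1}wE; ring.
  have -> : alpha^-1 = b * alpha ^+ k by rewrite -[LHS]mul1r b1 exprSr; field.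
  by apply: valringM => //; apply: valringX valring_alpha.
apply/coprime_conductorP; move: Ow; rewrite {}k0 mul1r => Ow.
have [D D0 OD] := integers_bound hO dK0 dK.
have [D1 D10 bound] := order_coord_bound nw.
have [d [s [Zs ls DE]]] : exists d s, [/\ Z0 s, ~ l s & (D1 * D)%:R = alpha ^+ d * s].
  by apply: nat_pfactor; rewrite muln_gt0 D10.
have [s' [us' us's Os']] := int_to_locunit Zs ls.
exists (s' * s) => // x Zx.
have [|a [b [Ra Rb xE]]] := genZ x; first exact: (lattice_sub_localize Zx).
have [Za Zb] : Z0 (D1%:R * (D%:R * a)) /\ Z0 (D1%:R * (D%:R * b)).
  apply: bound; try by apply: memvM; [exact: rpred_nat | exact: valring_sub].
  by have := OD _ Zx; rewrite xE; congr O; ring.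
have num y : valring y -> Z0 (D1%:R * (D%:R * y)) -> Z0 (s * y).
  move=> [K0y [s1 us1 Zs1]] Zy; apply: (@integers_cancel d _ s1) => //.
  - by apply: memvM => //; case: Zs.
  - by rewrite mulrCA; apply: integersM.
  - by rewrite mulrA -DE natrM -mulrA.
have -> : s' * s * x = s' * (s * a) + s' * (s * b) * w by rewrite xE; ring.
by apply: orderD => //; [apply/Os'/num | apply: orderM => //; apply/Os'/num].
Qed.

(** The product of the denominators found on the finitely many generators serves for the whole
    group; this turns multipliers of a localization into localized multipliers. *)
Lemma zspan_localize_uniform n (Y : 'I_n -> K) x :
    (forall s y, locunit s -> zspan Y y -> zspan Y (s * y)) ->
    (forall i, localize (zspan Y) (x * Y i)) ->
  exists2 s, locunit s & forall y, zspan Y y -> zspan Y (s * x * y).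
Proof.
move=> stab loc; have /choice[s sP] i : exists s, locunit s /\ zspan Y (s * (x * Y i)).
  by have [s us sx] := loc i; exists s.
exists (\prod_i s i); first by apply: locunit_prod => i; case: (sP i).
have MB := @zspanB _ _ Y; pose M := [set y | zspan Y (\prod_i s i * x * y)].
move=> y Yy; apply: (@zspanP _ _ Y M _ _ _ y Yy).
- by rewrite /M /= mulr0; apply: zspan0.
- by move=> u v Mu Mv; rewrite /M /= mulrBr; apply: MB.
move=> i; rewrite /M /= (bigD1 i) //=.
have -> : s i * \prod_(j | j != i) s j * x * Y i = \prod_(j | j != i) s j * (s i * (x * Y i))
  by ring.
apply: stab; last by case: (sP i).
by apply: big_ind => [||j _]; [exact: locunit1 | exact: locunitM | case: (sP j)].
Qed.

Lemma int_inverse (d : int) : ~ (ell %| d)%Z -> exists e q : int, e * d = 1 + q * ell.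
Proof.
move=> nd; have /coprimezP[[u v] /= uv] : coprimez d ell.
  by rewrite /coprimez gcdzC -[_ == _]/(coprime _ _) prime_coprime //; apply/negP.
by exists u, (- v); rewrite -uv; ring.
Qed.

Lemma int_prime (a b : int) : (ell %| a * b)%Z -> (ell %| a)%Z \/ (ell %| b)%Z.
Proof. by rewrite !dvdzE abszM Euclid_dvdM // => /orP. Qed.

(** * Completion compared with localization *)

Lemma ideal_pow0 n : ideal_pow l n ZK 0.
Proof.
case: n => [|n]; first exact: (integers_nat _ 0).
exists 0%N, (fun=> 0), (fun=> 0); split; [by case | by case | by rewrite big_ord0].
Qed.

Lemma ideal_pow_sub n x : ideal_pow l n ZK x -> exists2 z, ZK z & x = alpha ^+ n * z.
Proof.
elim: n x => [|n IHn] x; first by exists x; rewrite ?mul1r.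
case=> m [a [b [la lb ->]]].
have /choice[c cP] i : exists c, ZK c /\ a i * b i = alpha ^+ n.+1 * c.
  have [y Zy ->] := (idealP _).1 (la i); have [z Zz ->] := IHn _ (lb i).
  by exists (y * z); split; [apply: integersM => //; apply: integers_sub Zy | rewrite exprS; ring].
exists (\sum_i c i).
  by apply: (@big_ind _ ZK) => [|u v|i _];
    [exact: (integers_nat _ 0) | exact: integersD | case: (cP i)].
by rewrite mulr_sumr; apply: eq_bigr => i _; case: (cP i).
Qed.

Lemma completed_order_mono O1 O2 : O1 `<=` O2 ->
  completed_order K0 l O1 `<=` completed_order K0 l O2.
Proof.
move=> sub u [n [x [a [Ox Za ca nu]]]]; exists n, x, a; split=> // i.
exact: sub.
Qed.

Lemma completed_order_const O1 x : O1 x -> completed_order K0 l O1 (fun=> x).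
Proof.
move=> O1x; exists 1%N, (fun=> x), (fun _ _ => 1); split=> //.
- by move=> *; apply: (integers_nat _ 1).
- move=> _ n; exists 0%N => j k _ _; rewrite subrr.
  case: n => [|n]; first exact: (integers_nat _ 0).
  by exists 0%N, (fun=> 0), (fun=> 0); split; [case | case | rewrite big_ord0].
- by move=> n; exists 0%N => k _; rewrite big_ord1 mulr1 subrr; apply: ideal_pow0.
Qed.

(** The Cauchy sequences are cut at precision [alpha ^+ d], where [D = alpha ^+ d * s]. The error
    [alpha ^+ d * z] becomes [D * z], an element of [O1], after multiplication by [s], and the
    factor [t] brings the terms [a i N] into [O :&: K0]. *)
Lemma completed_order_localize O1 x :
    (forall u v, O1 u -> O1 v -> O1 (u + v)) -> (forall u v, O1 u -> O1 v -> O1 (u * v)) ->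
    (forall r, O r -> r \in K0 -> O1 r) ->
    (exists2 D : nat, (0 < D)%N & forall z, ZK z -> O1 (D%:R * z)) ->
  completed_order K0 l O1 (fun=> x) -> localize O1 x.
Proof.
move=> O1D O1M O1r [D D0 O1z] [n [y [a [O1y Za ca nu]]]].
have [d [s [Zs ls DE]]] := nat_pfactor D0.
have [t [ut uts Ot]] := int_to_locunit Zs ls.
have [N /(_ N (leqnn N))/ideal_pow_sub[z Zz xE]] := nu d.
have O1u r : locunit r -> O1 r by case=> Or K0r _; apply: O1r.
exists (t * (t * s)); first exact: locunitM.
have -> : t * (t * s) * x = (t * s) * (\sum_i y i * (t * a i N)) + t * (t * (D%:R * z)).
  rewrite -[x in LHS](subrK (\sum_i y i * a i N)) xE DE.
  have -> : \sum_i y i * (t * a i N) = t * \sum_i y i * a i N.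
    by rewrite mulr_sumr; apply: eq_bigr => i _; rewrite mulrCA.
  by ring.
apply: (O1D); apply: (O1M); try exact: O1u.
  apply: (@big_ind _ O1) => [|u v|i _]; [apply: (O1r);
    [exact: order0 | exact: mem0v] | exact: O1D |].
  apply: (O1M) => //; apply: (O1r); first exact: Ot.
  by apply: memvM; [case: ut | case: (Za i N)].
by apply: O1M; [exact: O1u | exact: O1z].
Qed.

Lemma integers_localize_cancel t u : locunit t -> ZK (t * u) -> ZK (alpha * u) -> ZK u.
Proof.
move=> ut Ztu Zau; have [_ _ lt] := ut.
have [v /idealP[z Zz vE]] := ideal_inverse (locunit_int ut) lt.
have -> : u = v%:~R * (t * u) - z * (alpha * u).
  by rewrite [z * _]mulrA [z * _]mulrC -vE; ring.
by apply: integersB; apply: integersM => //; [exact: integers_int | exact: integers_sub Zz].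
Qed.

(** * Decomposition of l and roots of the quadratic polynomial modulo ell *)

Section Residue.
Variables (th : K) (tau nu : int).
Hypotheses (Zth : ZK th).
Hypothesis gen : forall x, ZK x -> exists p q : int, exists2 z, ZK z & x =
  p%:~R + q%:~R * th + alpha * z.
Hypothesis indep : forall (p q : int) z, ZK z -> p%:~R + q%:~R * th = alpha * z ->
  (ell %| p)%Z /\ (ell %| q)%Z.
Hypothesis quad : exists2 z, ZK z & th ^+ 2 - tau%:~R * th + nu%:~R = alpha * z.

Local Notation residue_root c := (ell %| c ^+ 2 - tau * c + nu)%Z.
Let aZ : set K := [set x | exists2 z, ZK z & x = alpha * z].

Let aZB x y : aZ x -> aZ y -> aZ (x - y).
Proof.
by move=> [u Zu ->] [v Zv ->]; exists (u - v); [exact: integersB | rewrite mulrBr].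
Qed.

Let aZM x y : ZK x -> aZ y -> aZ (x * y).
Proof. by move=> Zx [v Zv ->]; exists (x * v); [exact: integersM | rewrite mulrCA]. Qed.

Let aZ0 : aZ 0.
Proof. by exists 0; [exact: (integers_nat _ 0) | rewrite mulr0]. Qed.

Let aZD x y : aZ x -> aZ y -> aZ (x + y).
Proof. by move=> ax ay; rewrite -[y]opprK; apply: aZB => //; rewrite -[- y]sub0r; apply: aZB. Qed.

Let aZ_int (n : int) : (ell %| n)%Z -> aZ n%:~R.
Proof. by move=> /ideal_int/idealP[z Zz ->]; exists z => //; apply: integers_sub Zz. Qed.

Let aZ_indep (p q : int) : aZ (p%:~R + q%:~R * th) -> (ell %| p)%Z /\ (ell %| q)%Z.
Proof. by case=> z; apply: indep. Qed.

Let Zint (n : int) : ZK n%:~R := integers_int _ n.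

(** A root [c] would give [(th - c) (th - (tau - c))] in the prime ideal [alpha ZK], although
    neither factor lies there by independence of 1 and [th]. *)
Lemma residue_inert c : inert l -> ~ residue_root c.
Proof.
move=> [_ _ prime_l] div; have [z Zz quadE] := quad.
have ext x : extended_ideal l x <-> aZ x by exact: extended_idealP.
have : aZ ((th - c%:~R) * (th - (tau - c)%:~R)).
  have -> : (th - c%:~R) * (th - (tau - c)%:~R) =
     (th ^+ 2 - tau%:~R * th + nu%:~R) - (c ^+ 2 - tau * c + nu)%:~R.
    by rewrite !(rmorphD, rmorphN, rmorphM, rmorphXn) /=; ring.
  by apply: aZB; [exists z | apply: aZ_int].
have contra d : ~ aZ (th - d%:~R).
  move=> ad; have /aZ_indep[_] : aZ ((- d)%:~R + 1%:~R * th).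
    by have -> : (- d)%:~R + 1%:~R * th = th - d%:~R by rewrite rmorphN /=; ring.
  by rewrite dvdz1 absz_nat => /eqP e1; have := prime_gt1 hell; rewrite e1.
by move=> /ext/prime_l[] //;
  [exact: integersB | exact: integersB | move/ext/contra | move/ext/contra].
Qed.

(* An element of [P] outside [alpha ZK] is congruent to a multiple of some [th - c]. *)
Let linear_factor (P Q : set K) y1 y2 : is_ideal ZK P -> is_ideal ZK Q -> aZ `<=` P -> aZ `<=` Q ->
    P y1 -> ~ aZ y1 -> Q y2 -> ~ aZ y2 -> aZ (y1 * y2) ->
  exists c : int, P (th - c%:~R).
Proof.
move=> [PZ P0 PD PM] [QZ Q0 QD QM] aP aQ Py1 ny1 Qy2 ny2 a12.
have [p [q [z Zz yE]]] := gen (PZ _ Py1).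
have az : aZ (alpha * z) by exists z.
have Ppq : P (p%:~R + q%:~R * th).
  have -> : p%:~R + q%:~R * th = y1 + - 1%:~R * (alpha * z) by rewrite yE; ring.
  by apply: (PD) => //; apply: aP; apply: aZM => //; apply: integersN.
(* Otherwise [y1] is congruent to the integer [p]: either [p] is divisible by [ell] and [y1] is in
   [alpha ZK], or [p] is invertible and [y1 * y2] in [alpha ZK] forces [y2] there. *)
have nq : ~ (ell %| q)%Z.
  move=> eq_; apply: ny2; have np : ~ (ell %| p)%Z.
    move=> ep; apply: ny1; rewrite yE; apply: aZD => //; apply: aZD; first exact: aZ_int.
    by rewrite mulrC; apply: aZM => //; apply: aZ_int.
  have [e [q0 eE]] := int_inverse np.
  have -> : y2 = e%:~R * (y1 * y2) - (y2 * (e%:~R * (q%:~R * th + alpha * z)) + y2 * (q0 * ell)%:~R).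
    have : (e * p)%:~R = (1 + q0 * ell)%:~R :> K by rewrite eE.
    rewrite yE !(rmorphM, rmorphD, rmorph1) /= => E.
    transitivity (y2 * (e%:~R * p%:~R) - y2 * (q0%:~R * ell%:~R)); last by ring.
    by rewrite E; ring.
  have Zy2 := QZ _ Qy2.
  apply: aZB; first exact: aZM.
  apply: aZD; apply: aZM => //; last by apply: aZ_int; apply: dvdz_mull.
  by apply: aZM => //; apply: aZD => //; rewrite mulrC; apply: aZM => //; apply: aZ_int.
have [e [q0 eE]] := int_inverse nq; exists (- (e * p)).
have -> : th - (- (e * p))%:~R = e%:~R * (p%:~R + q%:~R * th) + - th * (q0 * ell)%:~R.
  have : (e * q)%:~R = (1 + q0 * ell)%:~R :> K by rewrite eE.
  rewrite !(rmorphM, rmorphD, rmorphN, rmorph1) /= => E.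
  transitivity (e%:~R * p%:~R + th * (e%:~R * q%:~R) - th * (q0%:~R * ell%:~R)); last by ring.
  by rewrite E; ring.
by apply: (PD); [exact: PM | apply/aP/aZM; [exact: integersN | apply: aZ_int; apply: dvdz_mull]].
Qed.

(** Each of [P], [Q] has an element outside [alpha ZK], since otherwise dividing [alpha], a sum of
    products, by [alpha] would put 1 in the other ideal. Hence both contain some [th - c], and the
    product of these two elements lies in [P Q = alpha ZK]; comparison with the quadratic relation
    gives the congruences. *)
Lemma residue_product P Q : is_prime_ideal ZK P -> is_prime_ideal ZK Q ->
    extended_ideal l = ideal_mul P Q ->
  exists c c' : int, [/\ P (th - c%:~R), Q (th - c'%:~R),
    (ell %| tau - (c + c'))%Z & (ell %| nu - c * c')%Z].
Proof.
move=> primeP primeQ lPQ; have [[PZ P0 PD PM] P1 _] := primeP; have [[QZ Q0 QD QM] Q1 _] := primeQ.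
have a0 := alpha_neq0.
have ext x : ideal_mul P Q x <-> aZ x by rewrite -lPQ; apply: extended_idealP.
have mulPQ x y : P x -> Q y -> aZ (x * y).
  by move=> Px Qy; apply/ext; exists 1%N, (fun=> x), (fun=> y); split=> //; rewrite big_ord1.
have sumP (M : set K) m (F : 'I_m -> K) : M 0 -> (forall u v, M u -> M v -> M (u + v)) ->
    (forall i, M (F i)) -> M (\sum_i F i).
  by move=> M0 MD MF; apply: (@big_ind _ M).
have aP : aZ `<=` P.
  move=> _ /ext[m [u [v [Pu Qv ->]]]]; apply: sumP => // i.
  by rewrite mulrC; apply: (PM) => //; apply: QZ.
have aQ : aZ `<=` Q.
  move=> _ /ext[m [u [v [Pu Qv ->]]]]; apply: sumP => // i.
  by apply: (QM) => //; apply: PZ.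
have aa : aZ alpha by exists 1; [exact: (integers_nat _ 1) | rewrite mulr1].
have [y1 Py1 ny1] : exists2 y, P y & ~ aZ y.
  apply: contrapT => nP; apply: Q1; have [m [u [v [Pu Qv aE]]]] := (ext _).2 aa.
  have /choice[z zP] i : exists z, ZK z /\ u i = alpha * z.
    have [z Zz uE] : aZ (u i) by apply: contrapT => nui; apply: nP; exists (u i).
    by exists z.
  have -> : 1 = \sum_i v i * z i.
    apply: (mulfI a0); rewrite mulr1 {1}aE mulr_sumr; apply: eq_bigr => i _.
    by case: (zP i) => _ ->; ring.
  by apply: sumP => // i; rewrite mulrC; apply: (QM) => //; case: (zP i).
have [y2 Qy2 ny2] : exists2 y, Q y & ~ aZ y.
  apply: contrapT => nQ; apply: P1; have [m [u [v [Pu Qv aE]]]] := (ext _).2 aa.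
  have /choice[z zP] i : exists z, ZK z /\ v i = alpha * z.
    have [z Zz uE] : aZ (v i) by apply: contrapT => nvi; apply: nQ; exists (v i).
    by exists z.
  have -> : 1 = \sum_i z i * u i.
    apply: (mulfI a0); rewrite mulr1 {1}aE mulr_sumr; apply: eq_bigr => i _.
    by case: (zP i) => _ ->; ring.
  by apply: sumP => // i; apply: (PM) => //; case: (zP i).
have idP : is_ideal ZK P by []. have idQ : is_ideal ZK Q by [].
have [c Pc] := linear_factor idP idQ aP aQ Py1 ny1 Qy2 ny2 (mulPQ _ _ Py1 Qy2).
have a21 : aZ (y2 * y1) by rewrite mulrC; apply: mulPQ.
have [c' Qc'] := linear_factor idQ idP aQ aP Qy2 ny2 Py1 ny1 a21.
exists c, c'; have [z Zz quadE] := quad.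
have : aZ ((c * c' - nu)%:~R + (tau - (c + c'))%:~R * th).
  have -> : (c * c' - nu)%:~R + (tau - (c + c'))%:~R * th =
     (th - c%:~R) * (th - c'%:~R) - (th ^+ 2 - tau%:~R * th + nu%:~R).
    by rewrite !(rmorphD, rmorphN, rmorphM) /=; ring.
  by apply: aZB; [exact: mulPQ | exists z].
by case/aZ_indep => d1 d2; split=> //; rewrite -rpredN opprB.
Qed.

(** [P] is generated by [alpha] and [th - c]: modulo these an element of [P] becomes an integer,
    divisible by [ell] since otherwise 1 would lie in [P]. So [c] modulo [ell] determines [P]. *)
Let prime_linear P Q c c' : is_prime_ideal ZK P -> is_ideal ZK Q -> aZ `<=` P -> aZ `<=` Q ->
  P (th - c%:~R) -> Q (th - c'%:~R) -> (ell %| c - c')%Z -> P `<=` Q.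
Proof.
move=> [[PZ P0 PD PM] P1 _] [QZ Q0 QD QM] aP aQ Pc Qc' div x Px.
have [p [q [z Zz xE]]] := gen (PZ _ Px).
have az : aZ (alpha * z) by exists z.
have Ppq : P (p + q * c)%:~R.
  have -> : (p + q * c)%:~R = x + ((- q)%:~R * (th - c%:~R) + (- 1)%:~R * (alpha * z)).
    by rewrite xE !(rmorphD, rmorphN, rmorphM, rmorph1) /=; ring.
  by apply: (PD) => //; apply: (PD); [apply: (PM) | apply/aP/aZM].
have epq : (ell %| p + q * c)%Z.
  apply: contrapT => npq; have [e [q0 eE]] := int_inverse npq; apply: P1.
  have -> : 1 = e%:~R * (p + q * c)%:~R + (- (q0 * ell))%:~R :> K.
    by rewrite -rmorphM /= eE -rmorphD /= addrK.
  by apply: (PD); [apply: (PM) | apply/aP/aZ_int; rewrite rpredN dvdz_mull].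
have -> : x = (p + q * c)%:~R + (q%:~R * (th - c'%:~R) + ((- q * (c - c'))%:~R + alpha * z)).
  by rewrite xE !(rmorphD, rmorphN, rmorphM) /=; ring.
apply: (QD); first exact/aQ/aZ_int.
apply: (QD); first exact: QM.
by apply/aQ/aZD => //; apply: aZ_int; rewrite dvdz_mull.
Qed.

Lemma residue_factor c c' d : (ell %| tau - (c + c'))%Z -> (ell %| nu - c * c')%Z ->
  residue_root d <-> (ell %| d - c)%Z \/ (ell %| d - c')%Z.
Proof.
move=> et en; have E : d ^+ 2 - tau * d + nu =
  (d - c) * (d - c') - (tau - (c + c')) * d + (nu - c * c') by ring.
have e0 : (ell %| - (tau - (c + c')) * d + (nu - c * c'))%Z.
  by apply: rpredD => //; rewrite mulNr rpredN dvdz_mulr.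
rewrite E -addrA -mulNr; split=> [div | ediv]; last first.
  by apply: rpredD => //; case: ediv => ?; [rewrite dvdz_mulr | rewrite dvdz_mull].
by apply: int_prime; have := rpredB div e0; rewrite addrK.
Qed.

Lemma residue_splits : splits l -> exists c c' : int, ~ (ell %| c - c')%Z /\
  forall d, residue_root d <-> (ell %| d - c)%Z \/ (ell %| d - c')%Z.
Proof.
move=> [P [Q [primeP primeQ nPQ lPQ]]].
have [c [c' [Pc Qc' et en]]] := residue_product primeP primeQ lPQ.
exists c, c'; split=> [div | d]; last exact: residue_factor.
have [idP _ _] := primeP; have [idQ _ _] := primeQ.
have [PZ P0 PD PM] := idP; have [QZ Q0 QD QM] := idQ.
have ext x : ideal_mul P Q x <-> aZ x by rewrite -lPQ; apply: extended_idealP.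
have aP : aZ `<=` P.
  move=> _ /ext[m [u [v [Pu Qv ->]]]]; apply: (@big_ind _ P) => // i _.
  by rewrite mulrC; apply: (PM) => //; apply: QZ.
have aQ : aZ `<=` Q.
  move=> _ /ext[m [u [v [Pu Qv ->]]]]; apply: (@big_ind _ Q) => // i _.
  by apply: (QM) => //; apply: PZ.
apply: nPQ; apply/seteqP; split; first exact: prime_linear primeP idQ aP aQ Pc Qc' div.
by apply: prime_linear primeQ idP aQ aP Qc' Pc _; rewrite -rpredN opprB.
Qed.

Lemma residue_ramifies : ramifies l -> exists c : int,
  forall d, residue_root d <-> (ell %| d - c)%Z.
Proof.
move=> [P [primeP lPP]]; have [c [c' [Pc Pc' et en]]] := residue_product primeP primeP lPP.
have [idP P1 _] := primeP; have [PZ P0 PD PM] := idP.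
have ext x : ideal_mul P P x <-> aZ x by rewrite -lPP; apply: extended_idealP.
have aP : aZ `<=` P.
  move=> _ /ext[m [u [v [Pu Qv ->]]]]; apply: (@big_ind _ P) => // i _.
  by apply: (PM) => //; apply: PZ.
(* [P] contains the integer [c' - c]; if it were prime to [ell], then [P] would contain 1. *)
have div : (ell %| c' - c)%Z.
  apply: contrapT => nd; have [e [q0 eE]] := int_inverse nd; apply: P1.
  have -> : 1 = e%:~R * (th - c%:~R) + ((- e)%:~R * (th - c'%:~R) + (- (q0 * ell))%:~R) :> K.
    have : (e * (c' - c))%:~R = (1 + q0 * ell)%:~R :> K by rewrite eE.
    rewrite !(rmorphM, rmorphD, rmorphN, rmorph1) /= => E.
    transitivity (e%:~R * (c'%:~R - c%:~R) - q0%:~R * ell%:~R :> K); last by ring.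
    by rewrite E; ring.
  by apply: (PD); [exact: PM | apply: (PD); [exact: PM | apply/aP/aZ_int;
    rewrite rpredN dvdz_mull]].
exists c => d; split; last by move=> ?; apply/(residue_factor d et en); left.
case/(residue_factor d et en) => // d1.
by have := rpredD d1 div; rewrite addrA subrK.
Qed.
End Residue.

(** * The l-torsion plane of the lattice *)

Section Module.
Variables (A : set K) (n : nat) (X : 'I_n -> K).
Hypotheses (AX : A = zspan X) (A1 : A 1) (multA : forall x, O x <-> forall a, A a -> A (x * a)).

Definition torsion : set K := [set x | forall b, l b -> O b -> A (b * x)].

Lemma moduleB x y : A x -> A y -> A (x - y).
Proof. by rewrite AX; apply: zspanB. Qed.

Lemma moduleM r x : O r -> A x -> A (r * x).
Proof. by move=> /multA; apply. Qed.

Lemma module0 : A 0. Proof. by rewrite AX; apply: zspan0. Qed.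

Lemma moduleD x y : A x -> A y -> A (x + y).
Proof.
move=> Ax Ay; rewrite -[y]opprK; apply: moduleB => //.
by rewrite -[- y]sub0r; apply: moduleB => //; apply: module0.
Qed.

Lemma moduleZ (k : int) x : A x -> A (k%:~R * x).
Proof. exact/moduleM/(order_int hO). Qed.

Lemma order_lattice_module : order_lattice A.
Proof.
split; [exact: moduleB | exact: moduleM | |].
  by move=> x Ox; rewrite -[x]mulr1; apply: moduleM.
have [D D0 OD] := order_scale_family X; exists D => // x; rewrite AX.
apply: (@zspanP _ _ X [set x | O (D%:R * x)]) => [||i]; rewrite /= ?mulr0.
- exact: order0.
- by move=> u v Ou Ov; rewrite mulrBr; apply: orderB.
- exact: OD.
Qed.

(** Forming the ring of multipliers commutes with localization because [A] is finitely generated. *)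
Lemma localize_multiplier x : (forall a, A a -> localize A (x * a)) -> localize O x.
Proof.
move=> Ax; have [||s us sx] := @zspan_localize_uniform n X x.
- by rewrite -AX => s y /locunit_order; apply: moduleM.
- by rewrite -AX => i; apply: Ax; rewrite AX; apply: zspan_gen.
by exists s => //; apply/multA => a; rewrite AX; apply: sx.
Qed.

Lemma torsionB x y : torsion x -> torsion y -> torsion (x - y).
Proof. by move=> Tx Ty b lb Ob; rewrite mulrBr; apply: moduleB; [apply: Tx | apply: Ty]. Qed.

Lemma torsionM r x : O r -> torsion x -> torsion (r * x).
Proof. by move=> Or Tx b lb Ob; rewrite mulrCA; apply: moduleM => //; apply: Tx. Qed.

Lemma torsionZ (k : int) x : torsion x -> torsion (k%:~R * x).
Proof. exact/torsionM/(order_int hO). Qed.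

Lemma torsion0 : torsion 0.
Proof. by move=> b _ _; rewrite mulr0; apply: module0. Qed.

Lemma torsionD x y : torsion x -> torsion y -> torsion (x + y).
Proof.
move=> Tx Ty; rewrite -[y]opprK; apply: torsionB => //.
by rewrite -[- y]sub0r; apply: torsionB => //; apply: torsion0.
Qed.

Lemma module_torsion : A `<=` torsion.
Proof. by move=> x Ax b _ Ob; apply: moduleM. Qed.

Lemma torsion_ell (k : int) x : (ell %| k)%Z -> torsion x -> A (k%:~R * x).
Proof. by move=> /ideal_int lk Tx; apply: Tx => //; apply: order_int. Qed.

Lemma torsion_localize x : torsion x -> localize A (alpha * x).
Proof.
have [m [m0 [lm Om]]] := real_multiplier => Tx.
exists m%:R; first by split=> //; [exact: (order_int hO (Posz m)) | exact: rpred_nat].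
rewrite mulrA; apply: Tx; last exact: Om.
by apply: idealM; [exact: integers_nat | apply/idealP; exists 1; rewrite ?mulr1 //;
  apply: (integers_nat _ 1)].
Qed.

(** Denominators act invertibly on [T / A]: if [u] inverts [s] modulo [l], then [u s - 1] lies in
    [l] and in [O] and sends [x] into [A]. So [T / A] injects into its localization. *)
Lemma torsion_module x : torsion x -> localize A x -> A x.
Proof.
move=> Tx [s us Ax]; have [_ _ ls] := us.
have [u lu] := ideal_inverse (locunit_int us) ls.
have -> : x = u%:~R * (s * x) - (u%:~R * s - 1) * x by ring.
apply: moduleB; first exact: moduleZ.
apply: Tx => //; apply: orderB (order1 hO) => //; apply: orderM => //; first exact: order_int.
exact: locunit_order.
Qed.

(** The surjectivity that complements [torsion_module]: locally, [T] is all of [A / alpha]. With [u]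
    inverse to [t s] modulo [l], the element [u t s x] is torsion and differs from [x] by a multiple
    of [alpha x]. *)
Lemma torsion_lift x : localize A (alpha * x) -> exists2 y, torsion y & localize A (y - x).
Proof.
move=> [s us Ax]; have [_ _ ls] := us.
have [t [ut uts Ot]] := int_to_locunit (locunit_int us) ls; have [_ _ lts] := uts.
have [u /idealP[z Zz zE]] := ideal_inverse (locunit_int uts) lts.
exists (u%:~R * (t * s * x)).
  apply: torsionZ => b /idealP[c Zc ->] _.
  have -> : alpha * c * (t * s * x) = t * c * (s * (alpha * x)) by ring.
  by apply: moduleM => //; apply: Ot.
have -> : u%:~R * (t * s * x) - x = z * (alpha * x).
  by rewrite mulrA [z * _]mulrC -zE; ring.
apply: (localizeM order_lattice_module); first exact: valring_int.
by exists s.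
Qed.

(** A basis of [T / A] over the field with [ell] elements, with integer coefficients that matter
    only modulo [ell] by [torsion_ell]. *)
Definition torsion_basis y z : Prop :=
  [/\ torsion y, torsion z,
      forall x, torsion x -> exists p q : int, A (x - (p%:~R * y + q%:~R * z))
    & forall p q : int, A (p%:~R * y + q%:~R * z) -> (ell %| p)%Z /\ (ell %| q)%Z].

(** If [x1], [x2] is a basis of the localization of [A], torsion elements approximating [x1 / alpha]
    and [x2 / alpha] do. *)
Lemma torsion_basis_exists : exists y z, torsion_basis y z.
Proof.
have LM := order_lattice_module; have a0 := alpha_neq0.
have [x1 [x2 [Kx1 nx2 Ax1 Ax2 gen]]] := localize_basis LM.
have x10 : x1 != 0.
  apply/eqP=> x10; have L1 : localize A 1 by apply: (lattice_sub_localize A1).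
  have [r1 [r2 [Rr1 Rr2]]] := gen _ L1; have [r3 [r4 [Rr3 Rr4]]] := gen _ Ax1.
  rewrite x10 !mulr0 !add0r => _ e1; case/negP: nx2.
  have r20 : r2 != 0 by apply: contra_eq_neq e1 => ->; rewrite mul0r oner_neq0.
  by rewrite -[x2](mulKf r20) -e1 mulr1 memvV valring_sub.
have inj a b c d : valring a -> valring b -> valring c -> valring d ->
    a * x1 + b * x2 = c * x1 + d * x2 -> a = c /\ b = d.
  move=> Ra Rb Rc Rd e.
  have K0M r : valring r -> r * x1 \in K0 by move=> /valring_sub Kr; apply: memvM.
  by have [/(mulIf x10) -> ->] :=
    real_coord_inj nx2 (K0M _ Ra) (valring_sub Rb) (K0M _ Rc) (valring_sub Rd) e.
have lift x : localize A x -> exists2 y, torsion y & localize A (y - x / alpha).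
  by move=> Ax; apply: torsion_lift; rewrite mulrCA divff ?mulr1.
have [y1 Ty1 Ly1] := lift _ Ax1; have [y2 Ty2 Ly2] := lift _ Ax2.
have LZ (k : int) x : localize A x -> localize A (k%:~R * x).
  by apply: (localizeM LM); apply: valring_intr.
exists y1, y2; split=> // [x Tx | p q Apq].
  have [r1 [r2 [Rr1 Rr2 xE]]] := gen _ (torsion_localize Tx).
  have [c1 Rc1] := valring_residue Rr1; have [c2 Rc2] := valring_residue Rr2.
  exists c1, c2; apply: torsion_module.
    by apply: torsionB => //; apply: torsionD; apply: torsionZ.
  have -> : x - (c1%:~R * y1 + c2%:~R * y2) =
      ((r1 - c1%:~R) / alpha * x1 + (r2 - c2%:~R) / alpha * x2) -
      (c1%:~R * (y1 - x1 / alpha) + c2%:~R * (y2 - x2 / alpha)).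
    by rewrite -[x](mulKf a0) xE; field.
  by apply: (localizeB LM); apply: (localizeD LM);
    [apply: (localizeM LM) | apply: (localizeM LM) | apply: LZ | apply: LZ].
have : localize A ((p%:~R * x1 + q%:~R * x2) / alpha).
  have -> : (p%:~R * x1 + q%:~R * x2) / alpha = (p%:~R * y1 + q%:~R * y2) -
      (p%:~R * (y1 - x1 / alpha) + q%:~R * (y2 - x2 / alpha)) by field.
  apply: (localizeB LM); first exact: lattice_sub_localize.
  by apply: (localizeD LM); apply: LZ.
case/gen=> r1 [r2 [Rr1 Rr2 e]].
have [|||||pE qE] := @inj p%:~R q%:~R (alpha * r1) (alpha * r2).
- exact: valring_intr.
- exact: valring_intr.
- by apply: valringM => //; apply: valring_alpha.
- by apply: valringM => //; apply: valring_alpha.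
- by rewrite -!mulrA -mulrDr -e mulrCA divff ?mulr1.
by split; apply: valring_dvd; rewrite ?pE ?qE mulrC mulKf.
Qed.

Lemma torsion_cyclic th y z (a d : int) : O th -> torsion_basis y z ->
  A (th * y - (a%:~R * y + d%:~R * z)) -> ~ (ell %| d)%Z -> torsion_basis y (th * y).
Proof.
move=> Oth [Ty Tz gen indep] Ath nd; have [e [q0 eE]] := int_inverse nd.
split=> // [|x Tx|p q Apq]; first exact: torsionM.
  have [p [q Ax]] := gen _ Tx; exists (p - q * e * a), (q * e).
  have -> : x - ((p - q * e * a)%:~R * y + (q * e)%:~R * (th * y)) =
     (x - (p%:~R * y + q%:~R * z)) - (q * e)%:~R * (th * y - (a%:~R * y + d%:~R * z))
     - (q * q0 * ell)%:~R * z.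
    have : (q * (e * d))%:~R = (q * (1 + q0 * ell))%:~R :> K by rewrite eE.
    rewrite !(rmorphM, rmorphD, rmorphB, rmorphN, rmorph1) /= => E.
    transitivity (x - (p%:~R * y + q%:~R * z) - q%:~R * e%:~R * (th * y - (a%:~R * y + d%:~R * z))
      - (q%:~R * (e%:~R * d%:~R) - q%:~R) * z); first by ring.
    by rewrite E; ring.
  apply: moduleB; last by apply: torsion_ell => //; apply: dvdz_mull.
  by apply: moduleB => //; apply: moduleZ.
have : A ((p + q * a)%:~R * y + (q * d)%:~R * z).
  have -> : (p + q * a)%:~R * y + (q * d)%:~R * z =
     (p%:~R * y + q%:~R * (th * y)) - q%:~R * (th * y - (a%:~R * y + d%:~R * z)).
    by rewrite !(rmorphM, rmorphD) /=; ring.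
  by apply: moduleB => //; apply: moduleZ.
case/indep=> pq /int_prime[eq_|//]; split=> //.
by have := rpredB pq (dvdz_mulr a eq_); rewrite addrK.
Qed.

Lemma torsion_basisC y z : torsion_basis y z -> torsion_basis z y.
Proof.
case=> Ty Tz gen indep; split=> // [x /gen[p [q Ax]]|p q].
  by exists q, p; rewrite [X in _ - X]addrC.
by rewrite addrC => /indep[].
Qed.

Lemma torsion_basisD y z : torsion_basis y z -> torsion_basis (y + z) z.
Proof.
case=> Ty Tz gen indep; split=> // [|x /gen[p [q Ax]]|p q]; first exact: torsionD.
  exists p, (q - p); have -> // : p%:~R * (y + z) + (q - p)%:~R * z = p%:~R * y + q%:~R * z.
  by rewrite rmorphB /=; ring.
have -> : p%:~R * (y + z) + q%:~R * z = p%:~R * y + (p + q)%:~R * z.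
  by rewrite rmorphD /=; ring.
by case/indep=> ep epq; split=> //; have := rpredB epq ep; rewrite addrC addKr.
Qed.

(** An endomorphism of a plane for which [y], [z] and [y + z] are all eigenvectors, with [y], [z] a
    basis, is scalar. So one of the three is cyclic. *)
Lemma cyclic_vector th : O th ->
    (forall c : int, ~ (forall x, torsion x -> A ((th - c%:~R) * x))) ->
  exists y, torsion_basis y (th * y).
Proof.
move=> Oth nscal; have [y [z bas]] := torsion_basis_exists.
have [Ty Tz gen indep] := bas.
have [a [d yE]] := gen _ (torsionM Oth Ty).
have [ed|nd] := pselect (ell %| d)%Z; last by exists y; apply: torsion_cyclic bas yE nd.
have [d' [b zE]] := gen _ (torsionM Oth Tz).
have [ed'|nd'] := pselect (ell %| d')%Z; last first.
  by exists z; apply: (@torsion_cyclic th z y b d' Oth (torsion_basisC bas)) => //;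
    rewrite [b%:~R * z + _]addrC.
have yE' : A (th * y - a%:~R * y).
  have -> : th * y - a%:~R * y = (th * y - (a%:~R * y + d%:~R * z)) + d%:~R * z by ring.
  by apply: moduleD => //; apply: torsion_ell.
have zE' : A (th * z - b%:~R * z).
  have -> : th * z - b%:~R * z = (th * z - (d'%:~R * y + b%:~R * z)) + d'%:~R * y by ring.
  by apply: moduleD => //; apply: torsion_ell.
have [eb|nb] := pselect (ell %| b - a)%Z; last first.
  exists (y + z); apply: (@torsion_cyclic th (y + z) z a (b - a) Oth (torsion_basisD bas)) => //.
  have -> : th * (y + z) - (a%:~R * (y + z) + (b - a)%:~R * z) =
     (th * y - a%:~R * y) + (th * z - b%:~R * z) by rewrite rmorphB /=; ring.
  exact: moduleD.
case: (nscal a) => x /gen[p [q Ax]].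
have -> : (th - a%:~R) * x = (th - a%:~R) * (x - (p%:~R * y + q%:~R * z)) +
   (p%:~R * (th * y - a%:~R * y) + q%:~R * (th * z - b%:~R * z) + (q * (b - a))%:~R * z).
  by rewrite rmorphM rmorphB /=; ring.
apply: moduleD; first by apply: moduleM => //; apply: orderB => //; apply: order_int.
apply: moduleD; last by apply: torsion_ell => //; apply: dvdz_mull.
by apply: moduleD; apply: moduleZ.
Qed.

(** * Target lattices of l-isogenies and their multipliers *)

Definition extension g : set K := [set v | exists m : int, A (v - m%:~R * g)].

Definition multipliers (M : set K) : set K := [set x | forall v, M v -> M (x * v)].

Lemma extension_gen g : extension g g.
Proof. by exists 1; rewrite mul1r subrr; apply: module0. Qed.

Lemma module_extension g : A `<=` extension g.
Proof. by move=> a Aa; exists 0; rewrite mul0r subr0. Qed.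

Lemma extensionB g u v : extension g u -> extension g v -> extension g (u - v).
Proof.
move=> [m Au] [m' Av]; exists (m - m').
have -> : u - v - (m - m')%:~R * g = (u - m%:~R * g) - (v - m'%:~R * g) by rewrite rmorphB /=; ring.
exact: moduleB.
Qed.

Lemma extension0 g : extension g 0.
Proof. exact/module_extension/module0. Qed.

Lemma extensionD g u v : extension g u -> extension g v -> extension g (u + v).
Proof.
move=> Gu Gv; rewrite -[v]opprK; apply: extensionB => //.
by rewrite -[- v]sub0r; apply: extensionB => //; apply: extension0.
Qed.

Lemma extensionZ g (m : int) v : extension g v -> extension g (m%:~R * v).
Proof.
move=> [m' Av]; exists (m * m').
by rewrite rmorphM /= -mulrA -mulrBr; apply: moduleZ.
Qed.

Lemma extension_torsion g : torsion g -> extension g `<=` torsion.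
Proof.
move=> Tg v [m Av]; rewrite -[v](subrK (m%:~R * g)).
by apply: torsionD; [exact: module_torsion | exact: torsionZ].
Qed.

Lemma extension_sub g h : extension h g -> extension g `<=` extension h.
Proof.
move=> hg v [m /(@module_extension h) Av]; rewrite -[v](subrK (m%:~R * g)).
by apply: extensionD => //; apply: extensionZ.
Qed.

Lemma extension_zspan g : exists Y : 'I_n.+1 -> K, Y ord0 = g /\ extension g = zspan Y.
Proof.
exists (fun i => oapp X g (unlift ord0 i)); split; first by rewrite unlift_none.
apply/seteqP; split=> [v [m]|]; last first.
  apply: zspanP; [exact: extension0 | exact: extensionB | move=> i].
  case: unliftP => [j _|_] /=; last exact: extension_gen.
  by apply: module_extension; rewrite AX; apply: zspan_gen.
rewrite AX => -[c cE]; exists (fun i => oapp c m (unlift ord0 i)).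
rewrite big_ord_recl unlift_none /= -[LHS](subrK (m%:~R * g)) cE addrC; congr (_ + _).
by apply: eq_bigr => i _; rewrite liftK.
Qed.

(** Elements of [O :&: K0] act on [T / A] as integers, their residues modulo [l], so they stabilize
    every line. This is the hypothesis of [completed_order_localize] for target orders. *)
Lemma extension_real g r v : torsion g -> O r -> r \in K0 -> extension g v -> extension g (r * v).
Proof.
move=> Tg Or K0r Gv; have [c lc] := ideal_residue (order_real Or K0r).
have -> : r * v = (r - c%:~R) * v + c%:~R * v by ring.
apply: extensionD; last exact: extensionZ.
apply: module_extension; apply: (extension_torsion Tg Gv) => //.
by apply: orderB => //; apply: order_int.
Qed.

Lemma torsion_alpha u z x : O u -> u = alpha * z -> localize O z -> torsion x -> A (u * x).
Proof.
move=> Ou uE Oz Tx; apply: torsion_module; first exact: torsionM.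
rewrite uE -mulrA mulrCA; apply: (localizeOM order_lattice_module) => //.
exact: torsion_localize.
Qed.

Lemma multipliers_bound g : torsion g ->
  exists2 D : nat, (0 < D)%N & forall x, ZK x -> multipliers (extension g) (D%:R * x).
Proof.
move=> Tg; have [D D0 OD] := integers_bound hO dK0 dK.
exists (D * ell)%N; first by rewrite muln_gt0 D0 prime_gt0.
move=> x Zx v Gv; apply: module_extension.
have -> : (D * ell)%:R * x * v = (D%:R * x) * (ell%:Z%:~R * v) by rewrite natrM -pmulrn; ring.
by apply: moduleM; [apply: OD | apply: torsion_ell => //; apply: extension_torsion Gv].
Qed.

Lemma multipliers_integral g : multipliers (extension g) `<=` ZK.
Proof.
move=> x Gx; have [Y [_ GY]] := extension_zspan g; apply: (@zspan_integral _ _ Y).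
  by move=> i; rewrite -GY; apply: Gx; rewrite GY; apply: zspan_gen.
apply: contrapT => Y0; have : extension g 1 by apply: module_extension.
rewrite GY => -[c] /eqP; apply/negP.
rewrite big1 ?oner_eq0 // => i _; have [->|nYi] := eqVneq (Y i) 0; first by rewrite mulr0.
by case: Y0; exists i.
Qed.

(** A multiplier [x] of the lattice of [g] maps [T] to itself, since [A], [g] and [th g] generate
    [T] and [x] commutes with [th]. As [A] is locally [alpha T], it also maps [A] to itself. On the
    other hand [th] is no multiplier, even locally, because [th g] is independent of [g] modulo
    [A]. *)
Lemma multipliers_unstable g th : torsion_basis g (th * g) -> O th ->
  multipliers (extension g) `<=` O /\ ~ localize (multipliers (extension g)) th.
Proof.
move=> [Tg _ gen indep] Oth; have Gg := extension_gen g; have LM := order_lattice_module.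
split=> [x Gx | [s us Gs]].
  have Tx t : torsion t -> torsion (x * t).
    move=> /gen[p [q Aa]]; set a := _ - _ in Aa.
    have -> : x * t = x * a + (p%:~R * (x * g) + q%:~R * (th * (x * g))) by rewrite /a; ring.
    have Txg : torsion (x * g) by apply/(extension_torsion Tg)/Gx.
    apply: torsionD; first exact/(extension_torsion Tg)/Gx/module_extension.
    by apply: torsionD; apply: torsionZ => //; apply: torsionM.
  apply/multA => a Aa; apply: torsion_module; first exact/Tx/module_torsion.
  have a0 := alpha_neq0.
  have [|t Tt [s us Ab]] := @torsion_lift (a / alpha).
    by rewrite mulrCA divff ?mulr1 //; apply: lattice_sub_localize.
  have -> : x * a = alpha * (x * t) - s^-1 * (alpha * (x * (s * (t - a / alpha)))).
    by field; rewrite a0 locunit_neq0.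
  apply: (localizeB LM); first exact/torsion_localize/Tx.
  apply: (localizeM LM); first exact: locunit_inv.
  exact/torsion_localize/Tx/module_torsion.
have [m Am] := Gs _ Gg; have [_ _ ls] := us.
have [u lu] := ideal_inverse (locunit_int us) ls.
have Tthg := torsionM Oth Tg.
have : A ((- (u * m))%:~R * g + 1%:~R * (th * g)).
  have -> : (- (u * m))%:~R * g + 1%:~R * (th * g) =
     u%:~R * (s * th * g - m%:~R * g) - (u%:~R * s - 1) * (th * g).
    by rewrite rmorphN rmorphM /=; ring.
  apply: moduleB; first exact: moduleZ.
  apply: Tthg => //; apply: orderB (order1 hO) => //; apply: orderM => //; first exact: order_int.
  exact: locunit_order.
by case/indep=> _; rewrite dvdz1 absz_nat => /eqP e1; have := prime_gt1 hell; rewrite e1.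
Qed.

(** * Action of the local generator th on the torsion *)

Section Generator.
Variables (w : K) (k : nat).
Let th := alpha ^+ k * w.
Hypotheses (nw : w \notin K0) (Zw : localize ZK w) (Oth : O th).
Hypothesis genZ : forall x, localize ZK x ->
  exists a b, [/\ valring a, valring b & x = a + b * w].
Hypothesis genO : forall x, localize O x ->
  exists a b, [/\ valring a, valring b & x = a + b * th].

Lemma generator_notin : th \notin K0.
Proof.
have K0a : alpha ^+ k \in K0 by case: Zalpha => K0a _; rewrite rpredX.
have a0 : alpha ^+ k != 0 by rewrite expf_neq0 ?alpha_neq0.
by apply: contra nw => Kth; rewrite -[w](mulKf a0) memvM ?memvV.
Qed.

Lemma generator_div (c : int) : ~ localize O ((th - c%:~R) / alpha).
Proof.
case/genO=> a [b [Ra Rb e]]; have a0 := alpha_neq0.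
have K0a : alpha^-1 \in K0 by case: Zalpha => K0a _; rewrite memvV.
have [||||| _ b1] := @real_coord_inj th (- c%:~R / alpha) alpha^-1 a b generator_notin.
- by apply: memvM => //; rewrite memvN memv_int.
- by [].
- exact: valring_sub.
- exact: valring_sub.
- by rewrite -e; field.
by apply: valring_alphaV; rewrite b1.
Qed.

(** If [th] acted as [c] on [T / A], then [(th - c) / alpha] would map the localization of [A] to
    itself and so lie in that of [O], but its coordinate along [th] is [1 / alpha]. *)
Lemma generator_nonscalar (c : int) : ~ (forall x, torsion x -> A ((th - c%:~R) * x)).
Proof.
move=> scal; apply: (@generator_div c); apply: localize_multiplier => a Aa.
have a0 := alpha_neq0; have LM := order_lattice_module.
have [|t Tt Lt] := @torsion_lift (a / alpha).
  by rewrite mulrCA divff ?mulr1 //; apply: lattice_sub_localize.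
have -> : (th - c%:~R) / alpha * a = (th - c%:~R) * t - (th - c%:~R) * (t - a / alpha) by field.
apply: (localizeB LM); first exact/lattice_sub_localize/scal.
apply: (localizeOM LM) => //; apply: lattice_sub_localize.
by apply: orderB => //; apply: order_int.
Qed.

Lemma localize_affine a b : valring a -> valring b -> localize O (a + b * th).
Proof.
have LO := order_lattice_order; move=> Ra Rb; apply: (localizeD LO).
  exact: valring_localize.
by apply: (localizeM LO) => //; apply: lattice_sub_localize.
Qed.

(** From [w^2 = a + b w] follows [th^2 = alpha^(2k) a + alpha^k b th]. For [k = 0], [tau] and [- nu]
    are the residues of [b] and [a]. For [k > 0] the factor [alpha ^+ 2] of the constant term is
    recorded, because [generator_ascend] divides by [alpha] and must still be left with a multiple
    of [alpha]. *)
Lemma generator_quadratic : exists tau nu : int,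
  (exists a b, [/\ valring a, valring b & th ^+ 2 = tau%:~R * th - nu%:~R + alpha * (a + b * th)])
  /\ ((0 < k)%N -> [/\ tau = 0, nu = 0 & exists a b,
        [/\ valring a, valring b & th ^+ 2 = alpha ^+ 2 * a + alpha * b * th]]).
Proof.
have Rk j : valring (alpha ^+ j) by apply/valringX/valring_alpha.
have [|a [b [Ra Rb e]]] := @genZ (w * w).
  case: Zw => s us Zsw; exists (s * s); first exact: locunitM.
  have -> : s * s * (w * w) = (s * w) * (s * w) by ring.
  exact: integersM.
have th2 : th ^+ 2 = alpha ^+ k * alpha ^+ k * a + alpha ^+ k * b * th.
  by rewrite /th exprMn -[w ^+ 2]/(w * w) e; ring.
case: (posnP k) => [k0 | k1].
  have [c Rc] := valring_residue Ra; have [d Rd] := valring_residue Rb; have a0 := alpha_neq0.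
  exists d, (- c); split=> //.
  exists ((a - c%:~R) / alpha), ((b - d%:~R) / alpha); split=> //.
  by rewrite th2 k0 expr0 rmorphN /=; field.
have [j kE] : exists j, k = j.+1 by exists k.-1; rewrite prednK.
exists 0, 0; split=> [|_].
  exists (alpha ^+ j * alpha ^+ k * a), (alpha ^+ j * b).
  split; try by do ?apply: valringM.
  by rewrite th2 mul0r subr0 add0r {1 3}kE exprS; ring.
split=> //; exists (alpha ^+ j * alpha ^+ j * a), (alpha ^+ j * b).
split; try by do ?apply: valringM.
by rewrite th2 kE exprS; ring.
Qed.

Lemma order_residue x : O x -> exists c d : int, forall v, torsion v ->
  A ((x - (c%:~R + d%:~R * th)) * v).
Proof.
move=> Ox; have [a [b [Ra Rb xE]]] := genO (lattice_sub_localize Ox); have a0 := alpha_neq0.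
have [c Rc] := valring_residue Ra; have [d Rd] := valring_residue Rb.
exists c, d => v; apply: (@torsion_alpha _ ((a - c%:~R) / alpha + (b - d%:~R) / alpha * th)).
- apply: orderB => //; apply: (orderD hO); first exact: order_int.
  by apply: orderM => //; apply: order_int.
- by rewrite xE; field.
- exact: localize_affine.
Qed.

(** Locally [A] is [alpha T], so [th / alpha] maps [A] into [th T + A], which lies in the lattice of
    [th y] because [th^2] kills [T / A]. It maps [th y] to [a (alpha y) + b (th y)], where [alpha y]
    is locally in [A]. So the lattice is locally stable under [th / alpha], and a common denominator
    [s] makes a global multiplier. *)
Lemma generator_ascend y : (0 < k)%N -> torsion_basis y (th * y) ->
    (forall x, torsion x -> A (th ^+ 2 * x)) ->
    O `<=` multipliers (extension (th * y)) ->
    (exists a b, [/\ valring a, valring b & th ^+ 2 = alpha ^+ 2 * a + alpha * b * th]) ->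
  exists2 x, multipliers (extension (th * y)) x & ~ localize O x.
Proof.
move=> k0 [Ty Tthy gen indep] th2 OG [a [b [Ra Rb th2E]]].
have a0 := alpha_neq0; have LM := order_lattice_module.
set g := th * y; set G := extension g.
have GM : order_lattice G.
  split; [exact: extensionB | by move=> r x /OG; apply | | ].
    by case: LM => _ _ OA _; move=> x /OA; apply: module_extension.
  case: LM => _ _ _ [D D0 OD]; exists (D * ell)%N; first by rewrite muln_gt0 D0 prime_gt0.
  move=> x Gx; rewrite natrM -mulrA; apply: OD.
  by apply: (@torsion_ell (Posz ell)) => //; apply: extension_torsion Gx.
have AG x : localize A x -> localize G x by case=> s us As; exists s => //; apply: module_extension.
have Gg : G g by apply: extension_gen.
have GA x : A x -> localize G (th / alpha * x).
  move=> Ax; have [|t Tt Lt] := @torsion_lift (x / alpha).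
    by rewrite mulrCA divff ?mulr1 //; apply: lattice_sub_localize.
  have -> : th / alpha * x = th * t - th * (t - x / alpha) by field.
  apply: (localizeB GM); last first.
    by apply/AG/(localizeOM LM) => //; apply: lattice_sub_localize.
  apply: lattice_sub_localize.
  have [p [q Apq]] := gen _ Tt; set z := _ - _ in Apq.
  have -> : th * t = th * z + (p%:~R * g + q%:~R * (th ^+ 2 * y)) by rewrite /z /g; ring.
  apply: extensionD; first by apply/module_extension/moduleM.
  apply: extensionD; first exact: extensionZ.
  by apply/module_extension/moduleZ/th2.
have Gthg : localize G (th / alpha * g).
  have -> : th / alpha * g = a * (alpha * y) + b * g.
    have -> : th / alpha * g = th ^+ 2 / alpha * y by rewrite /g; ring.
    by rewrite th2E /g; field.
  apply: (localizeD GM); last by apply: (localizeM GM) => //; apply: lattice_sub_localize.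
  by apply/AG/(localizeM LM) => //; apply: torsion_localize.
have [Y [Y0 GY]] := extension_zspan g.
have [||s us sx] := @zspan_localize_uniform _ Y (th / alpha).
- by rewrite -GY => s x /locunit_order; case: GM => _ GM' _ _; apply: GM'.
- move=> i; rewrite -GY; have : G (Y i) by rewrite /G GY; apply: zspan_gen.
  case=> m Am; have -> : th / alpha * Y i =
    th / alpha * (Y i - m%:~R * g) + m%:~R * (th / alpha * g) by ring.
  by apply: (localizeD GM); [apply: GA | apply: (localizeM GM) => //; apply: valring_intr].
exists (s * (th / alpha)); first by move=> v; have := sx v; rewrite -GY; apply.
move=> [t ut Ot]; apply: (@generator_div 0); rewrite subr0.
exists (t * s); first exact: locunitM.
by rewrite -mulrA.
Qed.
End Generator.

(** * The lines of the torsion plane *)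

Section Lines.
Variables (th y : K) (tau nu : int).
Hypotheses (Oth : O th) (basis_y : torsion_basis y (th * y)).
Hypothesis quad : forall x, torsion x -> A ((th ^+ 2 - tau%:~R * th + nu%:~R) * x).
Hypothesis residue : forall x, O x ->
  exists c d : int, forall v, torsion v -> A ((x - (c%:~R + d%:~R * th)) * v).

Definition line (c : int) : K := th * y - c%:~R * y.

Lemma line_torsion c : torsion (line c).
Proof. by case: basis_y => Ty Tthy _ _; apply: torsionB => //; apply: torsionZ. Qed.

Lemma line_basis c : torsion_basis (line c) y.
Proof.
case: basis_y => Ty Tthy gen indep; split=> // [|x /gen[p [q Ax]]|p q].
- exact: line_torsion.
- exists q, (p + q * c).
  have -> // : q%:~R * line c + (p + q * c)%:~R * y = p%:~R * y + q%:~R * (th * y).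
  by rewrite /line !(rmorphN, rmorphD, rmorphM, rmorph1) /=; ring.
have -> : p%:~R * line c + q%:~R * y = (q - p * c)%:~R * y + p%:~R * (th * y).
  by rewrite /line !(rmorphN, rmorphD, rmorphM, rmorph1) /=; ring.
case/indep=> eq_ ep; split=> //.
by have := rpredD eq_ (dvdz_mulr c ep); rewrite subrK.
Qed.

(** In the basis [line c], [y], the coordinate of [th * line c] along [y] is minus the value of the
    quadratic polynomial at [c]; both [line_stable] and [line_unstable] are read off from it. *)
Lemma line_action c : A (th * line c - ((tau - c)%:~R * line c + (- (c ^+ 2 - tau * c + nu))%:~R * y)).
Proof.
case: basis_y => Ty _ _ _.
have -> : th * line c - ((tau - c)%:~R * line c + (- (c ^+ 2 - tau * c + nu))%:~R * y) =
    (th ^+ 2 - tau%:~R * th + nu%:~R) * y.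
  by rewrite /line !(rmorphN, rmorphD, rmorphM, rmorphXn) /=; ring.
exact: quad.
Qed.

Lemma line_stable c : (ell %| c ^+ 2 - tau * c + nu)%Z -> extension (line c) (th * line c).
Proof.
case: basis_y => Ty _ _ _ div; exists (tau - c).
have -> : th * line c - (tau - c)%:~R * line c =
   (th * line c - ((tau - c)%:~R * line c + (- (c ^+ 2 - tau * c + nu))%:~R * y))
   + (- (c ^+ 2 - tau * c + nu))%:~R * y by ring.
apply: moduleD; first exact: line_action.
by apply: torsion_ell => //; rewrite rpredN.
Qed.

Lemma line_unstable c : ~ (ell %| c ^+ 2 - tau * c + nu)%Z ->
  torsion_basis (line c) (th * line c).
Proof.
move=> ndiv; apply: (torsion_cyclic Oth (line_basis c) (line_action c)).
by rewrite rpredN.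
Qed.

Lemma line_inj c c' : extension (line c) (line c') -> (ell %| c - c')%Z.
Proof.
case: basis_y => Ty Tthy gen indep [m].
have -> : line c' - m%:~R * line c = (m * c - c')%:~R * y + (1 - m)%:~R * (th * y).
  by rewrite /line !(rmorphN, rmorphD, rmorphM, rmorph1) /=; ring.
case/indep=> e1 e2; have := rpredD e1 (dvdz_mulr c e2).
by have -> : m * c - c' + (1 - m) * c = c - c' by ring.
Qed.

Lemma line_cong c c' : (ell %| c - c')%Z -> extension (line c) = extension (line c').
Proof.
have half a b : (ell %| a - b)%Z -> extension (line b) (line a).
  case: basis_y => Ty _ _ _ div; exists 1.
  have -> : line a - 1%:~R * line b = (- (a - b))%:~R * y by rewrite /line !(rmorphN, rmorphD,
    rmorphM, rmorph1) /=; ring.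
  by apply: torsion_ell => //; rewrite rpredN.
by move=> div; apply/seteqP; split; apply: extension_sub; apply: half => //; rewrite -rpredN opprB.
Qed.

Lemma line_not_axis c : ~ extension y (line c).
Proof.
case: basis_y => Ty Tthy gen indep [m].
have -> : line c - m%:~R * y = (- c - m)%:~R * y + 1%:~R * (th * y).
  by rewrite /line !(rmorphN, rmorphD, rmorphM, rmorph1) /=; ring.
by case/indep=> _; rewrite dvdz1 absz_nat => /eqP e1; have := prime_gt1 hell; rewrite e1.
Qed.

Lemma line_notin c : ~ A (line c).
Proof. by move=> Al; apply: (@line_not_axis c); apply: module_extension. Qed.

Lemma axis_notin : ~ A y.
Proof.
case: basis_y => Ty Tthy gen indep Ay.
have : A (1%:~R * y + 0%:~R * (th * y)) by rewrite mul1r mul0r addr0.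
by case/indep; rewrite dvdz1 absz_nat => /eqP e1; have := prime_gt1 hell; rewrite e1.
Qed.

Lemma extension_classify g : torsion g -> ~ A g ->
  extension g = extension y \/ exists2 c : 'I_ell, True & extension g = extension (line c).
Proof.
case: basis_y => Ty Tthy gen indep Tg nAg; have [p [q Ag]] := gen _ Tg.
have [eq_|nq] := pselect (ell %| q)%Z.
  left; have Ag' : A (g - p%:~R * y).
    have -> : g - p%:~R * y = (g - (p%:~R * y + q%:~R * (th * y))) + q%:~R * (th * y) by ring.
    by apply: moduleD => //; apply: torsion_ell.
  have np : ~ (ell %| p)%Z.
    by move=> ep; apply: nAg; rewrite -[g](subrK (p%:~R * y)); apply: moduleD => //;
      apply: torsion_ell.
  have [e [q0 eE]] := int_inverse np.
  apply/seteqP; split; apply: extension_sub; first by exists p.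
  exists e; have -> : y - e%:~R * g = - e%:~R * (g - p%:~R * y) - (q0 * ell)%:~R * y.
    have : (e * p)%:~R = (1 + q0 * ell)%:~R :> K by rewrite eE.
    rewrite !(rmorphM, rmorphD, rmorph1) /= => E.
    transitivity (- e%:~R * (g - p%:~R * y) - (e%:~R * p%:~R - 1) * y); first by ring.
    by rewrite E; ring.
  apply: moduleB; last by apply: torsion_ell => //; apply: dvdz_mull.
  by rewrite -rmorphN; apply: moduleZ.
(* Dividing [p y + q (th y)] by the invertible [q] gives [th y + (p / q) y], so [c] is [- p / q]
   modulo [ell]. *)
right; have [e [q0 eE]] := int_inverse nq; set c := - (e * p).
have ell0 : (ell != 0 :> int) by have := prime_gt0 hell; lia.
have c_lt : (`|(c %% ell)%Z| < ell)%N.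
  by have := modz_ge0 c ell0; have := @ltz_pmod c ell; have := prime_gt0 hell; lia.
exists (Ordinal c_lt) => //; rewrite -[extension (line _)](@line_cong c); last first.
  by rewrite /= gez0_abs ?modz_ge0 // {1}(divz_eq c ell) addrK dvdz_mull.
apply/seteqP; split; apply: extension_sub.
  exists q; have -> : g - q%:~R * line c =
     (g - (p%:~R * y + q%:~R * (th * y))) + (- (p * q0 * ell))%:~R * y.
    have : (e * q * p)%:~R = ((1 + q0 * ell) * p)%:~R :> K by rewrite eE.
    rewrite /line /c !(rmorphM, rmorphD, rmorphN, rmorph1) /= => E.
    transitivity (g - (p%:~R * y + q%:~R * (th * y)) - (e%:~R * q%:~R * p%:~R - p%:~R) * y);
      first by ring.
    by rewrite E; ring.
  by apply: moduleD => //; apply: torsion_ell => //; rewrite rpredN dvdz_mull.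
exists e; have -> : line c - e%:~R * g =
   - e%:~R * (g - (p%:~R * y + q%:~R * (th * y))) - (q0 * ell)%:~R * (th * y).
  have : (e * q)%:~R = (1 + q0 * ell)%:~R :> K by rewrite eE.
  rewrite /line /c !(rmorphM, rmorphD, rmorphN, rmorph1) /= => E.
  transitivity (- e%:~R * (g - (p%:~R * y + q%:~R * (th * y))) - (e%:~R * q%:~R - 1) * (th * y));
    first by ring.
  by rewrite E; ring.
apply: moduleB; last by apply: torsion_ell => //; apply: dvdz_mull.
by rewrite -rmorphN; apply: moduleZ.
Qed.

Lemma stable_order g : torsion g -> extension g (th * g) -> O `<=` multipliers (extension g).
Proof.
move=> Tg Gthg x Ox v [m Av]; have [c [d Ax]] := residue Ox.
have -> : x * v = x * (v - m%:~R * g) + m%:~R * ((x - (c%:~R + d%:~R * th)) * g + (c%:~R * g + d%:~R * (th * g))) by ring.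
apply: extensionD; first by apply/module_extension/moduleM.
apply/extensionZ/extensionD; first exact/module_extension/Ax.
by apply: extensionD; apply: extensionZ => //; apply: extension_gen.
Qed.

(** Multipliers are integral, hence locally in [O] when [O] is maximal at [l]; as they also map [A]
    into [T], [torsion_module] makes the inclusion global. *)
Lemma stable_maximal g s : torsion g -> locunit s -> (forall x, ZK x -> O (s * x)) ->
  multipliers (extension g) `<=` O.
Proof.
move=> Tg us sO x Gx; apply/multA => a Aa; apply: torsion_module.
  by apply/(extension_torsion Tg)/Gx/module_extension.
by exists s => //; rewrite mulrA; apply: moduleM => //; apply/sO/multipliers_integral/Gx.
Qed.
End Lines.

(** * Counting lines by type *)

Definition proper_line g : Prop := torsion g /\ ~ A g.

Definition exactly_lines (N : nat) (Q : set K -> Prop) : Prop :=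
  exists t : 'I_N -> K,
    [/\ forall i, proper_line (t i) /\ Q (extension (t i)),
        forall i j, extension (t i) = extension (t j) -> i = j
      & forall g, proper_line g -> Q (extension g) -> exists i, extension g = extension (t i)].

Definition line_descending (G : set K) : Prop :=
  completed_order K0 l (multipliers G) `<` completed_order K0 l O.

Definition line_ascending (G : set K) : Prop :=
  completed_order K0 l O `<` completed_order K0 l (multipliers G).

Definition line_horizontal (G : set K) : Prop := subring_iso O (multipliers G).

(** Strictness on completions is witnessed by the constant sequence [th]. Since the new order is a
    proper subring of [O], [order_not_iso] excludes an abstract isomorphism as well. *)
Lemma unstable_descending g th : torsion_basis g (th * g) -> O th ->
  line_descending (extension g) /\ ~ line_horizontal (extension g).
Proof.
move=> bas Oth; have [sub nth] := multipliers_unstable bas Oth; have [Tg _ _ _] := bas.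
split; last first.
  apply: order_not_iso => //; split=> // OG; apply: nth.
  by exists 1; [exact: locunit1 | rewrite mul1r; apply: OG].
split; first exact: completed_order_mono.
move=> /(_ _ (completed_order_const Oth)) C; apply: nth.
apply: completed_order_localize C.
- by move=> u v Gu Gv x Gx; rewrite mulrDl; apply: extensionD; [apply: Gu | apply: Gv].
- by move=> u v Gu Gv x Gx; rewrite -mulrA; apply/Gu/Gv.
- by move=> r Or K0r v; apply: extension_real.
- exact: multipliers_bound.
Qed.

Lemma order_horizontal G : multipliers G = O -> line_horizontal G.
Proof.
move=> GO; rewrite /line_horizontal GO; exists id; split=> //.
by split=> [x //||x Ox]; [move=> x y | exists x].
Qed.

Lemma proper_ascending G x : O `<=` multipliers G -> multipliers G x -> ~ localize O x ->
  line_ascending G.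
Proof.
move=> sub Gx nOx; split; first exact: completed_order_mono.
move=> /(_ _ (completed_order_const Gx)) C; apply: nOx.
apply: completed_order_localize C => //; [exact: orderD | exact: orderM |].
exact: (integers_bound hO dK0 dK).
Qed.

(** Eliminates [w] and [k]: what remains of them is [th], the pair [tau], [nu], and either the
    structure of the maximal order modulo [alpha] or an element witnessing ascent. *)
Lemma line_setup : exists th y (tau nu : int),
  [/\ O th, torsion_basis y (th * y),
      forall x, torsion x -> A ((th ^+ 2 - tau%:~R * th + nu%:~R) * x)
    & forall x, O x -> exists c d : int, forall v, torsion v ->
      A ((x - (c%:~R + d%:~R * th)) * v)] /\
  if `[< coprime_ideals ZK (extended_ideal l) (conductor O) >] then
    [/\ forall x, ZK x -> exists p q : int, exists2 z, ZK z & x = p%:~R + q%:~R * th + alpha * z,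
        forall (p q : int) z, ZK z -> p%:~R + q%:~R * th = alpha * z -> (ell %| p)%Z /\ (ell %| q)%Z
      & exists2 z, ZK z & th ^+ 2 - tau%:~R * th + nu%:~R = alpha * z]
  else
    [/\ tau = 0, nu = 0 & O `<=` multipliers (extension (th * y)) ->
        exists2 x, multipliers (extension (th * y)) x & ~ localize O x].
Proof.
have [w [k [nw Zw Oth genZ genO]]] := order_structure.
have cop := order_structure_coprime nw Zw Oth genZ genO.
have [y bas] := cyclic_vector Oth (generator_nonscalar nw Oth genO).
have [tau [nu [[a [b [Ra Rb quadE]]] k_pos]]] := generator_quadratic k Zw genZ.
have quadE' : (alpha ^+ k * w) ^+ 2 - tau%:~R * (alpha ^+ k * w) + nu%:~R =
  alpha * (a + b * (alpha ^+ k * w)).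
  by rewrite quadE; ring.
have Oquad : O ((alpha ^+ k * w) ^+ 2 - tau%:~R * (alpha ^+ k * w) + nu%:~R).
  apply: (orderD hO); last exact: order_int.
  by apply: (orderB hO); apply: orderM => //; exact: order_int.
have quadA x : torsion x -> A (((alpha ^+ k * w) ^+ 2 - tau%:~R * (alpha ^+ k * w) + nu%:~R) * x).
  by apply: (torsion_alpha Oquad quadE'); apply: localize_affine.
exists (alpha ^+ k * w), y, tau, nu; split; first split=> //.
  by move=> x; apply: (order_residue Oth genO).
case: asboolP => C.
  have k0 : k = 0%N by apply/cop.
  have LZ := order_lattice_integers; have a0 := alpha_neq0.
  have thE : alpha ^+ k * w = w by rewrite k0 mul1r.
  rewrite thE in quadE' Oth Oquad *.
  have Zaff c d : valring c -> valring d -> localize ZK (c + d * w).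
    move=> Rc Rd; have RZ r : valring r -> localize ZK r.
      by case=> _ [s us /integers_sub Zs]; exists s.
    by apply: (localizeD LZ); [exact: RZ | apply: (localizeM LZ)].
  (* The expansions in [genZ] are only local. An element integral at [l] is integral as soon as its
     product with [alpha] is, so they descend to the maximal order. *)
  have Zcancel u : localize ZK u -> ZK (alpha * u) -> ZK u.
    by case=> s us Zs; apply: integers_localize_cancel us Zs.
  split.
  - move=> x Zx; have [c [d [Rc Rd xE]]] := genZ _ (lattice_sub_localize Zx).
    have [p Rp] := valring_residue Rc; have [q Rq] := valring_residue Rd.
    exists p, q; exists ((c - p%:~R) / alpha + (d - q%:~R) / alpha * w); last by rewrite xE; field.
    apply: Zcancel; first exact: Zaff.
    have -> : alpha * ((c - p%:~R) / alpha + (d - q%:~R) / alpha * w) = x - (p%:~R + q%:~R * w).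
      by rewrite xE; field.
    apply: integersB => //; apply: integersD; first exact: integers_int.
    by apply: integersM; [exact: integers_int | apply: (order_integral hO)].
  - move=> p q z Zz e; have [c [d [Rc Rd zE]]] := genZ _ (lattice_sub_localize Zz).
    have K0a : alpha \in K0 by case: Zalpha.
    have [|||||pE qE] := @real_coord_inj w p%:~R q%:~R (alpha * c) (alpha * d) nw.
    + exact: memv_int.
    + exact: memv_int.
    + by apply: memvM => //; apply: valring_sub.
    + by apply: memvM => //; apply: valring_sub.
    + by rewrite e zE; ring.
    by split; apply: valring_dvd; rewrite ?pE ?qE mulrC mulKf.
  - exists (a + b * w) => //; apply: Zcancel; first exact: Zaff.
    by rewrite -quadE'; apply: (order_integral hO).
have k0 : (0 < k)%N by rewrite lt0n; apply/negP => /eqP/cop.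
have [t0 n0 ab] := k_pos k0; split=> // OG.
apply: (generator_ascend nw Oth genO k0 bas _ OG ab) => x Tx.
by have := quadA x Tx; rewrite t0 n0 mul0r subr0 addr0.
Qed.

Lemma line_classification :
  (coprime_ideals ZK (extended_ideal l) (conductor O) ->
     [/\ splits l -> exactly_lines 2 line_horizontal /\
           (forall g, proper_line g -> ~ line_horizontal (extension g) ->
             line_descending (extension g)),
         ramifies l -> exactly_lines 1 line_horizontal /\
           (forall g, proper_line g -> ~ line_horizontal (extension g) ->
             line_descending (extension g))
       & inert l -> exactly_lines ell.+1 (fun=> True) /\
           (forall g, proper_line g -> line_descending (extension g))]) /\
  (~ coprime_ideals ZK (extended_ideal l) (conductor O) ->
     exactly_lines 1 line_ascending /\ exactly_lines ell line_descending).
Proof.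
have [th [y [tau [nu [[Oth bas quad res] cases]]]]] := line_setup.
pose root c := (ell %| c ^+ 2 - tau * c + nu)%Z.
pose L := line th y; have Lprop c : proper_line (L c).
  by split; [exact: line_torsion bas c | exact: line_notin bas c].
have yprop : proper_line y by split; [case: bas | exact: axis_notin bas].
have [ydesc yhor] := unstable_descending bas Oth.
have Lunst c : ~ root c -> line_descending (extension (L c)) /\ ~ line_horizontal (extension (L c)).
  by move=> nr; exact: unstable_descending (line_unstable Oth bas quad nr) Oth.
have Lstab c : root c -> O `<=` multipliers (extension (L c)).
  by move=> rc; apply: (stable_order res);
    [case: (Lprop c) | exact: (@line_stable th y tau nu bas quad c rc)].
have Lclass := extension_classify bas.
have Lax c : extension (L c) <> extension y.
  by move=> e; apply: (line_not_axis bas (c := c)); rewrite -[extension y]e; apply: extension_gen.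
have Linj c c' : extension (L c) = extension (L c') -> (ell %| c - c')%Z.
  by move=> e; apply: (line_inj bas); rewrite -/L e; apply: extension_gen.
have Linj_lt (i j : nat) : (i < ell)%N -> (j < ell)%N -> extension (L i) = extension (L j) -> i = j.
  by move=> li lj /Linj/dvdzP[[[|q]|q]]; nia.
case: asboolP cases => cop => [[gen indep quadZ] | [t0 n0 asc]]; split=> // _; last first.
  (* The polynomial is now [c ^+ 2], so [L 0], the line of [th * y], is the only stable one. *)
  have rootE c : root c <-> (ell %| c)%Z.
    rewrite /root t0 n0 mul0r subr0 addr0 expr2; split=> [/int_prime[]//|].
    exact: dvdz_mulr.
  have ext0 : extension (L 0) = extension (th * y) by rewrite /L /line mul0r subr0.
  have Lasc c : (ell %| c)%Z -> line_ascending (extension (L c)).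
    move=> ec; rewrite (@line_cong th y bas c 0) ?subr0 //.
    have r0 : root 0 by apply/rootE; apply: dvdz0.
    have := Lstab 0 r0; rewrite -/L ext0 => OG; have [x Gx nOx] := asc OG.
    exact: proper_ascending Gx nOx.
  have asc_desc G : line_ascending G -> line_descending G -> False by case=> _ nGO [].
  split.
    exists (fun=> L 0); split=> [i|i j _|g [Tg nAg] gasc].
    - by split=> //; apply: Lasc; apply: dvdz0.
    - by rewrite !ord1.
    exists ord0; case: (Lclass g Tg nAg) => [e|[c _ e]]; rewrite e in gasc *.
      by case: (asc_desc _ gasc ydesc).
    have [/rootE rc|nr] := pselect (root c); first by apply: (line_cong bas); rewrite subr0.
    by case: (asc_desc _ gasc (Lunst _ nr).1).
  (* [L 0] is the ascending line, so its index is given to [y]. *)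
  exists (fun i : 'I_ell => if i == 0 :> nat then y else L i); split=> [i|i j|g [Tg nAg] gdesc].
  - case: eqP => i0 //; split=> //; apply: (Lunst _ _).1 => /rootE.
    by move=> /dvdzP[[[|q]|q]]; have := ltn_ord i; nia.
  - case: eqP => i0; case: eqP => j0 e; apply: val_inj => /=.
    + by rewrite i0 j0.
    + by case: (Lax _ (esym e)).
    + by case: (Lax _ e).
    + exact: Linj_lt e.
  case: (Lclass g Tg nAg) => [e|[c _ e]].
    by exists (Ordinal (prime_gt0 hell)).
  exists c; case: eqP => // c0; case: (asc_desc (extension g)) => //.
  by rewrite e c0; apply: Lasc; apply: dvdz0.
have [s us sO] := coprime_conductorP.1 cop.
have Zth : ZK th by apply: (order_integral hO).
have Lhor c : root c -> line_horizontal (extension (L c)).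
  move=> rc; apply: order_horizontal; apply/seteqP; split; last exact: Lstab.
  by apply: (fun Tg => stable_maximal Tg us sO); case: (Lprop c).
have Lothers g : proper_line g -> ~ line_horizontal (extension g) -> line_descending (extension g).
  move=> [Tg nAg]; case: (Lclass g Tg nAg) => [-> //|[c _ ->]] nh.
  by have [rc|/Lunst[]//] := pselect (root c); case: nh; apply: Lhor.
have hor_root c : line_horizontal (extension (L c)) -> root c.
  by move=> hc; apply: contrapT => /Lunst[].
split=> [/(residue_splits Zth gen indep quadZ) [c [c' [ncc rootE]]] | /(residue_ramifies Zth gen indep quadZ)[c rootE] | in_l].
- split=> //; have [rc rc'] : root c /\ root c' by split; apply/rootE; [left | right];
  rewrite subrr dvdz0.
  exists (fun i : 'I_2 => if i == 0 :> nat then L c else L c'); split=> [i|i j|g [Tg nAg] ghor].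
  + by case: eqP => _; split=> //; apply: Lhor.
  + have ncc' : ~ (ell %| c' - c)%Z by rewrite -rpredN opprB.
    by case: i j => [[|[|//]] i2] [[|[|//]] j2] //= e; apply: val_inj => //=; case: (ncc);
      [exact: Linj | rewrite -rpredN opprB; exact: Linj].
  + case: (Lclass g Tg nAg) => [e|[d _ e]]; rewrite e in ghor *; first by case: yhor.
    have /rootE[dc|dc] := hor_root _ ghor; [exists ord0 | exists ord_max]; exact: (line_cong bas).
- split=> //; have rc : root c by apply/rootE; rewrite subrr dvdz0.
  exists (fun=> L c); split=> [i|i j _|g [Tg nAg] ghor].
  + by split=> //; apply: Lhor.
  + by rewrite !ord1.
  + exists ord0; case: (Lclass g Tg nAg) => [e|[d _ e]]; rewrite e in ghor *; first by case: yhor.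
    by have /rootE dc := hor_root _ ghor; apply: (line_cong bas).
have nroot c : ~ root c by exact: residue_inert Zth indep quadZ c in_l.
split; last first.
  move=> g [Tg nAg]; case: (Lclass g Tg nAg) => [-> //|[c _ ->]].
  by case: (Lunst c (nroot c)).
(* All lines are counted here, and the extra index [ell] is that of [y]. *)
exists (fun i : 'I_ell.+1 => if (i < ell)%N then L i else y); split=> [i|i j|g [Tg nAg] _].
- by case: ifP.
- case: ifPn => li; case: ifPn => lj e; apply: val_inj => /=.
  + exact: Linj_lt e.
  + by case: (Lax _ e).
  + by case: (Lax _ (esym e)).
  + by have := ltn_ord i; have := ltn_ord j; lia.
case: (Lclass g Tg nAg) => [e|[c _ e]]; first by exists ord_max; rewrite /= ltnn.
by exists (widen_ord (leqnSn ell) c); rewrite /= ltn_ord.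
Qed.
End Module.

End Localization.

(** * Complex tori *)

Section Transport.
Variable R : realType.
Local Notation C := R[i].
Local Notation V := 'cV[R[i]]_2.

Definition superlattice (Lam : set V) (v : V) : set V := [set u | exists m : int, Lam (u - v *~ m)].

Lemma inIntSpanP m (b : m.-tuple V) u :
  inIntSpan b u <-> exists c : 'I_m -> int, u = \sum_i tnth b i *~ c i.
Proof.
split=> [[c ->]|[c ->]].
  by exists c; apply: eq_bigr => i _; rewrite (tnth_nth 0).
by exists [ffun i => c i]; apply: eq_bigr => i _; rewrite ffunE (tnth_nth 0).
Qed.

Lemma inIntSpanB m (b : m.-tuple V) u w : inIntSpan b u -> inIntSpan b w -> inIntSpan b (u - w).
Proof.
move=> /inIntSpanP[c ->] /inIntSpanP[d ->]; apply/inIntSpanP; exists (fun i => c i - d i).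
by rewrite -sumrB; apply: eq_bigr => i _; rewrite mulrzBr.
Qed.

Lemma inIntSpan_gen m (b : m.-tuple V) i : inIntSpan b (tnth b i).
Proof.
apply/inIntSpanP; exists (fun j => (j == i)%:R); rewrite (bigD1 i) //= eqxx.
by rewrite big1 ?addr0 // => j /negPf->; rewrite mulr0z.
Qed.

Lemma inIntSpan_sub m (b : m.-tuple V) (M : set V) :
    (forall u w, M u -> M w -> M (u - w)) -> M 0 -> (forall i, M (tnth b i)) -> inIntSpan b `<=` M.
Proof.
move=> MB M0 Mb _ /inIntSpanP[c ->].
have MN u : M u -> M (- u) by move=> Mu; rewrite -[- u]sub0r; apply: MB.
have MD u w : M u -> M w -> M (u + w) by move=> Mu /MN Mw; rewrite -[w]opprK; apply: MB.
have Mn u n : M u -> M (u *+ n) by move=> Mu; elim: n => // n IHn; rewrite mulrS; apply: MD.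
apply: (@big_ind _ M) => // i _; case: (c i) => n; first exact: Mn.
by rewrite NegzE mulrNz; apply/MN/Mn.
Qed.

Section Additive.
Variable M : set V.
Hypotheses (M0 : M 0) (MB : forall u w, M u -> M w -> M (u - w)).

Lemma additiveN u : M u -> M (- u).
Proof. by move=> Mu; rewrite -[- u]sub0r; apply: MB. Qed.

Lemma additiveD u w : M u -> M w -> M (u + w).
Proof. by move=> Mu Mw; rewrite -[w]opprK; apply: MB => //; apply: additiveN. Qed.

Lemma additiveZ u (m : int) : M u -> M (u *~ m).
Proof.
move=> Mu; have Mn n : M (u *+ n).
  by elim: n => // n IHn; rewrite mulrS; apply: additiveD.
by case: m => n; [apply: Mn | rewrite NegzE mulrNz; apply/additiveN/Mn].
Qed.
End Additive.

Lemma inIntSpan0 m (b : m.-tuple V) : inIntSpan b 0.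
Proof. by apply/inIntSpanP; exists (fun=> 0); rewrite big1. Qed.

(** Write [ell v] in the basis [b]; some coordinate [c j] is prime to [ell], since otherwise [v]
    would be in the lattice. With [e c_j = 1 + q ell], the vector [v' = e v - q b_j] satisfies
    [ell v' = b_j] plus a combination of the other [b_i], so it can replace [b_j] in a basis of the
    superlattice. *)
Lemma superlattice_lattice (Lam : set V) (v : V) (ell : nat) :
    is_lattice Lam -> prime ell -> Lam (v *+ ell) -> ~ Lam v ->
  is_lattice (superlattice Lam v).
Proof.
move=> [b [indep ->]] hell /inIntSpanP[c cE] nv.
have ell0 : (ell%:R : C) != 0 by rewrite pnatr_eq0 -lt0n prime_gt0.
have ell_inj (u w : V) : u *+ ell = w *+ ell -> u = w.
  by rewrite -[u *+ _]scaler_nat -[w *+ _]scaler_nat => /(scalerI ell0).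
have [j nj] : exists j, ~ (ell %| c j)%Z.
  apply: contrapT => nex; apply: nv; have /choice[d dE] i : exists d : int, c i = d * ell.
    by apply/dvdzP; apply: contrapT => ni; apply: nex; exists i.
  apply/inIntSpanP; exists d; apply: ell_inj; rewrite cE -sumrMnl.
  by apply: eq_bigr => i _; rewrite dE mulrzA.
have [e [q eE]] := int_inverse hell nj.
set bj := tnth b j; pose v' := v *~ e - bj *~ q.
pose b' := [tuple (if i == j then v' else tnth b i) | i < 4].
have b'E i : tnth b' i = if i == j then v' else tnth b i by rewrite tnth_mktuple.
have ellv' : v' *+ ell = bj + \sum_(i | i != j) tnth b i *~ (e * c i).
  rewrite pmulrn /v' mulrzBl mulrzAC -pmulrn cE -!mulrzA mulrz_suml.
  rewrite (bigD1 j) //= -mulrzA [c j * e]mulrC eE mulrzDr mulr1z addrAC addrK.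
  by congr (_ + _); apply: eq_bigr => i _; rewrite -mulrzA mulrC.
have G0 : superlattice (inIntSpan b) v 0 by exists 0; rewrite subr0; apply: inIntSpan0.
have GB u w : superlattice (inIntSpan b) v u -> superlattice (inIntSpan b) v w ->
    superlattice (inIntSpan b) v (u - w).
  move=> [m Lu] [n Lw]; exists (m - n); have := inIntSpanB Lu Lw.
  suff -> : u - w - v *~ (m - n) = (u - v *~ m) - (w - v *~ n) by [].
  by rewrite mulrzBr !opprB addrACA [RHS]addrACA [- w - _]addrC.
have LG u : inIntSpan b u -> superlattice (inIntSpan b) v u by exists 0; rewrite subr0.
have Gv : superlattice (inIntSpan b) v v by exists 1; rewrite subrr; apply: inIntSpan0.
have S0 := inIntSpan0 b'; have SB := @inIntSpanB _ b'.
have Sv' : inIntSpan b' v' by have := inIntSpan_gen b' j; rewrite b'E eqxx.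
have Sb i : i != j -> inIntSpan b' (tnth b i).
  by move=> nij; have := inIntSpan_gen b' i; rewrite b'E (negPf nij).
have SZ := additiveZ S0 SB.
have Sbj : inIntSpan b' bj.
  have -> : bj = v' *~ ell - \sum_(i | i != j) tnth b i *~ (e * c i) by rewrite -pmulrn ellv' addrK.
  apply: (SB); first exact: SZ.
  apply: (@big_ind _ (inIntSpan b')) => [||i nij];
    [exact: S0 | exact: additiveD S0 SB | exact/SZ/Sb].
have SL u : inIntSpan b u -> inIntSpan b' u.
  by apply: (inIntSpan_sub SB S0) => i; have [->|/Sb] := eqVneq i j.
exists b'; split=> [r rE i|]; last first.
  apply/seteqP; split=> [u [m Lu]|]; last first.
    apply: (inIntSpan_sub GB G0) => i; rewrite b'E; case: eqP => _; last exact/LG/inIntSpan_gen.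
    by apply: (GB); apply: (additiveZ G0 GB) => //; apply/LG/inIntSpan_gen.
  have Sv : inIntSpan b' v.
    (* Uses [c_j v' = e c_j v - q c_j b_j] and [e c_j = 1 + q ell]. *)
    have -> : v = v' *~ c j + bj *~ (q * c j) - (v *+ ell) *~ q.
      rewrite /v' mulrzBl -!mulrzA subrK eE mulrzDr mulr1z pmulrn -mulrzA [ell%:Z * q]mulrC.
      by rewrite addrK.
    by apply: (SB); [apply: (additiveD S0 SB); apply: SZ | apply/SZ/SL; rewrite cE;
      apply/inIntSpanP; exists c].
  by rewrite -[u](subrK (v *~ m)); apply: (additiveD S0 SB); [exact: SL | exact: SZ].
(* The coefficients, on the old basis, of [ell] times the relation given by [r] on the new one. *)
pose f i : R := if i == j then r j else ell%:R * r i + r j * (e * c i)%:~R.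
have fE : \sum_i (f i)%:C%C *: tnth b i = 0.
  transitivity ((\sum_i (r i)%:C%C *: tnth b' i) *+ ell); last by rewrite rE mul0rn.
  rewrite -sumrMnl (bigD1 j) //= [RHS](bigD1 j) //= b'E eqxx.
  rewrite scalerMnr ellv' scalerDr -addrA; congr (_ + _); first by rewrite /f eqxx.
  rewrite scaler_sumr -big_split /=; apply: eq_bigr => i' nij.
  rewrite b'E (negPf nij) /f (negPf nij) rmorphD !rmorphM /= rmorph_nat rmorph_int scalerDl addrC.
  congr (_ + _); first by rewrite -scalerA scaler_nat.
  by rewrite -[tnth b i' *~ _]scaler_int scalerA !rmorphM /= rmorph_int.
have rj : r j = 0 by have := indep _ fE j; rewrite /f eqxx.
have [->//|nij] := eqVneq i j.
have := indep _ fE i; rewrite /f (negPf nij) rj mul0r addr0 => /eqP.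
by rewrite mulf_eq0 pnatr_eq0 (negPf (lt0n_neq0 (prime_gt0 hell))) /= => /eqP.
Qed.

(** Multiplication by [ell] maps the superlattice into [Lam], so [ell ^ 2 H] takes there the values
    of [H] at points of [Lam]. *)
Lemma superlattice_polarizable (Lam : set V) (v : V) (ell : nat) :
    is_lattice Lam -> (0 < ell)%N -> Lam (v *+ ell) ->
    (exists H, is_polarization Lam H) ->
  exists H, is_polarization (superlattice Lam v) H.
Proof.
move=> [b [_ LamE]] ell0 Lv [H [Hlin Hsym Hpos Hint]].
have L0 : Lam 0 by rewrite LamE; apply: inIntSpan0.
have LB u w : Lam u -> Lam w -> Lam (u - w) by rewrite LamE; apply: inIntSpanB.
have Lell u : superlattice Lam v u -> Lam (ell%:R *: u).
  move=> [m Lu]; rewrite scaler_nat -[u](subrK (v *~ m)) mulrnDl.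
  apply: (additiveD L0 LB); first by rewrite pmulrn; apply: (additiveZ L0 LB).
  by rewrite pmulrn mulrzAC -pmulrn; apply: (additiveZ L0 LB).
have HZ a u w : H (a *: u) w = a * H u w.
  have H0 : H 0 w = 0.
    by apply: (addIr (H 0 w)); rewrite add0r -[X in X + _]mul1r -Hlin scale1r addr0.
  by rewrite -[a *: u]addr0 Hlin H0 addr0.
have HZr a u w : H u (a *: w) = (a^*)%C * H u w.
  by rewrite Hsym HZ rmorphM /= -Hsym.
have ell_pos : 0 < ell%:R :> C by rewrite ltr0n.
exists (fun u w => ell%:R ^+ 2 * H u w); split.
- by move=> a u w z; rewrite Hlin mulrDr mulrCA.
- by move=> u w; rewrite Hsym rmorphM rmorphXn /= rmorph_nat.
- by move=> u nu; rewrite mulr_gt0 ?exprn_gt0 ?Hpos.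
move=> u w /Lell Lu /Lell Lw; have := Hint _ _ Lu Lw.
by rewrite HZ HZr rmorph_nat mulrA -expr2.
Qed.

(** * The lattice as a subgroup of K *)

Section Surface.
Variables (K : fieldExtType rat) (O : set K) (A : abelian_surface R).
Variable iota : {rmorphism K -> 'M[R[i]]_2}.
Hypotheses (dK : \dim {:K} = 4) (hO : is_order O).
Hypothesis hEnd : endo_ring A = [set iota x | x in O].
Local Notation Lam := (lattice A).

Lemma iotaM x y (v : V) : iota (x * y) *m v = iota x *m (iota y *m v).
Proof. by rewrite rmorphM mulmxA. Qed.

Lemma iotaB x y (v : V) : iota (x - y) *m v = iota x *m v - iota y *m v.
Proof. by rewrite rmorphB mulmxBl. Qed.

Lemma iota1 (v : V) : iota 1 *m v = v.
Proof. by rewrite rmorph1 mul1mx. Qed.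

Lemma iota_int (n : int) (v : V) : iota n%:~R *m v = v *~ n.
Proof. by rewrite rmorph_int -[n%:~R]scaler_int -scalemxAl mul1mx scaler_int. Qed.

Lemma iotaZ (n : int) x (v : V) : iota (n%:~R * x) *m v = (iota x *m v) *~ n.
Proof. by rewrite iotaM iota_int. Qed.

Lemma iota_eq0 x (v : V) : v != 0 -> iota x *m v = 0 -> x = 0.
Proof.
move=> v0 xv; apply: contraNeq v0 => nx.
by rewrite -[v]iota1 -(mulVf nx) iotaM xv mulmx0.
Qed.

Lemma iota_vec_inj (v : V) x y : v != 0 -> iota x *m v = iota y *m v -> x = y.
Proof.
by move=> v0 e; apply/eqP; rewrite -subr_eq0; apply/eqP/(iota_eq0 v0); rewrite iotaB e subrr.
Qed.

Lemma iota_inj : injective iota.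
Proof. exact: fmorph_inj. Qed.

Lemma order_endo x : endo_ring A (iota x) <-> O x.
Proof. by rewrite hEnd; split=> [[y Oy /iota_inj <-] //|Ox]; exists x. Qed.

Lemma lattice_additive : Lam 0 /\ forall u w, Lam u -> Lam w -> Lam (u - w).
Proof.
have [b [_ ->]] := latticeP A; split; first exact: inIntSpan0.
exact: inIntSpanB.
Qed.

Lemma mulrz_torsion_free (u w : V) (n : nat) : (0 < n)%N -> u *~ n = w *~ n -> u = w.
Proof.
move=> n0; rewrite -!pmulrn -[u *+ _]scaler_nat -[w *+ _]scaler_nat; apply: scalerI.
by rewrite pnatr_eq0 -lt0n.
Qed.

(** The rank of the lattice is the degree of [K]. For a basis [E] of [O], the vectors
    [iota (E j) *m v0] have integer coordinates on [b] and are independent, because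
    [iota x *m v0 = 0] forces [x = 0]. So the rational square matrix [M] is invertible, and its
    inverse writes each basis vector as a multiple of [v0] by an element of [K]. *)
Lemma lattice_rank_one : exists (v0 : V) (X : 'I_4 -> K),
  [/\ v0 != 0, Lam v0, [set x | Lam (iota x *m v0)] = zspan X
    & forall u, Lam u -> exists x, u = iota x *m v0].
Proof.
have [b [indep LamE]] := latticeP A; pose v0 := tnth b ord0.
have v00 : v0 != 0.
  apply/eqP=> v00; have := indep (fun i => (i == ord0)%:R) _ ord0; rewrite eqxx => H.
  suff /eqP : (1 : R) = 0 by rewrite oner_eq0.
  apply: H; rewrite (bigD1 ord0) //= -/v0 v00 scaler0 add0r big1 // => i /negPf->.
  by rewrite scale0r.
have Lv0 : Lam v0 by rewrite LamE; apply: inIntSpan_gen.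
have [_ _ [e [basis_e OE]]] := hO; have free_e := basis_free basis_e.
set d := \dim {:K} in e basis_e OE free_e *.
pose E (j : 'I_d) := e`_j.
have OEj j : O (E j).
  by rewrite OE inIntSpan_zspan; apply: (zspan_gen (fun i : 'I_d => e`_i)).
have /choice[N NE] j : exists n : 'I_4 -> int, iota (E j) *m v0 = \sum_i tnth b i *~ n i.
  by apply/inIntSpanP; rewrite -LamE; apply: (order_endo _).2.
have sumE (c : 'I_d -> int) : iota (\sum_j (c j)%:~R * E j) *m v0 =
    \sum_i tnth b i *~ (\sum_j N j i * c j).
  rewrite rmorph_sum mulmx_suml.
  transitivity (\sum_j \sum_i tnth b i *~ (N j i * c j)).
    by apply: eq_bigr => j _; rewrite iotaZ NE mulrz_suml; apply: eq_bigr => i _; rewrite mulrzA.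
  by rewrite exchange_big; apply: eq_bigr => i _; rewrite -mulrz_sumr.
pose M : 'M[rat]_(d, 4) := \matrix_(j, i) (N j i)%:~R.
have free_M : row_free M.
  apply: inj_row_free => u uM; have [D D0 [c cE]] := common_denominator (fun j => u 0 j).
  have cN i : \sum_j N j i * c j = 0.
    have : D%:R * (u *m M) 0 i = 0 by rewrite uM mxE mulr0.
    rewrite mxE mulr_sumr => s0; apply/eqP; rewrite -(intr_eq0 rat) rmorph_sum /=; apply/eqP.
    by apply: etrans s0; apply: eq_bigr => j _; rewrite rmorphM /= -cE mxE; ring.
  have /(iota_eq0 v00) c0 : iota (\sum_j (c j)%:~R * E j) *m v0 = 0.
    by rewrite sumE big1 // => i _; rewrite cN mulr0z.
  apply/rowP=> j; rewrite mxE; have : (D%:R * u 0 j == 0).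
    rewrite cE; have /freeP/(_ (fun j => (c j)%:~R)) := free_e; move/(_ _ j) => -> //.
    by rewrite -[RHS]c0; apply: eq_bigr => k _; rewrite scaler_int mulrzl.
  by rewrite mulf_eq0 pnatr_eq0 (negPf (lt0n_neq0 D0)) => /eqP.
have /row_fullP[B BM] : row_full M by rewrite /row_full (eqP free_M) /d dK.
have /choice[X XE] i : exists x, iota x *m v0 = tnth b i.
  have [D D0 [c cE]] := common_denominator (fun j => B i j).
  exists ((\sum_j (c j)%:~R * E j) / D%:R); apply: (mulrz_torsion_free D0).
  have nD : D%:R != 0 :> K by rewrite natrK_eq0 -lt0n.
  have NB k : \sum_j N j k * c j = D * (k == i)%:R :> int.
    apply: (@intr_inj rat); rewrite rmorph_sum /=.
    transitivity (D%:R * (k == i)%:R : rat); last by case: (k == i); rewrite ?mulr1 ?mulr0.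
    have := congr1 (fun Z : 'M[rat]_4 => D%:R * Z i k) BM; rewrite !mxE mulr_sumr eq_sym => BMik.
    by apply: etrans BMik; apply: eq_bigr => j _; rewrite rmorphM /= -cE mxE; ring.
  rewrite -iotaZ -pmulrn mulrCA divff // mulr1 sumE (bigD1 i) //= NB eqxx mulr1.
  by rewrite big1 ?addr0 // => k /negPf ki; rewrite NB ki mulr0 mulr0z.
have XS (c : 'I_4 -> int) : iota (\sum_i (c i)%:~R * X i) *m v0 = \sum_i tnth b i *~ c i.
  by rewrite rmorph_sum mulmx_suml; apply: eq_bigr => i _; rewrite iotaZ XE.
exists v0, X; split=> //.
  apply/seteqP; split=> x; rewrite /= LamE inIntSpanP => -[c cE]; exists c.
    by apply: (iota_vec_inj v00); rewrite cE XS.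
  by rewrite cE XS.
by move=> u; rewrite LamE inIntSpanP => -[c ->]; exists (\sum_i (c i)%:~R * X i); rewrite XS.
Qed.

(** * l-isogenies and lines *)

Section Isogenies.
Variables (K0 : {subfield K}) (alpha : K) (ell : nat).
Hypotheses (hell : prime ell) (Zalpha : integers K0 alpha).
Let l := principal (integers K0) alpha.
Hypothesis hnorm : has_index (integers K0) l ell.
Variables (v0 : V) (X : 'I_4 -> K).
Hypotheses (v00 : v0 != 0) (Lv0 : Lam v0) (LX : [set x | Lam (iota x *m v0)] = zspan X).
Hypothesis Lgen : forall u, Lam u -> exists x, u = iota x *m v0.
Let AA : set K := [set x | Lam (iota x *m v0)].

Let L0 : Lam 0. Proof. by case: lattice_additive. Qed.
Let LB u w : Lam u -> Lam w -> Lam (u - w). Proof. by case: lattice_additive => _; apply. Qed.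
Let LD := additiveD L0 LB.
Let LZ := additiveZ L0 LB.

Lemma shadow_multiplier x : O x <-> forall a, AA a -> AA (x * a).
Proof.
split=> [/order_endo Ex a La | xAA]; first by rewrite /AA /= iotaM; apply: Ex.
apply/order_endo => u Lu; have [a aE] := Lgen Lu.
by rewrite aE -iotaM; apply: xAA; rewrite /AA /= -aE.
Qed.

Lemma shadow1 : AA 1.
Proof. by rewrite /AA /= iota1. Qed.

Lemma torsion_shadow x : torsion K0 O alpha AA x <-> ltorsion l A iota (iota x *m v0).
Proof.
split=> T b lb Ob; first by rewrite -iotaM; apply: T => //; apply/order_endo.
by rewrite /AA /= iotaM; apply: T => //; apply/order_endo.
Qed.

(** Since [ell] lies in [l] and in [O], the vector [ell v] is in the lattice, and division by [ell]
    takes place in [K]. *)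
Lemma ltorsion_line v : ltorsion l A iota v -> exists x, v = iota x *m v0.
Proof.
move=> T; have ell0 := prime_gt0 hell.
have /Lgen[x xE] : Lam (iota (Posz ell)%:~R *m v).
  apply: T; first exact: ideal_ell hnorm.
  by apply/order_endo; exact: (order_int hO (Posz ell)).
exists (x / ell%:R); apply: (mulrz_torsion_free ell0).
have nell : ell%:R != 0 :> K by rewrite natrK_eq0 -lt0n.
by rewrite -iota_int xE -iotaZ -pmulrn mulrCA divff ?mulr1.
Qed.

Definition shadow (phi : isogeny A) : set K := [set x | isog_ker phi (iota x *m v0)].

(** Under this condition the kernel is recovered from its shadow, which only sees multiples of
    [v0]. *)
Definition on_line (phi : isogeny A) : Prop := forall v, isog_ker phi v -> exists x, v =
  iota x *m v0.

Lemma isog_ker_lattice (phi : isogeny A) : Lam `<=` isog_ker phi.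
Proof. by move=> v; apply: (@isog_hom _ _ phi). Qed.

Lemma isog_kerB (phi : isogeny A) u w : isog_ker phi u -> isog_ker phi w -> isog_ker phi (u - w).
Proof.
have [b [_ bE]] := latticeP (target phi).
by rewrite /isog_ker /= mulmxBr bE; apply: inIntSpanB.
Qed.

Lemma isog_ker0 (phi : isogeny A) : isog_ker phi 0.
Proof. exact: isog_ker_lattice L0. Qed.

Lemma l_isogeny_on_line (phi : isogeny A) : l_isogeny l ell iota phi -> on_line phi.
Proof. by case=> sub _ _ v /sub/ltorsion_line. Qed.

Lemma l_isogeny_line (phi : isogeny A) : l_isogeny l ell iota phi ->
  exists2 g, proper_line K0 O alpha AA g & shadow phi = extension AA g.
Proof.
move=> lphi; have onl := l_isogeny_on_line lphi; case: lphi => sub [t [kt tP]] [v kv gen].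
have [g vE] := onl _ kv; exists g; first split.
- by apply/torsion_shadow; rewrite -vE; apply: sub.
- rewrite /AA /= -vE => Lv.
  have kL w : isog_ker phi w -> Lam w.
    by move=> /gen[m Lw]; rewrite -[w](subrK (v *~ m)); apply: LD => //; apply: LZ.
  have n1 := prime_gt1 hell; have n0 := ltnW n1; have [k [_ uk]] := tP _ (kt (Ordinal n0)).
  have e0 : k = Ordinal n0 by apply: uk; apply: LB; apply: kL.
  have e1 : k = Ordinal n1 by apply: uk; apply: LB; apply: kL.
  by have := congr1 val e1; rewrite e0.
apply/seteqP; split=> [x /gen[m Lx]|x [m Lx]].
  by exists m; rewrite /AA /= iotaB iotaZ -vE.
rewrite /shadow /= -[iota x *m v0](subrK (v *~ m)).
apply: (additiveD (isog_ker0 phi) (@isog_kerB phi)); last first.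
  by apply: (additiveZ (isog_ker0 phi) (@isog_kerB phi)).
by apply: isog_ker_lattice; rewrite vE -iotaZ -iotaB.
Qed.

(** Pulled back along [phi], the lattice of the target becomes [isog_ker phi], and the conjugation
    by [phi] disappears. *)
Lemma target_multipliers (phi : isogeny A) : on_line phi ->
  order_of_target iota phi = multipliers (shadow phi).
Proof.
move=> onl; have uphi := isog_unit phi; apply/seteqP; split=> x Hx.
  move=> y ky; rewrite /shadow /isog_ker /= iotaM.
  by have := Hx _ ky; rewrite -!mulmxA mulKmx.
move=> w Bw; have kw : isog_ker phi (invmx (isog_mx phi) *m w) by rewrite /isog_ker /= mulKVmx.
have [y yE] := onl _ kw; rewrite -!mulmxA yE -iotaM.
by apply: Hx; rewrite /shadow /= -yE.
Qed.

(** Isogenies with the same kernel differ by [psi phi^-1], which carries one target lattice onto the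
    other. *)
Lemma isog_iso_shadow (phi psi : isogeny A) : on_line phi -> on_line psi ->
  isog_iso phi psi <-> shadow phi = shadow psi.
Proof.
move=> onphi onpsi; have uphi := isog_unit phi; have upsi := isog_unit psi.
split=> [[U [uU hU hU' psiE]] | e].
  apply/seteqP; split=> x; rewrite /shadow /isog_ker /=.
    by rewrite psiE -mulmxA; apply: hU.
  by move=> /hU'; rewrite psiE -!mulmxA mulKmx.
have ker_sub (p q : isogeny A) : on_line p -> shadow p = shadow q -> isog_ker p `<=` isog_ker q.
  by move=> onp epq v kv; have [x xE] := onp _ kv; have := kv;
    rewrite xE -[isog_ker p _]/(shadow p x) epq.
exists (isog_mx psi *m invmx (isog_mx phi)); split.
- by rewrite unitmx_mul upsi unitmx_inv.
- move=> w Bw; rewrite -mulmxA; apply: (ker_sub phi psi onphi e).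
  by rewrite /isog_ker /= mulKVmx.
- move=> w Bw; have -> : invmx (isog_mx psi *m invmx (isog_mx phi)) =
  isog_mx phi *m invmx (isog_mx psi).
    by rewrite -[LHS]mulmx1 -(mulmxV upsi); apply: (canLR (mulKmx _));
      [rewrite unitmx_mul upsi unitmx_inv | rewrite !mulmxA mulmxKV].
  rewrite -mulmxA; apply: (ker_sub psi phi onpsi (esym e)).
  by rewrite /isog_ker /= mulKVmx.
- by rewrite mulmxKV.
Qed.

(** The isogeny is the identity matrix, from the lattice to the superlattice generated by
    [v = iota g *m v0]; its kernel consists of the classes of [0, v, ..., (ell - 1) v]. *)
Lemma line_isogeny g : proper_line K0 O alpha AA g ->
  exists2 phi : isogeny A, l_isogeny l ell iota phi & shadow phi = extension AA g.
Proof.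
move=> [Tg nAg]; have ell0 := prime_gt0 hell; pose v := iota g *m v0.
have Tv : ltorsion l A iota v by apply/torsion_shadow.
have Lk (k : int) : (ell %| k)%Z -> Lam (v *~ k).
  case/dvdzP=> q ->; rewrite mulrC mulrzA; apply: LZ; rewrite -iota_int; apply: Tv.
    exact: ideal_ell hnorm.
  by apply/order_endo; exact: (order_int hO (Posz ell)).
have Lell : Lam (v *+ ell) by rewrite pmulrn; apply: Lk.
have nv : ~ Lam v by [].
have [H HP] := superlattice_polarizable (latticeP A) ell0 Lell (polarizableP A).
pose B := AbelianSurface (superlattice_lattice (latticeP A) hell Lell nv) (ex_intro _ H HP).
have homB : is_hom A B 1%:M by move=> u Lu; rewrite mul1mx; exists 0; rewrite subr0.
pose phi := Isogeny (unitmx1 _ _) homB.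
have kE u : isog_ker phi u <-> exists m : int, Lam (u - v *~ m) by rewrite /isog_ker /= mul1mx.
have kv : isog_ker phi v by apply/kE; exists 1; rewrite subrr.
exists phi; last first.
  apply/seteqP; split=> x; first by move/kE=> [m Lx]; exists m; rewrite /AA /= iotaB iotaZ.
  by case=> m Lx; apply/kE; exists m; rewrite -iotaZ -iotaB.
split.
- move=> u /kE[m Lu] b lb Ob; rewrite -[u](subrK (v *~ m)) mulmxDr.
  apply: LD; first exact: Ob.
  by rewrite -[v *~ m]iota_int -iotaM mulrC iotaM iota_int; apply: LZ; apply: Tv.
- exists (fun i => v *+ i); split=> [i|u /kE[m Lu]].
    by apply/kE; exists (Posz i); rewrite pmulrn subrr.
  have elln0 : (ell != 0 :> int) by rewrite eqz_nat -lt0n.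
  have c_lt : (`|(m %% ell)%Z| < ell)%N.
    by rewrite -ltz_nat gez0_abs ?modz_ge0 // ltz_pmod // ltz_nat.
  exists (Ordinal c_lt); split=> [|j Lj].
    rewrite /= pmulrn gez0_abs ?modz_ge0 //.
    have -> : u - v *~ (m %% ell)%Z = (u - v *~ m) + v *~ (m - (m %% ell)%Z).
      by rewrite mulrzBr addrA subrK.
    by apply: LD => //; apply: Lk; rewrite {1}(divz_eq m ell) addrK dvdz_mull.
  have Lmj : Lam (v *~ (m - j%:Z)).
    have -> : v *~ (m - j%:Z) = (u - v *+ j) - (u - v *~ m).
      by rewrite mulrzBr pmulrn opprB [RHS]addrC addrA subrK.
    exact: LB.
  have : (ell %| m - j%:Z)%Z.
    apply: contrapT => /(int_inverse hell)[e [q eE]]; apply: (nv).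
    have -> : v = v *~ (m - j%:Z) *~ e - v *~ (q * ell).
      by rewrite -mulrzA [X in v *~ X - _]mulrC eE mulrzDr mulr1z addrK.
    by apply: LB; [exact: LZ | apply: Lk; apply: dvdz_mull].
  move=> dmj; apply: val_inj => /=; have := dmj; rewrite -eqz_mod_dvd => /eqP ->.
  by rewrite modz_small ?absz_nat // ltz_nat ltn_ord.
- by exists v => // w /kE.
Qed.

Lemma exactly_lines_isogenies N (P : isogeny A -> Prop) (Q : set K -> Prop) :
    (forall phi, l_isogeny l ell iota phi -> P phi <-> Q (shadow phi)) ->
    exactly_lines K0 O alpha AA N Q ->
  exactly_up_to_iso N (fun phi => l_isogeny l ell iota phi /\ P phi).
Proof.
move=> PQ [t [tP t_inj tall]].
have /choice[p pP] i : exists phi, l_isogeny l ell iota phi /\ shadow phi = extension AA (t i).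
  by have [/line_isogeny[phi lphi e] _] := tP i; exists phi.
exists p; split=> [i|i j /isog_iso_shadow iso|phi [lphi Pphi]].
- have [lp sp] := pP i; split=> //; apply/PQ => //; rewrite sp.
  by case: (tP i).
- have [lp sp] := pP i; have [lq sq] := pP j.
  by apply: t_inj; rewrite -sp -sq; apply: iso; apply: l_isogeny_on_line.
have [g pg sg] := l_isogeny_line lphi.
have [|i iE] := tall g pg; first by rewrite -sg; apply/PQ.
exists i; have [lp sp] := pP i; apply/isog_iso_shadow; try exact: l_isogeny_on_line.
by rewrite sg sp.
Qed.
End Isogenies.
End Surface.
End Transport.

Theorem proposition21 (R : realType) (K : fieldExtType rat)
    (hK : primitive_quartic_CM R K)
    (hK5 : ~ exists2 z : K, 5.-primitive_root z & <<1; z>>%VS = {:K}%VS)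
    (K0 : {subfield K}) (hK0 : real_quadratic R K0)
    (hcl : class_number_one K0)
    (l : set K) (hl : is_ideal (integers K0) l)
    (ell : nat) (hell : prime ell) (hnorm : has_index (integers K0) l ell)
    (hgen : exists alpha : subvs_of K0,
       [/\ integers K0 (vsval alpha), totally_positive R alpha
         & l = principal (integers K0) (vsval alpha)])
    (A : abelian_surface R) (hA : principally_polarizable A)
    (O : set K) (hO : is_order O)
    (iota : {rmorphism K -> 'M[R[i]]_2})
    (hEnd : endo_ring A = [set iota x | x in O])
    (hRM : locally_maximal_RM K0 O ell) :
  (coprime_ideals (integers {:K}) (extended_ideal l) (conductor O) ->
     [/\ splits l ->
           exactly_up_to_iso 2
             (fun phi : isogeny A => l_isogeny l ell iota phi /\ horizontal iota phi) /\
           (forall phi : isogeny A, l_isogeny l ell iota phi ->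
              ~ horizontal iota phi -> descending K0 l iota phi),
         ramifies l ->
           exactly_up_to_iso 1
             (fun phi : isogeny A => l_isogeny l ell iota phi /\ horizontal iota phi) /\
           (forall phi : isogeny A, l_isogeny l ell iota phi ->
              ~ horizontal iota phi -> descending K0 l iota phi)
       & inert l ->
           exactly_up_to_iso ell.+1 (fun phi : isogeny A => l_isogeny l ell iota phi) /\
           (forall phi : isogeny A, l_isogeny l ell iota phi ->
              descending K0 l iota phi)]) /\
  (~ coprime_ideals (integers {:K}) (extended_ideal l) (conductor O) ->
     exactly_up_to_iso 1
       (fun phi : isogeny A => l_isogeny l ell iota phi /\ ascending K0 l iota phi) /\
     exactly_up_to_iso ell
       (fun phi : isogeny A =>
          l_isogeny l ell iota phi /\ descending K0 l iota phi)).
Proof.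
have [_ dK _] := hK; have [dK0 _] := hK0; have [alpha' [Zalpha _ lE]] := hgen.
set alpha := vsval alpha' in Zalpha lE; subst l.
have [v0 [X [v00 Lv0 LX Lgen]]] := lattice_rank_one dK hO hEnd.
set l := principal _ _ in hl hnorm hgen *.
have onl := l_isogeny_on_line hO hEnd hell hnorm Lgen.
have to_line := l_isogeny_line hO hEnd hell hnorm Lgen.
have exact_lines := exactly_lines_isogenies hO hEnd hell hnorm Lgen.
have srcE : order_of_source A iota = O.
  by apply/seteqP; split=> x; [exact: (order_endo hEnd x).1 | exact: (order_endo hEnd x).2].
have tgtE (phi : isogeny A) : l_isogeny l ell iota phi -> order_of_target iota phi =
  multipliers (shadow iota v0 phi).
  by move=> lphi; exact: target_multipliers (onl _ lphi).
have horE (phi : isogeny A) : l_isogeny l ell iota phi ->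
  horizontal iota phi <-> line_horizontal O (shadow iota v0 phi).
  by move=> lphi; rewrite /horizontal srcE tgtE.
have descE (phi : isogeny A) : l_isogeny l ell iota phi ->
    descending K0 l iota phi <-> line_descending K0 O alpha (shadow iota v0 phi).
  by move=> lphi; rewrite /descending srcE tgtE.
have ascE (phi : isogeny A) : l_isogeny l ell iota phi ->
    ascending K0 l iota phi <-> line_ascending K0 O alpha (shadow iota v0 phi).
  by move=> lphi; rewrite /ascending srcE tgtE.
have others (lines := fun g => proper_line K0 O alpha [set x | lattice A (iota x *m v0)] g) :
    (forall g, lines g -> ~ line_horizontal O (extension [set x | lattice A (iota x *m v0)] g) ->
       line_descending K0 O alpha (extension [set x | lattice A (iota x *m v0)] g)) ->
    forall phi : isogeny A, l_isogeny l ell iota phi -> ~ horizontal iota phi ->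
      descending K0 l iota phi.
  move=> H phi lphi nh; have [g pg sg] := to_line _ lphi.
  by apply/descE => //; rewrite sg; apply: H => //; rewrite -sg; apply/horE.
have [cop ncop] := line_classification dK0 dK hO hell Zalpha hnorm hRM LX
  (shadow1 iota Lv0) (shadow_multiplier hEnd Lgen).
split=> [/cop[spl ram ine] | /ncop[asc desc]]; last by split; apply: exact_lines; eassumption.
split=> [/spl[two oth] | /ram[one oth] | /ine[all oth]].
- by split; [apply: exact_lines horE two | apply: others].
- by split; [apply: exact_lines horE one | apply: others].
split=> [|phi lphi]; last first.
  have [g pg sg] := to_line _ lphi.
  by apply/descE => //; rewrite sg; apply: oth.
(* In the inert case all l-isogenies are counted, which is the transfer with a trivial predicate on
   both sides. *)
have [t [tP t_inj tall]] := exact_lines _ (fun=> True) _ (fun _ _ => conj id id) all.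
exists t; split=> // [i|phi lphi]; first by case: (tP i).
exact: tall.
Qed.
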